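(* Consider either discrete time or continuous time. (Discrete time) For each $k\in\mathbb{Z}_+$ the step from time $k$ to $k+1$ is either a Bernoulli step with parameter $\alpha_k$, $0\le\alpha_k\le(\sup_xa_x)^{-1}$, and $f_{k,k+1}(z)=1-\alpha_kz$, or a geometric step with parameter $\beta_k$, $0\le\beta_k<(\sup_xa_x-\inf_xa_x)^{-1}$ (no upper bound if $\mathbf a$ is constant), and $f_{k,k+1}(z)=(1+\beta_kz)^{-1}$; set $f_{s,t}=\prod_{i=s}^{t-1}f_{i,i+1}$. (Continuous time) $f_{s,t}(z)=e^{-(t-s)z}$. Let $N\ge1$, $s\le t$, $\mathbf x\in\mathbb{W}_N$ and $\mathbf y\in\overline{\mathbb{W}}_N$. Then the (signed) measure on $\mathbb{IA}_N$ $$(\mathbf z^{(1)},\dots,\mathbf z^{(N)})\mapsto\det\left(\left(-a_{x_i}\nabla_{x_i}^+\right)^{N-i}\mathsf{T}_{f_{s,t}}(x_i,z_j^{(N)})\right)_{i,j=1}^N\prod_{n=1}^{N-1}\det\left(\phi(z_i^{(n)},z_j^{(n+1)})\right)_{i,j=1}^{n+1}$$ has $\mathfrak{E}^{(N)}_{f_{s,t},\mathrm r}(\mathbf x,\cdot)$ as its right edge marginal on coordinates $(z_1^{(1)},z_2^{(2)},\dots,z_N^{(N)})$. Moreover, the (signed) measure on $\mathbb{IA}_N$ $$(\mathbf z^{(1)},\dots,\mathbf z^{(N)})\mapsto\det\left(\left(a_{y_i}\nabla_{y_i}^+\right)^{i-1}\mathsf{T}_{f_{s,t}}(y_i,z_j^{(N)})\right)_{i,j=1}^N\prod_{n=1}^{N-1}\det\left(\phi(z_i^{(n)},z_j^{(n+1)})\right)_{i,j=1}^{n+1}$$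 has $\mathfrak{E}^{(N)}_{f_{s,t},\mathrm l}(\mathbf y,\cdot)$ as its left edge marginal on coordinates $(z_1^{(N)},z_1^{(N-1)},\dots,z_1^{(1)})$. In particular, both $\mathfrak{E}^{(N)}_{f_{s,t},\mathrm r}(\mathbf x,\cdot)$ and $\mathfrak{E}^{(N)}_{f_{s,t},\mathrm l}(\mathbf y,\cdot)$ are marginals of (signed) measures with determinantal correlation functions.
   Context: $\mathbb{Z}_+=\{0,1,2,\dots\}$. $\mathbf a=(a_x)_{x\in\mathbb{Z}_+}$ is a fixed real sequence with $\inf_xa_x>0$, $\sup_xa_x<\infty$. $p_0(z)=1$, $p_x(z)=\prod_{k=0}^{x-1}(1-z/a_k)$. For $f$ holomorphic in $\{\Re z>-\epsilon\}$ for some $\epsilon>0$, $\mathsf{T}_f(x,y)=-\frac{1}{2\pi \mathrm{i}}\frac{1}{a_y}\oint_{\mathsf{C}_{\mathbf a}}\frac{p_x(w)}{p_{y+1}(w)}f(w)dw$, with $\mathsf{C}_{\mathbf a}\subset\{\Re z>-\epsilon\}$ a positively oriented contour encircling all $a_x$. $\mathbb{W}_N=\{(x_1,\dots,x_N)\in\mathbb{Z}_+^N:x_1<\dots<x_N\}$, $\overline{\mathbb{W}}_N=\{(x_1,\dots,x_N)\in\mathbb{Z}_+^N:x_1\le\dots\le x_N\}$. For $\mathbf x\in\mathbb{W}_n,\mathbf y\in\mathbb{W}_{n+1}$, $\mathbf x\prec\mathbf y$ means $y_1\le x_1<y_2\le\dots\le x_n<y_{n+1}$. $\mathbb{IA}_N=\{(\mathbf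 z^{(1)},\dots,\mathbf z^{(N)})\in\mathbb{W}_1\times\dots\times\mathbb{W}_N:\mathbf z^{(i)}\prec\mathbf z^{(i+1)},\ 1\le i\le N-1\}$. $\nabla^+g(x)=g(x+1)-g(x)$; $(\mp a_x\nabla^+_x)^k$ is the $k$-th iterate of the operator $g\mapsto\mp a_x\nabla^+g(x)$ acting in the variable $x$. $\phi(x,y)=-a_x^{-1}\mathbf 1_{y>x}$ for $x,y\in\mathbb{Z}_+$ and $\phi(\mathsf{virt},y)=1$, where $\mathsf{virt}$ is an extra symbol; in the determinants, $z^{(n)}_{n+1}=\mathsf{virt}$. A (signed) measure $\mu$ on $\mathbb{IA}_N$ has determinantal correlation functions if there is a kernel $K$ on $(\{1,\dots,N\}\times\mathbb{Z}_+)^2$ such that for all $m\ge 1$ and pairwise distinct $(n_1,u_1),\dots,(n_m,u_m)\in\{1,\dots,N\}\times\mathbb{Z}_+$, the $\mu$-mass of the set of arrays for which $u_i$ is a coordinate of $\mathbf z^{(n_i)}$ for every $i$ equals $\det(K[(n_i,u_i);(n_j,u_j)])_{i,j=1}^m$. $\mathfrak{E}^{(N)}_{f_{s,t},\mathrm r}$ and $\mathfrak{E}^{(N)}_{f_{s,t},\mathrm l}$ are the transition kernels from time $s$ to time $t$ of the right-edge system $(\mathsf{X}_1^{(1)},\dots,\mathsf{X}_N^{(N)})$ on $\mathbb{W}_N$ and of the left-edge system $(\mathsf{X}_1^{(N)},\mathsf{X}_1^{(N-1)},\dots,\mathsf{X}_1^{(1)})$ on $\overline{\mathbb{W}}_N$,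 which evolve as follows (all random variables for different particles and time-steps independent; $\mathsf{X}_0^{(0)}=-\infty$ for the right edge and $\mathsf{X}_1^{(0)}=+\infty$ for the left edge): Bernoulli step with parameter $\alpha$: with independent $\{0,1\}$-valued $\mathsf{B}^{(n)}(x)$, $\mathbb{P}(\mathsf{B}^{(n)}(x)=1)=\alpha a_x$: right edge $\mathsf{X}_n^{(n)}(t+1)=\max\{\mathsf{X}_{n-1}^{(n-1)}(t+1)+1,\ \mathsf{X}_n^{(n)}(t)+\mathsf{B}^{(n)}(\mathsf{X}_n^{(n)}(t))\}$; left edge $\mathsf{X}_1^{(n)}(t+1)=\min\{\mathsf{X}_1^{(n-1)}(t+1),\ \mathsf{X}_1^{(n)}(t)+\mathsf{B}^{(n)}(\mathsf{X}_1^{(n)}(t))\}$. Geometric step with parameter $\beta$: with independent $\mathsf{G}^{(n)}(x)$, $\mathbb{P}(\mathsf{G}^{(n)}(x)=m)=(1+\beta a_{x+m})^{-1}\prod_{k=x}^{x+m-1}\beta a_k(1+\beta a_k)^{-1}$, $m\in\mathbb{Z}_+$: right edge, with $\mathsf m=\max\{\mathsf{X}_n^{(n)}(t),\mathsf{X}_{n-1}^{(n-1)}(t+1)+1\}$, $\mathsf{X}_n^{(n)}(t+1)=\mathsf m+\mathsf{G}^{(n)}(\mathsf m)$; left edge $\mathsf{X}_1^{(n)}(t+1)=\min\{\mathsf{X}_1^{(n-1)}(t),\ \mathsf{X}_1^{(n)}(t)+\mathsf{G}^{(n)}(\mathsf{X}_1^{(n)}(t))\}$. Continuous time: each particle at $x$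 has an independent exponential clock of rate $a_x$. Right edge: when the clock of $\mathsf{X}_n^{(n)}=x$ rings it moves to $x+1$, and if $\mathsf{X}_{n+1}^{(n+1)}=x+1$ it is instantaneously pushed to $x+2$, and so on for higher $n$. Left edge: when the clock of $\mathsf{X}_1^{(n)}=x$ rings it moves to $x+1$ unless $\mathsf{X}_1^{(n-1)}=x$, in which case nothing happens. *)

(* Defs.v *)
From HB Require Import structures.
From mathcomp Require Import all_boot all_order all_algebra.
From mathcomp Require Import complex.
From mathcomp Require Import all_classical all_reals all_analysis.

Set Implicit Arguments.
Unset Strict Implicit.
Unset Printing Implicit Defensive.

Import Order.TTheory GRing.Theory Num.Theory.
Import numFieldNormedType.Exports.

Local Open Scope classical_set_scope.
Local Open Scope ring_scope.
Local Open Scope complex_scope.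

Local Notation Re := complex.Re.
Local Notation Im := complex.Im.

(* All indices start at 0: a level, particle or coordinate number [k.+1] of
   the usual numbering is [k] here. *)

Definition cexp (R : realType) (z : R[i]) : R[i] :=
  (expR (Re z) * cos (Im z)) +i* (expR (Re z) * sin (Im z)).

Definition holomorphic_on (R : realType) (D : set R[i]) (f : R[i] -> R[i]) :=
  forall z, D z -> derivable (f : (R[i])^o -> (R[i])^o) z 1.

Definition C1_real (R : realType) (u : R -> R) :=
  (forall t : R, derivable u t 1) /\ continuous (derive1 u).

(* A closed C^1 curve, parametrised by the restriction of [gamma] to [0, 1].
   The speed is allowed to vanish, so that every closed piecewise C^1 curve has
   such a parametrisation. *)
Definition closed_curve (R : realType) (gamma : R -> R[i]) :=
  [/\ C1_real (fun t => Re (gamma t)), C1_real (fun t => Im (gamma t))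
    & gamma 0 = gamma 1].

Definition velocity (R : realType) (gamma : R -> R[i]) (t : R) : R[i] :=
  derive1 (fun u => Re (gamma u)) t +i* derive1 (fun u => Im (gamma u)) t.

Definition contour_integral (R : realType) (gamma : R -> R[i])
    (F : R[i] -> R[i]) : R[i] :=
  (\int[lebesgue_measure]_(t in `[0, 1]) Re (F (gamma t) * velocity gamma t))
  +i*
  (\int[lebesgue_measure]_(t in `[0, 1]) Im (F (gamma t) * velocity gamma t)).

Definition two_pi_i (R : realType) : R[i] := 0 +i* (2 * pi).

(* [gamma] avoids [c] and has winding number 1 around it. *)
Definition encircles (R : realType) (gamma : R -> R[i]) (c : R[i]) :=
  (forall t : R, t \in `[0, 1] -> gamma t != c) /\
  contour_integral gamma (fun w => (w - c)^-1) = two_pi_i R.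

Definition right_half_plane (R : realType) (eps : R) : set R[i] :=
  [set z | - eps < Re z].

(* [gamma] may serve as the contour in the definition of [T_f]. *)
Definition admissible_contour (R : realType) (a : nat -> R)
    (f : R[i] -> R[i]) (gamma : R -> R[i]) :=
  closed_curve gamma /\
  (exists eps : R, [/\ 0 < eps, holomorphic_on (right_half_plane eps) f
     & forall t : R, t \in `[0, 1] -> right_half_plane eps (gamma t)]) /\
  (forall x, encircles gamma (a x)%:C).

Definition charpol (R : realType) (a : nat -> R) (x : nat) (z : R[i]) : R[i] :=
  \prod_(k < x) (1 - z / (a k)%:C).

(* For the functions [f] considered here, [f] commutes with complex
   conjugation, so that the complex number below is real. *)
Definition Tf (R : realType) (a : nat -> R) (gamma : R -> R[i])
    (f : R[i] -> R[i]) (x y : nat) : R :=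
  Re (- (two_pi_i R)^-1 * ((a y)%:C)^-1 *
      contour_integral gamma
        (fun w => charpol a x w / charpol a y.+1 w * f w)).

Definition weyl (N : nat) : set (N.-tuple nat) := [set x | sorted ltn x].
Definition weyl_closed (N : nat) : set (N.-tuple nat) :=
  [set x | sorted leq x].

(* An array is the sequence of its levels, the level [n] (0-based) having
   [n.+1] coordinates. *)
Definition array := seq (seq nat).
Definition level (z : array) (n : nat) : seq nat := nth [::] z n.
Definition entry (z : array) (n i : nat) : nat := nth 0%N (level z n) i.

Definition IA (N : nat) : set array :=
  [set z | [/\ size z = N,
     forall n, (n < N)%N -> size (level z n) = n.+1 /\ sorted ltn (level z n)
   & forall n i, (n.+1 < N)%N -> (i < n.+1)%N ->
       (entry z n.+1 i <= entry z n i < entry z n.+1 i.+1)%N]].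

Definition right_edge (N : nat) (z : array) : N.-tuple nat :=
  [tuple entry z i i | i < N].

Definition left_edge (N : nat) (z : array) : N.-tuple nat :=
  [tuple entry z (N.-1 - i) 0 | i < N].

Definition fdiff (R : realType) (g : nat -> R) (x : nat) : R := g x.+1 - g x.

(* [None] stands for the virtual symbol. *)
Definition phi (R : realType) (a : nat -> R) (x : option nat) (y : nat) : R :=
  if x is Some x' then - (a x')^-1 * (x' < y)%N%:R else 1.

Definition ext_entry (z : array) (n i : nat) : option nat :=
  if (i < n.+1)%N then Some (entry z n i) else None.

Definition phi_weight (R : realType) (a : nat -> R) (N : nat) (z : array) : R :=
  \prod_(n < N.-1)
    \det (\matrix_(i < n.+2, j < n.+2)
            phi a (ext_entry z n i) (entry z n.+1 j)).

Definition right_weight (R : realType) (a : nat -> R) (N : nat)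
    (T : nat -> nat -> R) (x : N.-tuple nat) (z : array) : R :=
  \det (\matrix_(i < N, j < N)
          iter (N.-1 - i) (fun g u => - a u * fdiff g u)
            (fun u => T u (entry z N.-1 j)) (tnth x i))
  * phi_weight a N z.

Definition left_weight (R : realType) (a : nat -> R) (N : nat)
    (T : nat -> nat -> R) (y : N.-tuple nat) (z : array) : R :=
  \det (\matrix_(i < N, j < N)
          iter i (fun g u => a u * fdiff g u)
            (fun u => T u (entry z N.-1 j)) (tnth y i))
  * phi_weight a N z.

Definition is_signed_measure (R : realType) (D : set array) (W : array -> R) :=
  summable D (EFin \o W).

Definition mass (R : realType) (W : array -> R) (A : set array) : R :=
  fine (\esum_(z in A) ((EFin \o W)^\+ z)%E - \esum_(z in A) ((EFin \o W)^\- z)%E)%E.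

Definition has_marginal (R : realType) (N : nat) (W : array -> R)
    (edge : array -> N.-tuple nat) (S : set (N.-tuple nat))
    (mu : N.-tuple nat -> R) :=
  forall v, S v -> mass W (IA N `&` [set z | edge z = v]) = mu v.

Definition determinantal (R : realType) (N : nat) (W : array -> R) :=
  exists K : 'I_N * nat -> 'I_N * nat -> R,
  forall (m : nat) (q : m.-tuple ('I_N * nat)), (0 < m)%N -> uniq q ->
    mass W (IA N `&`
      [set z | forall i : 'I_m, (tnth q i).2 \in level z (tnth q i).1])
    = \det (\matrix_(i < m, j < m) K (tnth q i) (tnth q j)).

Inductive step (R : realType) := Bernoulli of R | Geometric of R.

Definition step_ok (R : realType) (a : nat -> R) (st : step R) : Prop :=
  match st with
  | Bernoulli alpha => 0 <= alpha <= (sup (range a))^-1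
  | Geometric beta => 0 <= beta /\
      (inf (range a) < sup (range a) ->
       beta < (sup (range a) - inf (range a))^-1)
  end.

Definition step_fun (R : realType) (st : step R) (z : R[i]) : R[i] :=
  match st with
  | Bernoulli alpha => 1 - alpha%:C * z
  | Geometric beta => (1 + beta%:C * z)^-1
  end.

Definition discrete_f (R : realType) (st : nat -> step R) (s t : nat)
    (z : R[i]) : R[i] :=
  \prod_(s <= k < t) step_fun (st k) z.

Definition noise_pmf (R : realType) (a : nat -> R) (st : step R)
    (x m : nat) : R :=
  match st with
  | Bernoulli alpha =>
      if m is m'.+1 then (if m' is 0 then alpha * a x else 0)
      else 1 - alpha * a x
  | Geometric beta =>
      (1 + beta * a (x + m)%N)^-1 *
      \prod_(x <= k < (x + m)%N) (beta * a k * (1 + beta * a k)^-1)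
  end.

Definition mutually_independent d (Omega : measurableType d) (R : realType)
    (P : probability Omega R) (I : eqType) (X : I -> Omega -> nat) :=
  forall (J : seq I) (A : I -> set nat), uniq J ->
    fine (P (\bigcap_(i in [set` J]) (X i @^-1` A i)))
    = \prod_(i <- J) fine (P (X i @^-1` A i)).

(* [xi (k, n, x)] is the variable attached to the step from time [k] to [k.+1],
   the particle [n] and the position [x]. *)
Definition is_noise d (Omega : measurableType d) (R : realType)
    (P : probability Omega R) (a : nat -> R) (st : nat -> step R)
    (xi : nat * nat * nat -> Omega -> nat) :=
  [/\ forall i, measurable_fun setT (xi i),
      mutually_independent P xi
    & forall k n x m,
        P (xi (k, n, x) @^-1` [set m]) = (noise_pmf a (st k) x m)%:E].

(* In the four updates below, [x] is the old configuration, [b n u] (resp.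
   [g n u]) the value of the noise of particle [n] at position [u], and the
   result is the new position of particle [n]. *)

Fixpoint right_bernoulli (b : nat -> nat -> nat) (x : nat -> nat)
    (n : nat) : nat :=
  let free := (x n + b n (x n))%N in
  if n is n'.+1 then maxn (right_bernoulli b x n').+1 free else free.

Fixpoint right_geometric (g : nat -> nat -> nat) (x : nat -> nat)
    (n : nat) : nat :=
  let m := if n is n'.+1 then maxn (x n) (right_geometric g x n').+1
           else x n in
  (m + g n m)%N.

Fixpoint left_bernoulli (b : nat -> nat -> nat) (x : nat -> nat)
    (n : nat) : nat :=
  let free := (x n + b n (x n))%N in
  if n is n'.+1 then minn (left_bernoulli b x n') free else free.

Definition left_geometric (g : nat -> nat -> nat) (x : nat -> nat)
    (n : nat) : nat :=
  let free := (x n + g n (x n))%N in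
  if n is n'.+1 then minn (x n') free else free.

Definition right_update (R : realType) (st : step R) :=
  match st with
  | Bernoulli _ => right_bernoulli
  | Geometric _ => right_geometric
  end.

Definition left_update (R : realType) (st : step R) :=
  match st with
  | Bernoulli _ => left_bernoulli
  | Geometric _ => left_geometric
  end.

(* The left edge system is stored as the weakly increasing tuple
   (X_1^(N), ..., X_1^(1)): particle [n] is the entry [N.-1 - n]. *)

Definition right_move (R : realType) (st : step R) (N : nat)
    (xi : nat -> nat -> nat) (x : N.-tuple nat) : N.-tuple nat :=
  [tuple right_update st xi (nth 0%N x) i | i < N].

Definition left_move (R : realType) (st : step R) (N : nat)
    (xi : nat -> nat -> nat) (y : N.-tuple nat) : N.-tuple nat :=
  [tuple left_update st xi (nth 0%N (rev y)) (N.-1 - i) | i < N].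

(* The configuration at time [s + k] of the system started from [x] at time
   [s], for a given realisation of the noise. *)

Fixpoint right_chain (R : realType) (st : nat -> step R) (N : nat)
    (xi : nat * nat * nat -> nat) (s : nat) (x : N.-tuple nat) (k : nat)
    : N.-tuple nat :=
  if k is k'.+1 then
    right_move (st (s + k')%N) (fun n u => xi ((s + k')%N, n, u))
      (right_chain st xi s x k')
  else x.

Fixpoint left_chain (R : realType) (st : nat -> step R) (N : nat)
    (xi : nat * nat * nat -> nat) (s : nat) (y : N.-tuple nat) (k : nat)
    : N.-tuple nat :=
  if k is k'.+1 then
    left_move (st (s + k')%N) (fun n u => xi ((s + k')%N, n, u))
      (left_chain st xi s y k')
  else y.

Definition E_right_discrete d (Omega : measurableType d) (R : realType)
    (P : probability Omega R) (st : nat -> step R)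
    (xi : nat * nat * nat -> Omega -> nat) (N s t : nat)
    (x v : N.-tuple nat) : R :=
  fine (P [set w | right_chain st (fun i => xi i w) s x (t - s) = v]).

Definition E_left_discrete d (Omega : measurableType d) (R : realType)
    (P : probability Omega R) (st : nat -> step R)
    (xi : nat * nat * nat -> Omega -> nat) (N s t : nat)
    (y v : N.-tuple nat) : R :=
  fine (P [set w | left_chain st (fun i => xi i w) s y (t - s) = v]).

Definition continuous_f (R : realType) (s t : R) (z : R[i]) : R[i] :=
  cexp (- (t - s)%:C * z).

(* The position of particle [m] after the clock of particle [n] rings. *)

Fixpoint right_push (n : nat) (x : nat -> nat) (m : nat) : nat :=
  if (m < n)%N then x m
  else if m == n then (x m).+1
  else if m is m'.+1 then
    (* particle [m] is pushed if particle [m'] has just landed on it *)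
    (if x m == right_push n x m' then (x m).+1 else x m)
  else x m.

Definition left_block (n : nat) (x : nat -> nat) (m : nat) : nat :=
  if m == n then
    (if n is n'.+1 then (if x n' == x n then x n else (x n).+1)
     else (x n).+1)
  else x m.

Definition right_ring (N : nat) (n : 'I_N) (x : N.-tuple nat) : N.-tuple nat :=
  [tuple right_push n (nth 0%N x) i | i < N].

Definition left_ring (N : nat) (n : 'I_N) (y : N.-tuple nat) : N.-tuple nat :=
  [tuple left_block n (nth 0%N (rev y)) (N.-1 - i) | i < N].

Definition right_rate (R : realType) (a : nat -> R) (N : nat) (n : 'I_N)
    (x : N.-tuple nat) : R := a (nth 0%N x n).

Definition left_rate (R : realType) (a : nat -> R) (N : nat) (n : 'I_N)
    (y : N.-tuple nat) : R := a (nth 0%N (rev y) n).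

(* The entries of the matrix of jump rates of the continuous time Markov chain
   in which, in state [x], the clocks [n : 'I_N] ring independently at rates
   [rate n x], the state becoming [jump n x] when clock [n] rings. *)
Definition jump_generator (R : realType) (N : nat)
    (rate : 'I_N -> N.-tuple nat -> R)
    (jump : 'I_N -> N.-tuple nat -> N.-tuple nat) (x v : N.-tuple nat) : R :=
  \sum_(n < N) rate n x * ((jump n x == v)%:R - (x == v)%:R).

(* [p] is the transition function (p t x v is the probability of going from x
   to v in time t) of this Markov chain with state space [S]: a Markov
   semigroup such that, as h tends to 0, p h = Id + h * generator + o(h). *)
Definition is_transition_function (R : realType) (N : nat)
    (S : set (N.-tuple nat)) (rate : 'I_N -> N.-tuple nat -> R)
    (jump : 'I_N -> N.-tuple nat -> N.-tuple nat)
    (p : R -> N.-tuple nat -> N.-tuple nat -> R) :=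
  [/\ forall (t : R) x v, 0 <= t -> S x -> S v -> 0 <= p t x v,
      forall (t : R) x, 0 <= t -> S x -> \esum_(v in S) (p t x v)%:E = 1%:E,
      forall x v, S x -> S v -> p 0 x v = (x == v)%:R,
      forall (t u : R) x v, 0 <= t -> 0 <= u -> S x -> S v ->
        (p (t + u) x v)%:E = \esum_(w in S) (p t x w * p u w v)%:E
    & forall x v, S x -> S v ->
        (fun h : R => (p h x v - (x == v)%:R) / h) @ 0^'+
          --> jump_generator rate jump x v].

Definition is_right_transition (R : realType) (a : nat -> R) (N : nat)
    (p : R -> N.-tuple nat -> N.-tuple nat -> R) :=
  is_transition_function (@weyl N) (right_rate a (N := N)) (@right_ring N) p.

Definition is_left_transition (R : realType) (a : nat -> R) (N : nat)
    (p : R -> N.-tuple nat -> N.-tuple nat -> R) :=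
  is_transition_function (@weyl_closed N) (left_rate a (N := N))
    (@left_ring N) p.

Definition right_edge_claim (R : realType) (a : nat -> R) (N : nat)
    (T : nat -> nat -> R) (x : N.-tuple nat) (E : N.-tuple nat -> R) :=
  [/\ is_signed_measure (IA N) (right_weight a T x),
      has_marginal (right_weight a T x) (@right_edge N) (@weyl N) E
    & determinantal N (right_weight a T x)].

Definition left_edge_claim (R : realType) (a : nat -> R) (N : nat)
    (T : nat -> nat -> R) (y : N.-tuple nat) (E : N.-tuple nat -> R) :=
  [/\ is_signed_measure (IA N) (left_weight a T y),
      has_marginal (left_weight a T y) (@left_edge N) (@weyl_closed N) E
    & determinantal N (left_weight a T y)].

(* Main.v *)
(** With L g(u) = a_u (g(u + 1) - g(u)), the identity w p_x = a_x (p_x - p_{x+1})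
    shows that multiplying f by 1 - h w replaces T_f by (1 + h L) T_f.  Thus a
    Bernoulli step acts on T_f through 1 + alpha L, a geometric one through the
    inverse of 1 - beta L.

    The sum of the weights over the arrays with a prescribed edge v can be
    carried out level by level, because the determinants of phi turn into sums
    over ranges of a coordinate.  What is left is a single determinant H(x)
    with entries obtained from T_f and v by powers of L or of its inverse, and
    it satisfies the boundary relation H(.., u, u, ..) = H(.., u, u + 1, ..).
    This relation makes the blocking or pushing between particles invisible to
    H, so that H obeys the one-step equation of the edge system; for f = 1 it
    is the indicator of x = v.

    In continuous time, exp(-t w) is the limit of (1 - t w / n)^n, and n
    Bernoulli steps with parameter t / n converge to the given jump process.

    The correlations come from a generating function: the sum of the weights
    times prod_l (1 + t_l [q_l occurs in z]) is a determinant of a matrix that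
    is affine in t. *)

Require Import Defs.
From mathcomp Require Import all_boot all_order all_algebra.
From mathcomp Require Import fingroup perm complex.
From mathcomp Require Import all_classical all_reals all_analysis.
From mathcomp Require Import ring lra zify.
Set Implicit Arguments.
Unset Strict Implicit.
Unset Printing Implicit Defensive.
Import Order.TTheory GRing.Theory Num.Theory.
Import numFieldNormedType.Exports.
Local Open Scope classical_set_scope.
Local Open Scope ring_scope.

(** * One step of the edge dynamics under the boundary relation *)

Section Steps.
Variables (R : realType) (a : nat -> R).
Implicit Types (F G H : seq nat -> R) (l : seq nat) (M : nat) (th : R).

(** Contour integrals are evaluated by partial fractions alone: what remains are powers of [w] and
    higher powers of [(w - c)^-1], which have primitives, and simple poles, whose integrals are
    prescribed by the winding numbers or vanish because a logarithm exists to the right of [c].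
    Holomorphy of [f] enters through one fact: the contour stays to the right of the poles of the
    geometric factors. Identities over sites are first proved below some bound [M], where sums are
    finite; the limit pairs the geometric decay of [T_f(x, y)] in [y] with the polynomial growth of
    the summation kernels. The inverse of [1 - beta L] is never constructed: averaging
    [(1 - beta L) G] over a geometric step is shown to return [G]. In continuous time the derivative
    at 0 of the transition function is given state by state, without uniformity. Hence the
    comparison with Bernoulli walks is an induction on the number of jumps, using that one step from
    a given state reaches finitely many states. *)

Fixpoint shift_all th H l : R :=
  if l is u :: l' then
    (1 - th * a u) * shift_all th (fun k => H (u :: k)) l' +
    th * a u * shift_all th (fun k => H (u.+1 :: k)) l'
  else H [::].

Definition neumann H :=
  forall p q u, H (p ++ u :: u :: q) = H (p ++ u :: u.+1 :: q).

Definition vanishes_above M H := forall l u, u \in l -> (M <= u)%N -> H l = 0.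

Lemma neumann_cons H u : neumann H -> neumann (fun k => H (u :: k)).
Proof. by move=> nH p q w; rewrite -!cat_cons. Qed.

Lemma vanishes_above_cons M H u :
  vanishes_above M H -> vanishes_above M (fun k => H (u :: k)).
Proof. by move=> vH l w wl; apply: vH; rewrite inE wl orbT. Qed.

Lemma eq_shift_all th F G l :
  (forall k, size k = size l -> F k = G k) ->
  shift_all th F l = shift_all th G l.
Proof.
elim: l F G => [|u l IH] F G FG /=; first exact: FG.
by congr (_ * _ + _ * _); apply: IH => k sk; apply: FG; rewrite /= sk.
Qed.

Lemma shift_allD th F G l :
  shift_all th (fun k => F k + G k) l = shift_all th F l + shift_all th G l.
Proof. by elim: l F G => //= u l IH F G; rewrite !IH; ring. Qed.

Lemma shift_allZ th c F l :
  shift_all th (fun k => c * F k) l = c * shift_all th F l.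
Proof. by elim: l F => //= u l IH F; rewrite !IH; ring. Qed.

Lemma shift_all_sum th (I : Type) (r : seq I) (F : I -> seq nat -> R) l :
  shift_all th (fun k => \sum_(i <- r) F i k) l =
  \sum_(i <- r) shift_all th (F i) l.
Proof.
elim: r => [|i r IH].
  rewrite big_nil.
  under [LHS]eq_shift_all => k _ do rewrite big_nil -(mul0r 0).
  by rewrite shift_allZ mul0r.
rewrite big_cons -IH -shift_allD.
by apply: eq_shift_all => k _; rewrite big_cons.
Qed.

(** Each coordinate is averaged separately, so [1 + th L] falls on each factor of a product;
    determinants follow through their permutation expansion. *)
Lemma shift_all_prod th (f : nat -> nat -> R) l :
  shift_all th (fun k => \prod_(i < size k) f i (nth 0%N k i)) l =
  \prod_(i < size l)
    (f i (nth 0%N l i) + th * (a (nth 0%N l i) * fdiff (f i) (nth 0%N l i))).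
Proof.
elim: l f => [|u l IH] f /=; first by rewrite !big_ord0.
have E w : shift_all th (fun k => \prod_(i < (size k).+1)
     f i (nth 0%N (w :: k) i)) l = f 0%N w * \prod_(i < size l)
    (f i.+1 (nth 0%N l i) +
     th * (a (nth 0%N l i) * fdiff (f i.+1) (nth 0%N l i))).
  rewrite -(IH (fun i => f i.+1)) -shift_allZ.
  by apply: eq_shift_all => k _; rewrite big_ord_recl.
by rewrite !E big_ord_recl /= /fdiff; ring.
Qed.

(** [q] is the lowest site open to the next particle, one above the new position of the previous
    one; in [left_bits] below, [p] is the highest open site. A missing bit counts as [false]. *)
Fixpoint right_bits (q : nat) l (b : seq bool) : seq nat :=
  if l is u :: l' then
    let w := maxn q (u + head false b) in w :: right_bits w.+1 l' (behead b)
  else [::].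

Fixpoint left_bits (p : nat) l (b : seq bool) : seq nat :=
  if l is u :: l' then
    let w := minn p (u + head false b) in w :: left_bits w l' (behead b)
  else [::].

Fixpoint free_bits l (b : seq bool) : seq nat :=
  if l is u :: l' then
    (u + head false b)%N :: free_bits l' (behead b)
  else [::].

(** The hypothesis says that [c] is the old position of the previous particle or one more. A push
    matters only at [u = c] with bit 0: the free rule leaves the particle at [u], the push takes it
    to [u + 1], and the Neumann relation does not see the difference. *)
Lemma right_bits_free G l b c : neumann G ->
    path ltn c l || path ltn c.-1 l && (0 < c)%N ->
  G (c :: right_bits c.+1 l b) = G (c :: free_bits l b).
Proof.
elim: l b c G => //= u l IH b c G nG H.
have [ltcu|leuc] := ltnP c u.
  have -> : maxn c.+1 (u + head false b) = (u + head false b)%N by lia.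
  rewrite (IH (behead b) _ (fun k => G (c :: k))) //; first exact: neumann_cons.
  case: (head false b) => /=; last by rewrite addn0; move: H; lia.
  by rewrite addn1 /= orbC; move: H; lia.
have Ec : c = u by move: H; lia.
subst c; have -> : maxn u.+1 (u + head false b) = u.+1.
  by case: (head false b); lia.
rewrite (IH _ _ (fun k => G (u :: k))); last 2 first.
- exact: neumann_cons.
- by move: H; rewrite ltnn /=; case/andP => /andP[_ ->] _; rewrite orbT.
case: (head false b); first by rewrite addn1.
by rewrite addn0; have := nG [::] (free_bits l (behead b)) u.
Qed.

Lemma right_bits0_free G l b : neumann G -> sorted ltn l ->
  G (right_bits 0 l b) = G (free_bits l b).
Proof.
case: l => //= u l nG pl; rewrite max0n right_bits_free //.
by case: (head false b); rewrite /= ?addn0 ?addn1 pl ?orbT.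
Qed.

(** Blocking matters only at [u = c] with bit 1: the free rule gives [u + 1], the blocked one [u],
    and the Neumann relation identifies them. *)
Lemma left_bits_free G l b c : neumann G -> path geq c l ->
  G (c :: left_bits c l b) = G (c :: free_bits l b).
Proof.
elim: l b c G => //= u l IH b c G nG /andP[leuc pl].
have [ltuc|lecu] := ltnP u c.
  have -> : minn c (u + head false b) = (u + head false b)%N.
    by case: (head false b); lia.
  rewrite (IH (behead b) _ (fun k => G (c :: k))) //; first exact: neumann_cons.
  by case: l pl {IH} => //= w l /andP[wu ->]; rewrite andbT /geq /=; move: wu => /=; lia.
have Ec : c = u by move: leuc => /=; lia.
subst c; have -> : minn u (u + head false b) = u by lia.
rewrite (IH _ _ (fun k => G (u :: k))) //; last exact: neumann_cons.
case: (head false b); rewrite ?addn0 // addn1.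
by have := nG [::] (free_bits l (behead b)) u.
Qed.

(** A barrier at [M], strictly above all particles, never shortens a unit jump and so stands for no
    barrier at all. *)
Lemma left_bits0_free G l b M : neumann G -> sorted geq l -> all (ltn^~ M) l ->
  G (left_bits M l b) = G (free_bits l b).
Proof.
case: l => //= u l nG pl /andP[uM _].
have -> : minn M (u + head false b) = (u + head false b)%N.
  by case: (head false b); move: uM => /=; lia.
apply: left_bits_free => //.
by case: l pl => //= w l /andP[wu ->]; rewrite andbT /geq /=; move: wu => /=; lia.
Qed.

(* The expectation over independent bits, the bit attached to [u] having mean
   [th * a u]. *)
Fixpoint bits_mean th l (F : seq bool -> R) : R :=
  if l is u :: l' then
    (1 - th * a u) * bits_mean th l' (fun b => F (false :: b)) +
    th * a u * bits_mean th l' (fun b => F (true :: b))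
  else F [::].

Lemma eq_bits_mean th l (F G : seq bool -> R) :
  (forall b, F b = G b) -> bits_mean th l F = bits_mean th l G.
Proof.
elim: l F G => [|u l IH] F G FG /=; first exact: FG.
by congr (_ * _ + _ * _); apply: IH => b; apply: FG.
Qed.

Lemma bits_mean_free th l H :
  bits_mean th l (fun b => H (free_bits l b)) = shift_all th H l.
Proof.
elim: l H => //= u l IH H; rewrite addn0 addn1.
by rewrite (IH (fun k => H (u :: k))) (IH (fun k => H (u.+1 :: k))).
Qed.

Lemma bits_mean_right th H l : neumann H -> sorted ltn l ->
  bits_mean th l (fun b => H (right_bits 0 l b)) = shift_all th H l.
Proof.
move=> nH sl; rewrite -bits_mean_free.
by apply: eq_bits_mean => b; rewrite right_bits0_free.
Qed.

Lemma bits_mean_left th H l M : neumann H -> sorted geq l ->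
    all (ltn^~ M) l ->
  bits_mean th l (fun b => H (left_bits M l b)) = shift_all th H l.
Proof.
move=> nH sl lM; rewrite -bits_mean_free.
by apply: eq_bits_mean => b; rewrite (left_bits0_free b nH sl lM).
Qed.

(** For [be >= 0], the probability that a geometric jump from [m] gets to [c] or beyond; [geo] is
    the probability of landing exactly at [c]. *)
Definition reach (be : R) (m c : nat) : R :=
  \prod_(m <= k < c) (be * a k * (1 + be * a k)^-1).

Definition geo (be : R) (m c : nat) : R :=
  if (m <= c)%N then (1 + be * a c)^-1 * reach be m c else 0.

(* The law of [min(p, u + g)], with [g] the geometric variable attached to [u]. *)
Definition geo_stop (be : R) (p u c : nat) : R :=
  if (c < p)%N then geo be u c else if c == p then reach be u p else 0.

(** For [c >= m], [geo m c] times [1 + be a_c] is [reach m c] and times [be a_c] is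
    [reach m (c + 1)], so the sum telescopes. The mean of [(1 - be L) U] over a geometric jump is
    thus [U m], up to the mass that passes [M]. *)
Lemma sum_geo be (U : nat -> R) m M : (forall c, 1 + be * a c != 0) ->
    (m <= M)%N ->
  \sum_(c < M) geo be m c * ((1 + be * a c) * U c - be * a c * U c.+1) =
  U m - reach be m M * U M.
Proof.
move=> nz mM; rewrite -(big_mkord xpredT (fun c => geo be m c * ((1 + be * a c) * U c - be * a c * U c.+1))).
rewrite (big_cat_nat (n := m)) //= [X in X + _]big_nat_cond [X in X + _]big1 ?add0r; last first.
  by move=> c /andP[/andP[_ cm] _]; rewrite /geo leqNgt cm mul0r.
have e : U m = reach be m m * U m by rewrite /reach big_geq // mul1r.
rewrite [in RHS]e -[RHS]opprB.
rewrite -(telescope_sumr (fun c => reach be m c * U c)) //.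
rewrite -sumrN; apply: eq_big_nat => c /andP[mc _].
rewrite /geo mc /reach big_nat_recr //=.
by field.
Qed.

Fixpoint right_geo_sum be M (q : nat) l F : R :=
  if l is u :: l' then
    \sum_(c < M) geo be (maxn q u) c *
       right_geo_sum be M c.+1 l' (fun k => F ((c : nat) :: k))
  else F [::].

(** The next particle is stopped by the old position [u] of this one, not by its new position [c]:
    the geometric left edge is updated in parallel. *)
Fixpoint left_geo_sum be M (p : nat) l F : R :=
  if l is u :: l' then
    \sum_(c < M) geo_stop be p u c *
       left_geo_sum be M u l' (fun k => F ((c : nat) :: k))
  else F [::].

Lemma right_geo_sum_lin be M q l c d F G :
  right_geo_sum be M q l (fun k => c * F k + d * G k) =
  c * right_geo_sum be M q l F + d * right_geo_sum be M q l G.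
Proof.
elim: l q F G => //= u l IH q F G.
rewrite !mulr_sumr -big_split /=; apply: eq_bigr => i _.
by rewrite (IH _ (fun k => F (_ :: k)) (fun k => G (_ :: k))); ring.
Qed.

Lemma left_geo_sum_lin be M p l c d F G :
  left_geo_sum be M p l (fun k => c * F k + d * G k) =
  c * left_geo_sum be M p l F + d * left_geo_sum be M p l G.
Proof.
elim: l p F G => //= u l IH p F G.
rewrite !mulr_sumr -big_split /=; apply: eq_bigr => i _.
by rewrite (IH _ (fun k => F (_ :: k)) (fun k => G (_ :: k))); ring.
Qed.

Lemma eq_left_geo_sum be M p l F G : (forall k, F k = G k) ->
  left_geo_sum be M p l F = left_geo_sum be M p l G.
Proof. by move=> FG; congr left_geo_sum; apply: funext. Qed.

(** The configuration after a step in which no particle jumps but each is still pushed above its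
    predecessor. This is what the telescoping sums leave behind. *)
Fixpoint cascade (q : nat) l : seq nat :=
  if l is u :: l' then maxn q u :: cascade (maxn q u).+1 l' else [::].

Lemma cascade_sorted q l : path ltn q l -> cascade q.+1 l = l.
Proof.
by elim: l q => //= u l IH q /andP[qu pl]; rewrite (maxn_idPr _) ?IH.
Qed.

Lemma cascade0 l : sorted ltn l -> cascade 0 l = l.
Proof. by case: l => //= u l /cascade_sorted; rewrite max0n => ->. Qed.

Lemma neumann_cascade G c l : neumann G ->
  G (c :: cascade c.+1 l) = G (c :: cascade c l).
Proof.
elim: l c G => //= u l IH c G nG.
have [ltcu|leuc] := ltnP c u.
  by have -> : maxn c.+1 u = u by lia.
have -> : maxn c.+1 u = c.+1 by lia.
have /= -> := IH c.+1 (fun k => G (c :: k)) (neumann_cons _ nG).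
by have /= -> := nG [::] (cascade c.+1 l) c.
Qed.

(** By induction the inner particles turn the shifted function into [U c], and [neumann_cascade]
    turns the second term into [U (c + 1)]; then [sum_geo] applies to the first particle. The
    boundary term at [M] vanishes with [G]. *)
Lemma right_geo_sum_shift be M q l G : (forall c, 1 + be * a c != 0) ->
    neumann G -> vanishes_above M G ->
  right_geo_sum be M q l (shift_all (- be) G) = G (cascade q l).
Proof.
move=> nz; elim: l q G => //= u l IH q G nG vG.
set m := maxn q u; pose U c := G (c :: cascade c.+1 l).
have UM c : (M <= c)%N -> U c = 0.
  by move=> Mc; apply: (vG _ c) => //; rewrite inE eqxx.
have -> : G (m :: cascade m.+1 l) = U m by [].
transitivity (\sum_(c < M) geo be m c * ((1 + be * a c) * U c - be * a c * U c.+1)).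
  apply: eq_bigr => c _; congr (_ * _).
  rewrite (right_geo_sum_lin be M c.+1 l (1 - - be * a c) (- be * a c)
    (shift_all (- be) (fun k => G ((c : nat) :: k)))
    (shift_all (- be) (fun k => G (c.+1 :: k)))).
  rewrite !IH; try exact: neumann_cons; try exact: vanishes_above_cons.
  rewrite -(neumann_cascade c.+1) // /U; ring.
have [leMm|ltmM] := leqP M m; last by rewrite sum_geo ?(UM M) ?mulr0 ?subr0 // ltnW.
rewrite UM // big1 // => c _; rewrite /geo leqNgt (leq_trans _ leMm) ?mul0r //.
Qed.

(** At the barrier the summand reduces to [V p], because [G] agrees at [p] and [p + 1]; the mass
    [reach u p] stopped there thus cancels the boundary term of [sum_geo]. For the next particle the
    barrier is [u], and the same condition is the Neumann relation. When [p = M] the stopping site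
    lies outside the sum, and vanishing at [M] replaces it. *)
Lemma left_geo_sum_shift be M p l G : (forall c, 1 + be * a c != 0) ->
    neumann G -> (forall k, G (p.+1 :: k) = G (p :: k)) ->
    (p < M)%N \/ p = M /\ (forall k, G (M :: k) = 0) ->
    path geq p l ->
  left_geo_sum be M p l (shift_all (- be) G) = G l.
Proof.
move=> nz; elim: l p G => //= u l IH p G nG Gp pM /andP[/= up pl].
pose V c := left_geo_sum be M u l (shift_all (- be) (fun k => G (c :: k))).
have Vp : V p.+1 = V p.
  by apply: eq_left_geo_sum => k; apply: eq_shift_all => k' _.
transitivity (V u); last first.
  rewrite /V IH //; first exact: neumann_cons.
    by move=> k; have /= := nG [::] k u.
  have [uM|Mu] := ltnP u M; [by left|right].
  have pMe : p = M by case: pM => [|[]] //; lia.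
  have uMe : u = M by lia.
  split=> // k; rewrite uMe; case: pM => [|[_ G0]]; first lia.
  exact: G0.
transitivity (\sum_(c < M) geo_stop be p u c * ((1 + be * a c) * V c - be * a c * V c.+1)).
  apply: eq_bigr => c _; congr (_ * _).
  rewrite (left_geo_sum_lin be M u l (1 - - be * a c) (- be * a c)
    (shift_all (- be) (fun k => G ((c : nat) :: k)))
    (shift_all (- be) (fun k => G (c.+1 :: k)))).
  rewrite /V; ring.
case: pM => [pM|[pM G0]].
  rewrite -(big_mkord xpredT (fun c => geo_stop be p u c * ((1 + be * a c) * V c - be * a c * V c.+1))).
  rewrite (big_cat_nat (n := p.+1)) //= [X in _ + X]big_nat_cond [X in _ + X]big1 ?addr0; last first.
    move=> c /andP[/andP[pc _] _]; rewrite /geo_stop ltnNge (ltnW pc) /=.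
    by rewrite gtn_eqF // mul0r.
  rewrite big_nat_recr //= /geo_stop ltnn eqxx Vp.
  rewrite (eq_big_nat _ _ (F2 := fun c => geo be u c * ((1 + be * a c) * V c - be * a c * V c.+1))).
    by rewrite big_mkord sum_geo //; ring.
  by move=> c /andP[_ ->].
have VM : V p = 0.
  rewrite /V pM (eq_left_geo_sum _ _ _ _ (G := fun k => 0 * 0 + 0 * 0)).
    rewrite (left_geo_sum_lin be M u l 0 0 (fun=> 0) (fun=> 0)); ring.
  move=> k; rewrite (eq_shift_all _ (G := fun k => 0 * 0)) ?shift_allZ; first ring.
  by move=> k' _; rewrite G0 mul0r.
transitivity (V u - reach be u p * V p); last by rewrite VM mulr0 subr0.
rewrite -sum_geo // pM.
by apply: eq_bigr => c _; rewrite /geo_stop ltn_ord.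
Qed.

End Steps.

(** * Determinants satisfying the boundary relation *)

Section DetFamilies.
Variables (R : realType) (a : nat -> R).
Implicit Types (h : nat -> nat -> nat -> R) (s th : R).

(** Lists of the wrong length get the value 0, so that the boundary relation and the vanishing
    conditions can be stated on all lists. *)
Definition det_fun (N : nat) h (l : seq nat) : R :=
  if size l == N then \det (\matrix_(i < N, j < N) h i j (nth 0%N l i)) else 0.

Lemma detE_prod (S : comRingType) (n : nat) (f : nat -> nat -> S) :
  \det (\matrix_(i < n, j < n) f i j) =
  \sum_(p : 'S_n) (-1) ^+ p * \prod_(i < n) f i (p i).
Proof.
by apply: eq_bigr => p _; congr (_ * _); apply: eq_bigr => i _; rewrite mxE.
Qed.

Lemma shift_all_det th N h l : size l = N ->
  shift_all a th (det_fun N h) l =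
  det_fun N (fun i j u => h i j u + th * (a u * fdiff (h i j) u)) l.
Proof.
move=> sl; rewrite /det_fun sl eqxx.
rewrite (detE_prod N (fun i j => h i j (nth 0%N l i) +
  th * (a (nth 0%N l i) * fdiff (h i j) (nth 0%N l i)))).
(* [shift_all_prod] needs factors indexed by all of [nat], so the permutation is read off the list
   of its values. *)
pose f (p : 'S_N) i := h i (nth 0%N [seq val (p j) | j <- enum 'I_N] i).
have fE (p : 'S_N) (i : 'I_N) : f p i = h i (p i).
  rewrite /f; congr (h i _).
  by rewrite (nth_map i) ?size_enum_ord // nth_ord_enum.
transitivity (shift_all a th (fun k => \sum_(p : 'S_N) (-1) ^+ p *
    \prod_(i < size k) f p i (nth 0%N k i)) l).
  apply: eq_shift_all => k sk; rewrite sk sl eqxx.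
  rewrite (detE_prod N (fun i j => h i j (nth 0%N k i))).
  by apply: eq_bigr => p _; congr (_ * _); apply: eq_bigr => i _; rewrite fE.
rewrite shift_all_sum; apply: eq_bigr => p _.
rewrite shift_allZ shift_all_prod sl; congr (_ * _).
by apply: eq_bigr => i _; rewrite fE.
Qed.

(** The row of the second [u], moved to [u + 1], changes by [(s a_u)^-1] times the row above it,
    which is evaluated at the same [u]; this leaves the determinant unchanged. *)
Lemma neumann_det s N h : (forall u, a u != 0) -> s != 0 ->
    (forall i j u, (i.+1 < N)%N -> (j < N)%N ->
       s * (a u * fdiff (h i.+1 j) u) = h i j u) ->
  neumann (det_fun N h).
Proof.
move=> a0 s0 hE p q u; rewrite /det_fun !size_cat /=; case: eqP => // sN.
have ip : (size p < N)%N by lia.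
have jp : ((size p).+1 < N)%N by lia.
pose i0 := Ordinal ip; pose j0 := Ordinal jp.
have ij : i0 != j0 by apply/eqP => /(congr1 val) /=; lia.
set A := (X in _ = \det X).
pose B : 'M[R]_N := \matrix_(i, j)
  if i == j0 then (s * a u)^-1 * h i0 j u else A i j.
rewrite (determinant_multilinear (A := A) (B := \matrix_(i < N, j < N)
  h i j (nth 0%N (p ++ u :: u :: q) i)) (C := B) (i0 := j0) (b := 1) (c := 1)).
- rewrite !mul1r [\det B](_ : _ = 0) ?addr0 //.
  rewrite (determinant_multilinear (A := B) (B := \matrix_(i, j)
    if i == j0 then h i0 j u else A i j) (C := B) (i0 := j0)
    (b := (s * a u)^-1) (c := 0)).
  + rewrite mul0r addr0 (determinant_alternate ij) ?mulr0 // => j.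
    by rewrite !mxE eqxx (negPf ij) nth_cat ltnn subnn.
  + by apply/rowP => j; rewrite !mxE eqxx mul0r addr0.
  + by apply/matrixP => i j; rewrite !mxE eq_sym (negPf (neq_lift _ _)).
  + by apply/matrixP => i j; rewrite !mxE.
- apply/rowP => j; rewrite !mxE eqxx !mul1r !nth_cat /=.
  have -> : ((size p).+1 < size p)%N = false by lia.
  rewrite subSn // subnn /= -(hE (size p) j u) //.
  by rewrite mulrA mulKf ?mulf_neq0 // /fdiff addrC subrK.
- apply/matrixP => i j; rewrite !mxE.
  have : lift j0 i != (size p).+1 :> nat.
    by apply/eqP => /(@ord_inj _ _ j0)/eqP; rewrite eq_sym (negPf (neq_lift _ _)).
  move: (nat_of_ord _) => k kp; rewrite !nth_cat; case: ltnP => // pk.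
  by case: (k - size p)%N (subnKC pk) => [|[|m]] // E; move: kp; rewrite -E addn1 eqxx.
- by apply/matrixP => i j; rewrite !mxE eq_sym (negPf (neq_lift _ _)).
Qed.

Lemma det_fun_row0 N h l (i : 'I_N) :
  (forall j : 'I_N, h i j (nth 0%N l i) = 0) -> det_fun N h l = 0.
Proof.
move=> h0; rewrite /det_fun; case: eqP => // _.
by rewrite (expand_det_row _ i) big1 // => j _; rewrite !mxE h0 mul0r.
Qed.

Lemma vanishes_above_det N M h :
    (forall i j u, (i < N)%N -> (j < N)%N -> (M <= u)%N -> h i j u = 0) ->
  vanishes_above M (det_fun N h).
Proof.
move=> h0 l u ul Mu; have [sl|sl] := eqVneq (size l) N; last first.
  by rewrite /det_fun (negPf sl).
have il : (index u l < N)%N by rewrite -sl index_mem.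
apply: (@det_fun_row0 _ _ _ (Ordinal il)) => j.
by rewrite h0 //= nth_index.
Qed.

(* [lgen 1] is the generator of the one particle motion; [lgen (-1)] is the
   operator which multiplies by [w] under the contour integral. *)
Definition lgen s (g : nat -> R) (u : nat) : R := s * (a u * fdiff g u).

(** The power [n - i] of [lgen s] on [e 0 (v n)], negative powers being supplied by the family [e].
    Under [lowering] the operator sends row [i + 1] to row [i], which is the hypothesis of
    [neumann_det]. *)
Definition det_family s (e : nat -> nat -> nat -> R) (v : nat -> nat) (i n u : nat) : R :=
  if (i <= n)%N then iter (n - i) (lgen s) (e 0%N (v n)) u else e (i - n)%N (v n) u.

Definition lowering s (e : nat -> nat -> nat -> R) :=
  forall k x u, lgen s (e k.+1 x) u = e k x u.

Lemma lgen_family s e v i n u : lowering s e ->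
  lgen s (det_family s e v i.+1 n) u = det_family s e v i n u.
Proof.
move=> le; rewrite /det_family; have [lt_in|le_ni] := ltnP i n.
  by rewrite (ltnW lt_in) -iterS subnSK.
rewrite subSn //; transitivity (e (i - n)%N (v n) u); first exact: le.
have [le_in|//] := leqP i n.
by have -> : i = n by [lia]; rewrite subnn.
Qed.

Lemma neumann_family s e v N : (forall u, a u != 0) -> s != 0 ->
  lowering s e -> neumann (det_fun N (det_family s e v)).
Proof.
move=> a0 s0 le; apply: (neumann_det a0 s0) => i j u _ _.
exact: lgen_family.
Qed.

Lemma lgen_comm s th g u :
  lgen s (fun w => g w + th * (a w * fdiff g w)) u =
  lgen s g u + th * (a u * fdiff (lgen s g) u).
Proof. by rewrite /lgen /fdiff; ring. Qed.

Lemma iter_lgen_comm s th m g u :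
  iter m (lgen s) (fun w => g w + th * (a w * fdiff g w)) u =
  iter m (lgen s) g u + th * (a u * fdiff (iter m (lgen s) g) u).
Proof.
elim: m u => //= m IH u; rewrite -lgen_comm.
by congr lgen; apply: funext.
Qed.

Lemma det_family_step s th e e' v i n u :
    (forall k w x, e' k w x = e k w x + th * (a x * fdiff (e k w) x)) ->
  det_family s e' v i n u = det_family s e v i n u +
    th * (a u * fdiff (det_family s e v i n) u).
Proof.
move=> eE; rewrite /det_family; case: ifP => _; last exact: eE.
rewrite -iter_lgen_comm.
have -> // : e' 0%N (v n) = fun w => e 0%N (v n) w + th * (a w * fdiff (e 0%N (v n)) w).
by apply: funext => w; exact: eE.
Qed.

Lemma shift_all_family s th e e' v N l : size l = N ->
    (forall k w x, e' k w x = e k w x + th * (a x * fdiff (e k w) x)) ->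
  shift_all a th (det_fun N (det_family s e v)) l =
  det_fun N (det_family s e' v) l.
Proof.
move=> sl eE; rewrite shift_all_det // /det_fun; case: ifP => // _.
by congr (\det _); apply/matrixP => i j; rewrite !mxE (det_family_step _ _ _ _ _ eE).
Qed.

Lemma iter_lgen_above s M g : (forall u, (M <= u)%N -> g u = 0) ->
  forall m u, (M <= u)%N -> iter m (lgen s) g u = 0.
Proof.
move=> g0; elim=> [|m IH] u Mu /=; first exact: g0.
by rewrite /lgen /fdiff !IH // ?(leq_trans Mu) // subrr !mulr0.
Qed.

Lemma iter_lgen_below s M g : (forall u, (u < M)%N -> g u = 0) ->
  forall m u, (u + m < M)%N -> iter m (lgen s) g u = 0.
Proof.
move=> g0; elim=> [|m IH] u uM /=; first by apply: g0; lia.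
by rewrite /lgen /fdiff !IH ?subrr ?mulr0 //; lia.
Qed.

(** The [k]-th inverse power of [lgen (-1)] on the indicator of [v], with the constants of summation
    fixed by vanishing above [v]. [left_ker] inverts [lgen 1] and for [k > 0] vanishes at and below
    [v]. *)
Fixpoint right_ker (k v y : nat) : R :=
  if k is k'.+1 then \sum_(y <= w < v.+1) right_ker k' v w * (a w)^-1
  else (y == v)%:R.

Fixpoint left_ker (k v y : nat) : R :=
  if k is k'.+1 then \sum_(w < y) left_ker k' v w * (a w)^-1
  else (y == v)%:R.

Lemma right_ker_above k v y : (v < y)%N -> right_ker k v y = 0.
Proof.
case: k => [|k] vy /=; first by rewrite gtn_eqF.
by rewrite big_geq.
Qed.

Lemma left_ker_below k v y : (y <= v)%N -> left_ker k.+1 v y = 0.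
Proof.
elim: k y => [|k IH] y yv.
  by rewrite /= big1 // => w _; rewrite ltn_eqF ?mul0r // (leq_trans _ yv).
rewrite [LHS]/= big1 // => w _.
by move: (IH w); rewrite /= => ->; rewrite ?mul0r // (leq_trans _ yv) // ltnW.
Qed.

Lemma right_ker_lowering : (forall u, a u != 0) -> lowering (-1) right_ker.
Proof.
move=> a0 k v u; rewrite /lgen /fdiff /=.
have [lt_vu|le_uv] := ltnP v u.
  by rewrite !big_geq ?subrr ?mulr0 ?right_ker_above // ltnW.
rewrite [X in _ - X]big_ltn // opprD addrA addrAC subrr add0r.
by field.
Qed.

Lemma left_ker_lowering : (forall u, a u != 0) -> lowering 1 left_ker.
Proof.
move=> a0 k v u; rewrite /lgen /fdiff /= big_ord_recr /= addrAC subrr add0r.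
by field.
Qed.

Lemma det_corner n (A : 'M[R]_n.+1) :
    (forall j : 'I_n, A ord_max (lift ord_max j) = 0) \/
    (forall i : 'I_n, A (lift ord_max i) ord_max = 0) ->
  \det A = A ord_max ord_max *
    \det (\matrix_(i < n, j < n) A (lift ord_max i) (lift ord_max j)).
Proof.
have cof : cofactor A ord_max ord_max =
    \det (\matrix_(i < n, j < n) A (lift ord_max i) (lift ord_max j)).
  rewrite /cofactor addnn -signr_odd odd_double mul1r.
  by congr (\det _); apply/matrixP => i j; rewrite !mxE.
case=> A0.
  rewrite (expand_det_row _ ord_max) (bigD1 ord_max) //= cof big1 ?addr0 //.
  by move=> j jm; have [k -> _] := unlift_some (introN eqP (fun e => elimN eqP jm (esym e))); rewrite A0 mul0r.
rewrite (expand_det_col _ ord_max) (bigD1 ord_max) //= cof big1 ?addr0 //.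
by move=> j jm; have [k -> _] := unlift_some (introN eqP (fun e => elimN eqP jm (esym e))); rewrite A0 mul0r.
Qed.

Lemma det_fun_rcons N h l u :
    (forall j, (j < N)%N -> h N j u = 0) \/
    (forall i, (i < N)%N -> h i N (nth 0%N l i) = 0) ->
  det_fun N.+1 h (rcons l u) = h N N u * det_fun N h l.
Proof.
rewrite /det_fun size_rcons eqSS => h0; case: eqP => [sl|_]; last by rewrite mulr0.
have lN (i : 'I_N) : lift ord_max i = i :> nat by rewrite lift_max.
rewrite det_corner.
  rewrite mxE nth_rcons sl ltnn eqxx; congr (_ * \det _).
  by apply/matrixP => i j; rewrite !mxE !lN nth_rcons sl ltn_ord.
case: h0 => h0; [left=> j|right=> i]; rewrite mxE lN nth_rcons sl.
  by rewrite ltnn eqxx h0.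
by rewrite ltn_ord h0.
Qed.

Lemma sorted_rcons2 (T : Type) (e : rel T) (l : seq T) w u :
  sorted e (rcons (rcons l w) u) = sorted e (rcons l w) && e w u.
Proof. by case: l => [|x l] /=; rewrite ?andbT // !rcons_path last_rcons. Qed.

(** An iterated difference of order [size l - i] at coordinate [i] looks that many sites ahead; the
    gap keeps it from looking past [u]. *)
Lemma sorted_ltn_gap l u : sorted ltn (rcons l u) ->
  forall i, (i < size l)%N -> (nth 0%N l i + (size l - i) <= u)%N.
Proof.
elim/last_ind: l u => [//|l w IH] u sl i.
have {}sl : sorted ltn (rcons l w) /\ (w < u)%N.
  by move: sl; rewrite sorted_rcons2 => /andP.
rewrite size_rcons nth_rcons ltnS leq_eqVlt => /orP[/eqP->|il].
  by rewrite ltnn eqxx; case: sl; lia.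
by rewrite il; have := IH _ sl.1 _ il; case: sl; lia.
Qed.

Lemma sorted_geq_last l u : sorted geq (rcons l u) ->
  forall i, (i < size l)%N -> (u <= nth 0%N l i)%N.
Proof.
elim/last_ind: l u => [//|l w IH] u sl i.
have {}sl : sorted geq (rcons l w) /\ (u <= w)%N.
  by move: sl; rewrite sorted_rcons2 => /andP.
rewrite size_rcons nth_rcons ltnS leq_eqVlt => /orP[/eqP->|il].
  by rewrite ltnn eqxx; case: sl; lia.
by rewrite il; have := IH _ sl.1 _ il; case: sl; lia.
Qed.

(** Compare the last coordinates [u] and [w]. If [u < w], the last column off the corner consists of
    differences of the indicator of [w] that look no further than [u]; if [w <= u], the last row off
    the corner consists of [right_ker] evaluated above its support. Either way the corner entry
    [u == w] splits off. *)
Lemma det_right_ker_initial N l v : size l = N -> size v = N ->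
    sorted ltn l -> sorted ltn v ->
  det_fun N (det_family (-1) right_ker (nth 0%N v)) l = (l == v)%:R.
Proof.
elim: N l v => [|N IH] l v; first by move=> /size0nil-> /size0nil->; rewrite /det_fun det_mx00.
case/lastP: l => // l u; case/lastP: v => // v w.
rewrite !size_rcons => -[sl] [sv] Sl Sv.
have [Sl' Sv'] : sorted ltn l /\ sorted ltn v.
  by split; [move: Sl|move: Sv]; rewrite -cats1 => /cat_sorted2[].
rewrite det_fun_rcons.
  rewrite /det_family leqnn subnn /= nth_rcons sv ltnn eqxx eqseq_rcons.
  transitivity ((u == w)%:R * det_fun N (det_family (-1) right_ker (nth 0%N v)) l : R).
    congr (_ * _); rewrite /det_fun; case: eqP => // _; congr (\det _).
    by apply/matrixP => i j; rewrite !mxE nth_rcons sv ltn_ord.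
  by rewrite IH // andbC; case: eqP; rewrite ?mul1r ?mul0r.
have [lt_uw|le_wu] := ltnP u w.
  right=> i iN; rewrite /det_family ltnW // nth_rcons sv ltnn eqxx.
  apply: (@iter_lgen_below _ w) => [x xw|]; first by rewrite /= ltn_eqF.
  by have := sorted_ltn_gap Sl (i := i); rewrite sl => /(_ iN); lia.
left=> j jN; rewrite /det_family leqNgt jN /= nth_rcons sv jN right_ker_above //.
by have := sorted_ltn_gap Sv (i := j); rewrite sv => /(_ jN); lia.
Qed.

(** The same expansion with the order reversed: for [w < u] the differences of the indicator of [w]
    are taken above [w], and for [u <= w] the kernels [left_ker] of positive order vanish at [u],
    which is at or below each [v_j]. *)
Lemma det_left_ker_initial N l v : size l = N -> size v = N ->
    sorted geq l -> sorted geq v ->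
  det_fun N (det_family 1 left_ker (nth 0%N v)) l = (l == v)%:R.
Proof.
elim: N l v => [|N IH] l v; first by move=> /size0nil-> /size0nil->; rewrite /det_fun det_mx00.
case/lastP: l => // l u; case/lastP: v => // v w.
rewrite !size_rcons => -[sl] [sv] Sl Sv.
have [Sl' Sv'] : sorted geq l /\ sorted geq v.
  by split; [move: Sl|move: Sv]; rewrite -cats1 => /cat_sorted2[].
rewrite det_fun_rcons.
  rewrite /det_family leqnn subnn /= nth_rcons sv ltnn eqxx eqseq_rcons.
  transitivity ((u == w)%:R * det_fun N (det_family 1 left_ker (nth 0%N v)) l : R).
    congr (_ * _); rewrite /det_fun; case: eqP => // _; congr (\det _).
    by apply/matrixP => i j; rewrite !mxE nth_rcons sv ltn_ord.
  by rewrite IH // andbC; case: eqP; rewrite ?mul1r ?mul0r.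
have [lt_wu|le_uw] := ltnP w u.
  right=> i iN; rewrite /det_family ltnW // nth_rcons sv ltnn eqxx.
  apply: (@iter_lgen_above _ w.+1) => [x xw|]; first by rewrite /= gtn_eqF.
  by have := sorted_geq_last Sl (i := i); rewrite sl => /(_ iN); lia.
left=> j jN; rewrite /det_family leqNgt jN /= nth_rcons sv jN.
have -> : (N - j = (N - j).-1.+1)%N by lia.
apply: left_ker_below.
by have := sorted_geq_last Sv (i := j); rewrite sv => /(_ jN); lia.
Qed.

End DetFamilies.

(** * Summation over arrays *)

Section Arrays.
Variables (R : realType) (a : nat -> R).
Implicit Types (M N n : nat) (f : nat -> nat -> R).

(** The levels that may follow [x]. Interlacing lets the coordinates range independently over
    consecutive intervals, which is why sums over a level factor. *)
Fixpoint tops M lo (x : seq nat) : seq (seq nat) :=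
  if x is u :: x' then
    [seq c :: k | c <- index_iota lo u.+1, k <- tops M u.+1 x']
  else [seq [:: c] | c <- index_iota lo M].

Fixpoint arrs M N : seq array :=
  if N is N'.+1 then
    [seq rcons z k | z <- arrs M N', k <- tops M 0 (last [::] z)]
  else [:: [::]].

Lemma big_allpairs_dep_seq (S T U : Type) (h : S -> T -> U) (r : seq S)
    (t : S -> seq T) (F : U -> R) :
  \sum_(i <- [seq h x y | x <- r, y <- t x]) F i =
  \sum_(x <- r) \sum_(y <- t x) F (h x y).
Proof.
elim: r => [|x r IH]; first by rewrite !big_nil.
by rewrite big_cons -IH allpairs_cons big_cat big_map.
Qed.

Lemma sum_tops_prod f M lo x :
  \sum_(k <- tops M lo x) \prod_(j < (size x).+1) f j (nth 0%N k j) =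
  \prod_(j < (size x).+1)
    \sum_(nth M (lo :: map S x) j <= y < nth M (map S x) j) f j y.
Proof.
elim: x lo f => [|u x IH] lo f /=.
  rewrite big_map big_ord1 /=; apply: eq_bigr => c _; by rewrite big_ord1.
rewrite big_allpairs_dep_seq big_ord_recl /= big_distrl /=; apply: eq_bigr => c _.
rewrite -(IH _ (fun j => f j.+1)) big_distrr /=; apply: eq_bigr => k _.
by rewrite big_ord_recl.
Qed.

Lemma detE_prod_col n f :
  \det (\matrix_(i < n, j < n) f i j) =
  \sum_(p : 'S_n) (-1) ^+ p * \prod_(j < n) f (p j) j.
Proof.
rewrite -det_tr -(detE_prod n (fun j i => f i j)); congr (\det _).
by apply/matrixP => i j; rewrite !mxE.
Qed.

Lemma sum_tops_det f (g : nat -> nat -> R) M lo x :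
  \sum_(k <- tops M lo x) (\prod_(j < (size x).+1) g j (nth 0%N k j)) *
    \det (\matrix_(i < (size x).+1, j < (size x).+1) f i (nth 0%N k j)) =
  \det (\matrix_(i < (size x).+1, j < (size x).+1)
    \sum_(nth M (lo :: map S x) j <= y < nth M (map S x) j)
      g j y * f i y).
Proof.
rewrite (detE_prod_col _ (fun i j =>
  \sum_(nth M (lo :: map S x) j <= y < nth M (map S x) j)
      g j y * f i y)).
set n := (size x).+1.
transitivity (\sum_(k <- tops M lo x) \sum_(p : 'S_n) (-1) ^+ p *
   \prod_(j < n) (g j (nth 0%N k j) * f (p j) (nth 0%N k j))).
  apply: eq_bigr => k _; rewrite (detE_prod_col n (fun i j => f i (nth 0%N k j))).
  rewrite big_distrr /=; apply: eq_bigr => p _; by rewrite big_split mulrCA.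
rewrite exchange_big /=; apply: eq_bigr => p _; rewrite -big_distrr /=.
congr (_ * _).
pose h j y := g j y * f (nth 0%N [seq val (p i) | i <- enum 'I_n] j) y.
have hE (j : 'I_n) y : h j y = g j y * f (p j) y.
  by rewrite /h (nth_map j) ?size_enum_ord // nth_ord_enum.
under eq_bigr => k _ do under eq_bigr => j _ do rewrite -hE.
rewrite sum_tops_prod; apply: eq_bigr => j _; apply: eq_bigr => y _.
exact: hE.
Qed.

(** Right multiplication by a unitriangular matrix. The condition on [e] reflects that the last
    column has no successor. *)
Lemma det_col_next n f (e : nat -> R) : e n.-1 = 0 ->
  \det (\matrix_(i < n, j < n) (f i j - e j * f i j.+1)) =
  \det (\matrix_(i < n, j < n) f i j).
Proof.
case: n => [|n] en; first by rewrite !det_mx00.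
pose U : 'M[R]_n.+1 :=
  \matrix_(k, j) ((k == j)%:R - e j * (k == j.+1 :> nat)%:R).
have detU : \det U = 1.
  rewrite det_trig.
    by rewrite big1 // => i _; rewrite mxE eqxx ltn_eqF // mulr0 subr0.
  apply/is_trig_mxP => i j ij; rewrite mxE (ltn_eqF (ltn_trans ij _)) //.
  by rewrite -val_eqE ltn_eqF // mulr0 subr0.
rewrite -[RHS]mulr1 -detU -det_mulmx; congr (\det _).
apply/matrixP => i j; rewrite !mxE.
transitivity (\sum_k ((k == j)%:R * f i k - e j * ((k == j.+1 :> nat)%:R * f i k))).
  rewrite sumrB -big_distrr /=; congr (_ - _).
    by rewrite (bigD1 j) //= eqxx mul1r big1 ?addr0 // => k /negPf->; rewrite mul0r.
  have [jn|jn] := ltnP j.+1 n.+1.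
    congr (_ * _).
    rewrite (bigD1 (Ordinal jn)) //= eqxx mul1r big1 ?addr0 // => k.
    by rewrite -val_eqE /= => /negPf->; rewrite mul0r.
  have -> : e j = 0 by rewrite -en /=; congr e; have := ltn_ord j; lia.
  by rewrite !mul0r.
by apply: eq_bigr => k _; rewrite !mxE; ring.
Qed.

Lemma det_col_prev n f (e : nat -> R) : e 0%N = 0 ->
  \det (\matrix_(i < n, j < n) (f i j - e j * f i j.-1)) =
  \det (\matrix_(i < n, j < n) f i j).
Proof.
move=> e0; case: n => [|n]; first by rewrite !det_mx00.
pose U : 'M[R]_n.+1 :=
  \matrix_(j, k) ((k == j)%:R - e j * (k.+1 == j :> nat)%:R).
have detU : \det U = 1.
  rewrite det_trig.
    by rewrite big1 // => i _; rewrite mxE eqxx gtn_eqF // mulr0 subr0.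
  apply/is_trig_mxP => i j ij; rewrite mxE (gtn_eqF (ltn_trans ij _)) //.
  by rewrite -val_eqE gtn_eqF // mulr0 subr0.
rewrite -[RHS]mulr1 -detU -[\det U]det_tr -det_mulmx; congr (\det _).
apply/matrixP => i j; rewrite !mxE.
transitivity (\sum_k ((k == j)%:R * f i k - e j * ((k.+1 == j :> nat)%:R * f i k))).
  rewrite sumrB -big_distrr /=; congr (_ - _).
    by rewrite (bigD1 j) //= eqxx mul1r big1 ?addr0 // => k /negPf->; rewrite mul0r.
  case: j => -[|j] jn /=; first by rewrite e0 !mul0r.
  rewrite (bigD1 (Ordinal (ltnW jn))) //= eqxx mul1r big1 ?addr0 // => k.
  by rewrite -val_eqE /= eqSS => /negPf->; rewrite mul0r.
by apply: eq_bigr => k _; rewrite !mxE; ring.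
Qed.

(** Coordinate [j] of a level above [x] ranges over the sites from [cut j] up to, but excluding,
    [cut (j + 1)]. *)
Definition cut M (x : seq nat) (j : nat) : nat := nth M (0%N :: map S x) j.

Lemma cut_le M x j : sorted ltn x -> all (ltn^~ M) x ->
  (cut M x j <= cut M x j.+1 <= M)%N.
Proof.
move=> sx xM; have le i : (i < size x)%N -> (nth 0%N x i < M)%N.
  by move=> ix; exact: (allP xM (nth 0%N x i) (mem_nth _ ix)).
rewrite /cut; case: j => [|j] /=.
  by case: x sx xM {le} => //= u x _ /andP[].
have [jx|jx] := ltnP j.+1 (size x).
  rewrite !(nth_map 0%N) ?(ltnW jx) // le // andbT ltnS ltnW //.
  by apply: (sorted_ltn_nth ltn_trans) => //; exact: ltnW.
rewrite [X in (_ <= X <= _)%N]nth_default ?size_map // leqnn andbT.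
have [jx'|jx'] := ltnP j (size x); last by rewrite nth_default ?size_map.
by rewrite (nth_map 0%N) // le.
Qed.

Lemma cut_default M x j : (size x < j)%N -> cut M x j = M.
Proof. by move=> xj; rewrite /cut nth_default //= size_map. Qed.

Lemma cutS M x j : (j < size x)%N -> cut M x j.+1 = (nth 0%N x j).+1.
Proof. by move=> xj; rewrite /cut /= (nth_map 0%N). Qed.

(** Adding to each column all later ones extends its range of summation up to [M]. Afterwards column
    [j > 0] depends on a single coordinate of [x], and column 0 on none. *)
Lemma sum_tops_total f M x : sorted ltn x -> all (ltn^~ M) x ->
  \sum_(k <- tops M 0 x)
    \det (\matrix_(i < (size x).+1, j < (size x).+1) f i (nth 0%N k j)) =
  \det (\matrix_(i < (size x).+1, j < (size x).+1)
    \sum_(cut M x j <= y < M) f i y).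
Proof.
move=> sx xM; set n := (size x).+1.
have := sum_tops_det f (fun _ _ => 1) M 0 x.
under eq_bigr => k _ do rewrite big1_eq mul1r.
move=> ->.
rewrite -(@det_col_next n (fun i j => \sum_(cut M x j <= y < M) f i y)
  (fun j => (j < size x)%:R)) ?ltnn //.
congr (\det _); apply/matrixP => i j; rewrite !mxE /=.
under eq_bigr => y _ do rewrite mul1r.
have /andP[c1 c2] := cut_le j sx xM.
rewrite (big_cat_nat c1 c2) /=.
case: ltnP => jx; first by rewrite mul1r addrK.
by rewrite mul0r subr0 [X in _ = _ + X]big_geq ?addr0 // cut_default.
Qed.

Lemma sum_delta (g : nat -> R) lo hi v : (lo <= v < hi)%N ->
  \sum_(lo <= y < hi) (y == v)%:R * g y = g v.
Proof.
move=> vr; rewrite (bigD1_seq v) ?mem_index_iota ?iota_uniq //=.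
rewrite eqxx mul1r big1 ?addr0 // => y /negPf->.
by rewrite mul0r.
Qed.

(** The column of the prescribed first coordinate is left alone and the others are completed to tail
    sums. The bound on [v] says that it lies in the range of the first coordinate. *)
Lemma sum_tops_left f M x v : sorted ltn x -> all (ltn^~ M) x ->
    (v < cut M x 1)%N ->
  \sum_(k <- tops M 0 x) (nth 0%N k 0 == v)%:R *
    \det (\matrix_(i < (size x).+1, j < (size x).+1) f i (nth 0%N k j)) =
  \det (\matrix_(i < (size x).+1, j < (size x).+1)
    if j == 0%N :> nat then f i v else \sum_(cut M x j <= y < M) f i y).
Proof.
move=> sx xM vx; set n := (size x).+1.
have := sum_tops_det f (fun j y => if j == 0%N then (y == v)%:R else 1) M 0 x.
under eq_bigr => k _.
  rewrite big_ord_recl /= big1 ?mulr1 //; over.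
move=> ->.
rewrite -(@det_col_next n (fun i j => if j == 0%N then f i v else
   \sum_(cut M x j <= y < M) f i y) (fun j => (0 < j < size x)%:R)); last first.
  by rewrite ltnn andbF.
congr (\det _); apply/matrixP => i j; rewrite !mxE /=.
case: (posnP j) => [j0|j0] /=.
  by rewrite {1}j0 /= mul0r subr0 sum_delta //; move: vx; rewrite j0 /cut.
under eq_bigr => y _ do rewrite mul1r.
have /andP[c1 c2] := cut_le j sx xM.
rewrite (big_cat_nat c1 c2) /=.
case: ltnP => jx; first by rewrite mul1r addrK.
by rewrite mul0r subr0 [X in _ = _ + X]big_geq ?addr0 // cut_default.
Qed.

(** Here the prescribed coordinate is the last one, so the remaining columns are completed to the
    left, giving head sums. *)
Lemma sum_tops_right f M x v : sorted ltn x -> all (ltn^~ M) x ->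
    (cut M x (size x) <= v < M)%N ->
  \sum_(k <- tops M 0 x) (nth 0%N k (size x) == v)%:R *
    \det (\matrix_(i < (size x).+1, j < (size x).+1) f i (nth 0%N k j)) =
  \det (\matrix_(i < (size x).+1, j < (size x).+1)
    if j == size x :> nat then f i v else \sum_(0 <= y < cut M x j.+1) f i y).
Proof.
move=> sx xM vx; set n := (size x).+1.
have := sum_tops_det f (fun j y => if j == size x then (y == v)%:R else 1) M 0 x.
under eq_bigr => k _.
  rewrite big_ord_recr /= eqxx big1 ?mul1r //; last by move=> j _; rewrite ltn_eqF.
  over.
move=> ->.
rewrite -(@det_col_prev n (fun i j => if j == size x then f i v else
   \sum_(0 <= y < cut M x j.+1) f i y) (fun j => (0 < j < size x)%:R)) //.
congr (\det _); apply/matrixP => i j; rewrite !mxE /=.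
have [je|jne] := eqVneq (j : nat) (size x).
  rewrite je ltnn andbF mul0r subr0 sum_delta //.
  by rewrite [X in (_ < X)%N]nth_default ?size_map.
have jx : (j < size x)%N by have := ltn_ord j; lia.
under eq_bigr => y _ do rewrite mul1r.
case: (posnP j) => [j0|j0] /=; first by rewrite mul0r subr0 j0.
rewrite jx mul1r ltn_eqF ?(leq_trans _ jx) //; last by rewrite prednK // ltnW.
have /andP[c1 c2] := cut_le j sx xM.
by rewrite prednK // [in RHS](big_cat_nat (leq0n (cut M x j)) c1) /= addrAC subrr add0r.
Qed.

End Arrays.

(** * Interlacing arrays with entries below a bound *)

Section ArrayMembership.
Implicit Types (M N n : nat) (x k : seq nat).

Fixpoint fits M lo x k : bool :=
  match x, k with
  | [::], [:: c] => (lo <= c < M)%N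
  | u :: x', c :: k' => (lo <= c <= u)%N && fits M u.+1 x' k'
  | _, _ => false
  end.

Lemma mem_tops M lo x k : (k \in tops M lo x) = fits M lo x k.
Proof.
elim: x lo k => [|u x IH] lo k /=.
  apply/mapP/idP => [[c + ->]|]; first by rewrite mem_index_iota.
  by case: k => [//|c [|//]] ck; exists c; rewrite ?mem_index_iota.
apply/allpairsPdep/idP => [[c [k' [+ + ->]]]|].
  by rewrite mem_index_iota ltnS IH => -> ->.
case: k => // c k /andP[cu fk]; exists c, k.
by rewrite mem_index_iota ltnS cu IH.
Qed.

Lemma tops_uniq M lo x : uniq (tops M lo x).
Proof.
elim: x lo => [|u x IH] lo /=.
  by rewrite map_inj_uniq ?iota_uniq // => c d [].
by apply: allpairs_uniq_dep => [||[c k] [d k'] _ _ /= [-> ->]] //; rewrite ?iota_uniq.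
Qed.

Lemma fitsP M lo x k : fits M lo x k <->
  [/\ size k = (size x).+1, (lo <= nth 0 k 0)%N,
      forall i, (i < size x)%N -> (nth 0 k i <= nth 0 x i < nth 0 k i.+1)%N
    & (nth 0 k (size x) < M)%N].
Proof.
elim: x lo k => [|u x IH] lo [|c k] /=; try by split=> // -[].
  case: k => [|d k]; last by split=> // -[].
  by split=> [/andP[]|[_ -> _ ->]].
split=> [/andP[/andP[lc cu] /IH[sk uk ik ks]]|[[sk] lc ik ks]].
  split=> //; first by rewrite sk.
  case=> [_|i] /=; last exact: ik.
  by rewrite cu.
rewrite lc; have /andP[-> /= uk] := ik 0%N isT.
by apply/IH; split=> // i ix; exact: (ik i.+1).
Qed.

Lemma fits_sorted M lo x k : fits M lo x k ->
  sorted ltn k /\ all (ltn^~ M) k.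
Proof.
move=> /fitsP[sk lk ik kM].
have Sk : sorted ltn k.
  apply/(sortedP 0%N) => i; rewrite sk ltnS => ix.
  by have /andP[] := ik i ix; exact: leq_ltn_trans.
split=> //; apply/(all_nthP 0%N) => i; rewrite sk ltnS /= => ix.
apply: leq_ltn_trans kM; move: ix; rewrite leq_eqVlt => /orP[/eqP->//|ix].
by apply/ltnW/(sorted_ltn_nth ltn_trans) => //; rewrite inE sk // ltnW.
Qed.

Lemma arrs_size M N z : z \in arrs M N -> size z = N.
Proof.
elim: N z => [|N IH] z /=; first by rewrite inE => /eqP->.
by move=> /allpairsPdep[z' [k [/IH + _ ->]]]; rewrite size_rcons => ->.
Qed.

Lemma arrs_uniq M N : uniq (arrs M N).
Proof.
elim: N => //= N IH; apply: allpairs_uniq_dep => // [z _|].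
  exact: tops_uniq.
by move=> [z k] [z' k'] _ _ /= /rcons_inj[-> ->].
Qed.

Lemma arrs_last M N z : z \in arrs M N ->
  [/\ size (last [::] z) = N, sorted ltn (last [::] z)
    & all (ltn^~ M) (last [::] z)].
Proof.
elim: N z => [|N IH] z /=; first by rewrite inE => /eqP->.
move=> /allpairsPdep[z' [k [/IH[sz' _ _] kt ->]]]; rewrite last_rcons.
move: kt; rewrite mem_tops => kf; have [? ?] := fits_sorted kf.
by split=> //; case/fitsP: kf; rewrite sz'.
Qed.

Lemma mem_arrs M N z : (z \in arrs M N) <->
  IA N z /\ (forall n, all (ltn^~ M) (level z n)).
Proof.
elim: N z => [|N IH] z /=.
  rewrite inE; split=> [/eqP->|[[/size0nil -> _ _] _]]; last by [].
  by split=> [|n]; [split=> // ? []|rewrite /level nth_nil].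
have lev z' k n : size z' = N -> level (rcons z' k) n =
    if (n < N)%N then level z' n else if n == N then k else [::].
  by move=> sz; rewrite /level nth_rcons sz.
have lastE z' : size z' = N -> last [::] z' = level z' N.-1.
  by move=> sz; rewrite /level -sz nth_last.
split=> [/allpairsPdep[z' [k [z'a kt ->]]]|[[sz zl zi] zM]].
  have sz' := arrs_size z'a; have [ls _ _] := arrs_last z'a.
  have /IH[[_ zl zi] zM] := z'a.
  move: kt; rewrite mem_tops => kf; have [kS kM] := fits_sorted kf.
  case/fitsP: kf; rewrite ls => sk _ ki _.
  split; last by move=> n; rewrite lev //; case: ifP => // _; case: eqP.
  split; first by rewrite size_rcons sz'.
  - move=> n nN; rewrite lev //; case: ltnP => [/zl//|Nn].
    by have -> : n = N by [lia]; rewrite eqxx sk.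
  - move=> n i; rewrite ltnS => nN iN; rewrite /entry !lev // nN.
    case: ltnP => nN'; first exact: zi.
    have E : n.+1 = N by lia.
    rewrite E eqxx -[n]/(n.+1.-1) E -lastE //; apply: ki; lia.
case/lastP: z sz zl zi zM => // z k; rewrite size_rcons => -[sz] zl zi zM.
have /IH zA : IA N z /\ (forall n, all (ltn^~ M) (level z n)).
  split; last first.
    move=> n; have := zM n; rewrite lev //; case: ltnP => // nN _.
    by rewrite /level nth_default ?sz.
  split=> // [n nN|n i nN iN]; first by have := zl n (ltnW nN); rewrite lev // nN.
  by have := zi n i (ltnW nN) iN; rewrite /entry !lev // nN (ltnW nN).
apply/allpairsPdep; exists z, k; split=> //.
have [ls _ _] := arrs_last zA; have := zl N (ltnSn N); rewrite lev // ltnn eqxx => -[sk kS].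
rewrite mem_tops; apply/fitsP; rewrite ls; split=> // [i iN|].
  have := zi N.-1 i; rewrite /entry !lev //; have -> : (N.-1.+1 = N)%N by lia.
  by rewrite ltnn eqxx !leqnn lastE //; apply.
have := zM N; rewrite lev // ltnn eqxx => kM.
by apply: (allP kM); rewrite mem_nth ?sk.
Qed.

End ArrayMembership.

(** * Summing out an array level by level *)

Section Tower.
Variables (R : realType) (a : nat -> R) (M : nat) (p : nat -> nat).
Variables (P : nat -> (nat -> R) -> R) (Q : nat -> (nat -> R) -> nat -> R).
Variable om : nat -> seq nat -> R.
Implicit Types (f : nat -> nat -> R).

(** Summing out level [n] leaves a determinant with one constant column, number [p n], while each
    other column depends on one coordinate of the level below. Levels [x] of weight zero are exempt:
    there a prescribed edge coordinate may fall outside its range. *)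
Definition level_rule n := forall f x,
  size x = n -> sorted ltn x -> all (ltn^~ M) x ->
  (n = 0%N \/ om n.-1 x != 0) ->
  \sum_(k <- tops M 0 x) om n k *
    \det (\matrix_(i < n.+1, j < n.+1) f i (nth 0%N k j)) =
  \det (\matrix_(i < n.+1, j < n.+1)
    if j == p n :> nat then P n (f i)
    else Q n (f i) (nth 0%N x (unbump (p n) j))).

Fixpoint tower N (g : nat -> R) (j : nat) : R :=
  if N is n.+1 then
    if j == p n then P n g
    else tower n (fun u => (a u)^-1 * Q n g u) (unbump (p n) j)
  else 0.

(** The top level carries no factor [1/a], since the determinants of [phi] contribute it for the
    lower level of each consecutive pair. *)
Definition array_weight N (z : array) : R :=
  (\prod_(n < N) om n (level z n)) *
  \prod_(n < N.-1) \prod_(u <- level z n) (a u)^-1.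

Lemma array_weight_rcons N z k : size z = N ->
  array_weight N.+1 (rcons z k) =
  array_weight N z * (\prod_(u <- last [::] z) (a u)^-1) * om N k.
Proof.
move=> sz; rewrite /array_weight big_ord_recr /= {2}/level nth_rcons sz ltnn eqxx.
have -> : \prod_(n < N) om n (level (rcons z k) n) = \prod_(n < N) om n (level z n).
  by apply: eq_bigr => n _; rewrite /level nth_rcons sz ltn_ord.
have -> : \prod_(n < N) \prod_(u <- level (rcons z k) n) (a u)^-1 =
    \prod_(n < N) \prod_(u <- level z n) (a u)^-1.
  by apply: eq_bigr => n _; rewrite /level nth_rcons sz ltn_ord.
case: N sz => [/size0nil->|N sz]; first by rewrite !big_ord0 big_nil; ring.
rewrite [\prod_(n < N.+1) \prod_(u <- _) _]big_ord_recr /=.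
by rewrite -[last _ _]nth_last sz; ring.
Qed.

Lemma det_col_scale n (A : nat -> nat -> R) (c : nat -> R) :
  \det (\matrix_(i < n, j < n) (c j * A i j)) =
  (\prod_(j < n) c j) * \det (\matrix_(i < n, j < n) A i j).
Proof.
rewrite (detE_prod_col n (fun i j => c j * A i j)) detE_prod_col mulr_sumr.
by apply: eq_bigr => s _; rewrite big_split mulrCA.
Qed.

(** Once the top level is summed out, expansion along the constant column gives minors of the same
    form with one level less. The induction hypothesis turns them into the minors of the tower
    matrix along the same column. *)
Lemma tower_sum N f : (forall n, (p n <= n)%N) ->
    (forall n, (n < N)%N -> level_rule n) ->
  \sum_(z <- arrs M N) array_weight N z *
    \det (\matrix_(i < N, j < N) f i (nth 0%N (last [::] z) j)) =
  \det (\matrix_(i < N, j < N) tower N (f i) j).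
Proof.
move=> pn; elim: N f => [|N IH] f rule.
  by rewrite big_seq1 !det_mx00 /array_weight !big_ord0 !mulr1.
have pN : (p N < N.+1)%N by rewrite ltnS.
pose p0 := Ordinal pN.
pose J i u := (a u)^-1 * Q N (f i) u.
rewrite (expand_det_col _ p0).
transitivity (\sum_(i < N.+1) P N (f i) * ((-1) ^+ (i + p N) *
   \sum_(z <- arrs M N) array_weight N z *
    \det (\matrix_(k < N, j < N) J (bump i k) (nth 0%N (last [::] z) j)))); last first.
  apply: eq_bigr => i _; rewrite mxE /= eqxx /cofactor; congr (_ * (_ * _)).
  rewrite (IH (fun k => J (bump i k))); last by move=> n nN; apply: rule; lia.
  congr (\det _); apply/matrixP => k j; rewrite !mxE /=.
  by rewrite eq_sym (negPf (neq_bump _ _)) bumpK.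
under [RHS]eq_bigr => i _ do rewrite !mulr_sumr.
rewrite /= big_allpairs_dep_seq exchange_big /=; apply: eq_big_seq => z za.
have sz := arrs_size za; have [sl Sl lM] := arrs_last za.
under eq_bigr => k _ do rewrite array_weight_rcons // last_rcons -mulrA.
rewrite -mulr_sumr.
(* Where the lower levels already have weight zero the rule may fail, but both sides vanish. *)
have [w0|w0] := eqVneq (array_weight N z) 0.
  by rewrite w0 !mul0r big1 // => i _; rewrite mul0r !mulr0.
rewrite rule //; last first.
  case: (N) sz w0 => [|n] sz; [by left|right; move: w0].
  rewrite /array_weight big_ord_recr /= !mulf_eq0 !negb_or => /andP[/andP[_]].
  by rewrite /level -nth_last sz.
rewrite (expand_det_col _ p0) !mulr_sumr; apply: eq_bigr => i _.
rewrite mxE /= eqxx /cofactor.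
set D' := \det (row' _ _); set D := \det _.
have -> : D = \prod_(u <- last [::] z) (a u)^-1 * D'.
  rewrite /D /J (det_col_scale _ (fun k j => Q N (f (bump i k)) (nth 0%N (last [::] z) j))
     (fun j => (a (nth 0%N (last [::] z) j))^-1)).
  congr (_ * _); first by rewrite (big_nth 0%N) sl big_mkord.
  congr (\det _); apply/matrixP => k j; rewrite !mxE /=.
  by rewrite eq_sym (negPf (neq_bump _ _)) bumpK.
ring.
Qed.

End Tower.

(** * Arrays with a prescribed edge *)

Section EdgeSums.
Variables (R : realType) (a : nat -> R).
Implicit Types (f : nat -> nat -> R).

(** Interlacing makes [x_i < y_j] equivalent to [i < j]. In the first column only the virtual row
    survives, and the remaining minor is triangular with diagonal [- 1/a]; its sign cancels that of
    the cofactor. *)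
Lemma det_phi n (x y : nat -> nat) :
    (forall i, (i < n.+1)%N -> (y i <= x i < y i.+1)%N) ->
    (forall i j, (i <= j < n.+2)%N -> (y i <= y j)%N) ->
  \det (\matrix_(i < n.+2, j < n.+2)
     phi a (if (i < n.+1)%N then Some (x i) else None) (y j)) =
  \prod_(i < n.+1) (a (x i))^-1.
Proof.
move=> xy yle.
have ltE i j : (i < n.+1)%N -> (j < n.+2)%N -> (x i < y j)%N = (i < j)%N.
  move=> iN jN; have /andP[h1 h2] := xy i iN.
  apply/idP/idP => [xj|ij]; last by apply: leq_trans h2 (yle _ _ _); rewrite ij.
  rewrite ltnNge; apply/negP => ji.
  have := yle j i; rewrite ji (ltn_trans iN) // => /(_ isT) yji.
  by move: xj; rewrite ltnNge (leq_trans yji).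
rewrite (expand_det_col _ ord0) (bigD1 ord_max) //= mxE ltnn mul1r.
rewrite big1 ?addr0; last first.
  move=> i im; have iN : (i < n.+1)%N.
    by rewrite ltn_neqAle -val_eqE in im *; rewrite im -ltnS ltn_ord.
  by rewrite mxE iN /= ltE // mulr0 mul0r.
rewrite /cofactor /= addn0 -det_tr det_trig.
  rewrite (eq_bigr (fun i : 'I_n.+1 => (-1) * (a (x i))^-1)).
    by rewrite big_split /= prodr_const card_ord mulrA -exprD addnn -signr_odd odd_double mul1r.
  move=> i _; rewrite !mxE lift_max ltn_ord /= ltE // /bump /=; last by have := ltn_ord i; lia.
  by rewrite add1n ltnSn mulr1 mulN1r.
apply/is_trig_mxP => i j ij; rewrite !mxE lift_max ltn_ord /= ltE // /bump /=; last by have := ltn_ord i; lia.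
by rewrite add1n ltnS leqNgt ij mulr0.
Qed.

Lemma phi_weight_IA N z : IA N z ->
  phi_weight a N z = \prod_(n < N.-1) \prod_(u <- level z n) (a u)^-1.
Proof.
move=> [sz zl zi]; apply: eq_bigr => n _.
have nN : (n.+1 < N)%N by have := ltn_ord n; lia.
have [s1 _] := zl n (ltnW nN); have [s2 S2] := zl n.+1 nN.
rewrite (big_nth 0%N) s1 big_mkord.
apply: (det_phi (x := entry z n) (y := entry z n.+1)) => [i iN|i j]; first exact: zi.
case/andP; rewrite leq_eqVlt => /orP[/eqP->//|ij] jN.
by apply/ltnW/(sorted_ltn_nth ltn_trans) => //; rewrite inE s2 // (ltn_trans ij).
Qed.

Definition det_weight N f (z : array) : R :=
  \det (\matrix_(i < N, j < N) f i (entry z N.-1 j)) * phi_weight a N z.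

Lemma array_weight_edge N (om : nat -> seq nat -> R) f z M : z \in arrs M N ->
  array_weight a om N z *
    \det (\matrix_(i < N, j < N) f i (nth 0%N (last [::] z) j)) =
  \prod_(n < N) om n (level z n) * det_weight N f z.
Proof.
move=> zM; have [zIA _] := (mem_arrs M N z).1 zM.
rewrite /array_weight /det_weight phi_weight_IA // -mulrA; congr (_ * _).
by rewrite mulrC /entry /level -nth_last (arrs_size zM).
Qed.

(** The tower with fixed last coordinates takes head sums of [f]; exchanging the order of summation
    moves them to the kernel, where they build up [right_ker]. *)
Lemma sum_right_edge f N M (v : seq nat) : size v = N -> sorted ltn v ->
    all (ltn^~ M) v ->
  \sum_(z <- arrs M N)
    \prod_(n < N) (entry z n n == nth 0%N v n)%:R * det_weight N f z =
  \det (\matrix_(i < N, j < N)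
    \sum_(y < M) right_ker a (N.-1 - j) (nth 0%N v j) y * f i y).
Proof.
move=> sv Sv vM.
have vlt n : (n < N)%N -> (nth 0%N v n < M)%N.
  by move=> nN; apply: (allP vM); rewrite mem_nth ?sv.
pose om n k : R := (nth 0%N k n == nth 0%N v n)%:R.
pose P n (g : nat -> R) := g (nth 0%N v n).
pose Q (n : nat) (g : nat -> R) u := \sum_(0 <= y < u.+1) g y.
have rule n : (n < N)%N -> level_rule M id P Q om n.
  move=> nN g x sx Sx xM om0; rewrite -sx in nN om0 *.
  rewrite /om sum_tops_right //.
    congr (\det _); apply/matrixP => i j; rewrite !mxE; case: eqP => // /eqP js.
    have jx : (j < size x)%N by have := ltn_ord j; lia.
    by rewrite /Q cutS // /unbump ltnNge (ltnW jx) subn0.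
  (* A lower level of nonzero weight ends at the preceding entry of [v], and [v] increases strictly,
     so the next entry lies in the range of the last coordinate. *)
  rewrite vlt // andbT; case: om0 => [->//|].
  case: x sx Sx xM nN => [//|u x] sx Sx xM nN; rewrite [X in cut _ _ X]/= cutS //.
  rewrite /om; have [E _|/negPf ne] := eqVneq (nth 0%N (u :: x) (size x)) (nth 0%N v (size x)); last first.
    by rewrite [X in X != 0](_ : _ = 0) ?eqxx //= ne.
  rewrite E.
  by rewrite (sorted_ltn_nth ltn_trans) // inE sv ?(ltnW nN).
have := tower_sum a f (fun n => leqnn n) rule.
move=> E; transitivity (\det (\matrix_(i < N, j < N) tower a id P Q N (f i) j)).
  rewrite -E; apply: eq_big_seq => z zM; rewrite (array_weight_edge _ _ zM).
  by congr (_ * _); apply: eq_bigr.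
congr (\det _); apply/matrixP => i j; rewrite !mxE.
have : (j < N)%N by []; have : (N <= N)%N by []; move: {j}(j : nat) (f i).
elim: {-2}N => //= n IH j g nN; rewrite ltnS leq_eqVlt => /orP[/eqP->|jn].
  rewrite eqxx subnn /= -(big_mkord xpredT (fun y => (y == nth 0%N v n)%:R * g y)).
  by rewrite sum_delta // vlt.
rewrite ltn_eqF // /unbump ltnNge (ltnW jn) subn0 IH ?(ltnW nN) //.
have -> : (n - j = (n.-1 - j).+1)%N by lia.
set K := (n.-1 - j)%N; rewrite /= /Q.
transitivity (\sum_(w < M) \sum_(y < M)
  (if (y <= w)%N then right_ker a K (nth 0%N v j) w * (a w)^-1 * g y else 0)).
  apply: eq_bigr => w _; rewrite -big_mkcond /= mulrA mulr_sumr.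
  by rewrite big_mkord (big_ord_widen_cond M xpredT (fun y => right_ker a K (nth 0%N v j) w / a w * g y)).
rewrite exchange_big /=; apply: eq_bigr => y _.
rewrite mulr_suml.
have vj : (nth 0%N v j < M)%N by apply: vlt; lia.
rewrite [RHS](_ : _ = \sum_(y <= w < M) right_ker a K (nth 0%N v j) w / a w * g y); last first.
  have [yv|vy] := leqP y (nth 0%N v j).
    rewrite [RHS](big_cat_nat (leqW yv) vj) /= [X in _ = _ + X]big_nat_cond.
    rewrite [X in _ = _ + X]big1 ?addr0 // => w /andP[/andP[vw _] _].
    by rewrite right_ker_above // !mul0r.
  rewrite big_geq // big_nat_cond big1 // => w /andP[/andP[yw _] _].
  by rewrite right_ker_above ?mul0r // (leq_trans vy).
by rewrite big_geq_mkord [RHS]big_mkcond.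
Qed.

(** Now the first coordinate of every level is fixed and the sums are tail sums, which become
    [left_ker]. The edge is listed from the top level down, whence the index [N.-1 - n]. *)
Lemma sum_left_edge f N M (v : seq nat) : size v = N -> sorted leq v ->
    all (ltn^~ M) v ->
  \sum_(z <- arrs M N)
    \prod_(n < N) (entry z n 0 == nth 0%N v (N.-1 - n))%:R * det_weight N f z =
  \det (\matrix_(i < N, j < N)
    \sum_(y < M) left_ker a j (nth 0%N v j) y * f i y).
Proof.
move=> sv Sv vM; pose w n := nth 0%N v (N.-1 - n).
have wlt n : (n < N)%N -> (w n < M)%N.
  by move=> nN; apply: (allP vM); rewrite mem_nth ?sv //; lia.
pose om n k : R := (nth 0%N k 0 == w n)%:R.
pose P n (g : nat -> R) := g (w n).
pose Q (n : nat) (g : nat -> R) u := \sum_(u.+1 <= y < M) g y.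
have rule n : (n < N)%N -> level_rule M (fun=> 0%N) P Q om n.
  move=> nN g x sx Sx xM om0; rewrite -sx in nN om0 *.
  rewrite /om sum_tops_left //.
    congr (\det _); apply/matrixP => i j; rewrite !mxE; case: eqP => // /eqP js.
    have jx : (j.-1 < size x)%N by have := ltn_ord j; lia.
    rewrite /Q -{1}[j : nat]prednK ?lt0n // cutS // /unbump.
    by have -> : (0 < j)%N by [lia]; rewrite subn1.
  case: om0 => [s0|]; first by move: nN; rewrite (size0nil s0); exact: wlt.
  case: x sx Sx xM nN => [//|u x] sx Sx xM nN; first by rewrite wlt.
  rewrite cutS // /om; have [E _|/negPf ne] := eqVneq (nth 0%N (u :: x) 0) (w (size x)); last first.
    by rewrite [X in X != 0](_ : _ = 0) ?eqxx //= ne.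
  rewrite E.
  rewrite ltnS /w; apply: (sorted_leq_nth leq_trans leqnn) => //; rewrite ?inE ?sv /=; lia.
have := tower_sum a f (fun n => leq0n n) rule.
move=> E; transitivity (\det (\matrix_(i < N, j < N) tower a (fun=> 0%N) P Q N (f i) j)).
  rewrite -E; apply: eq_big_seq => z zM; rewrite (array_weight_edge _ _ zM).
  by congr (_ * _); apply: eq_bigr.
congr (\det _); apply/matrixP => i j; rewrite !mxE.
have -> : nth 0%N v j = w (N.-1 - j)%N by rewrite /w; congr nth; have := ltn_ord j; lia.
suff gen n g m : (n <= N)%N -> (m < n)%N -> tower a (fun=> 0%N) P Q n g m =
    \sum_(y < M) left_ker a m (w (n.-1 - m)%N) y * g y by exact: gen.
elim: n g m {i j E} => //= n IH g j nN.
case: j => [|j] jn.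
  rewrite subn0 /= -(big_mkord xpredT (fun y => (y == w n)%:R * g y)).
  by rewrite sum_delta // wlt.
rewrite /= /unbump subn1 IH ?(ltnW nN) //=.
have -> : (n.-1 - j = n - j.+1)%N by lia.
rewrite /Q.
transitivity (\sum_(x < M) \sum_(y < M)
  (if (x < y)%N then left_ker a j (w (n - j.+1)%N) x * (a x)^-1 * g y else 0)).
  apply: eq_bigr => x _; rewrite -big_mkcond /= mulrA mulr_sumr.
  by rewrite big_geq_mkord.
rewrite exchange_big /=; apply: eq_bigr => y _.
rewrite mulr_suml (big_ord_widen_cond M xpredT (fun x => left_ker a j (w (n - j.+1)%N) x / a x * g y)) 1?ltnW //=.
by rewrite -big_mkcond.
Qed.

End EdgeSums.

(** * Correlation functions as determinants *)

Section CorrelationAlgebra.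
Variable R : realType.

(** A permutation other than the identity would have to raise [d] at every point it moves, yet it
    preserves the sum of [d]. Only the identity contributes. *)
Lemma det_graded m (d : 'I_m -> nat) (A : 'M[R]_m) :
    (forall i, A i i = 1) ->
    (forall i j, i != j -> ~~ (d i < d j)%N -> A i j = 0) ->
  \det A = 1.
Proof.
move=> A1 A0; rewrite /determinant (bigD1 1%g) //=.
rewrite odd_perm1 expr0 mul1r [X in X + _]big1 => [|i _]; last by rewrite perm1.
rewrite big1 ?addr0 // => s s1.
have [/forallP sd|/forallPn[i si]] := boolP [forall i, (s i == i) || (d i < d (s i))%N].
  case/eqP: s1; apply/permP => i; rewrite perm1; apply/eqP.
  apply: contraT => si.
  have lt : (\sum_j d j < \sum_j d (s j))%N.
    rewrite (bigD1 i) //= [ltnRHS](bigD1 i) //= -addSn leq_add //.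
      by have := sd i; rewrite (negPf si).
    by apply: leq_sum => j _; have /orP[/eqP->|/ltnW] := sd j.
  by move: lt; rewrite [ltnRHS](_ : _ = (\sum_j d j)%N) ?ltnn // [RHS](reindex_inj (@perm_inj _ s)).
rewrite (bigD1 i) //= A0 ?mul0r ?mulr0 //.
  by move: si; rewrite negb_or eq_sym => /andP[].
by move: si; rewrite negb_or => /andP[].
Qed.

Variables (N m : nat).
Implicit Types (X : 'M[R]_N) (b : 'M[R]_(N, m)) (c : 'M[R]_(m, N)).
Implicit Types (F T : 'M[R]_m).

(** [T] enters affinely here, whereas it enters the Schur complement [X + b' T c] through the
    inverse of [1 - T F]. *)
Definition corr_block X b c F T : 'M[R]_(N + m) :=
  block_mx X (- b) (T *m c) (1%:M - T *m F).

Lemma det_corr_block X b b' c F T : \det (1%:M - T *m F) = 1 ->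
    b' = b + b' *m (T *m F) ->
  \det (X + b' *m (T *m c)) = \det (corr_block X b c F T).
Proof.
move=> d1 bE; rewrite -[RHS]mul1r.
have <- : \det (block_mx 1%:M b' 0 1%:M : 'M[R]_(N + m)) = 1.
  by rewrite det_ublock !det1 mulr1.
rewrite -det_mulmx mulmx_block !mul1mx !mul0mx !add0r mulmxBr mulmx1 [X in - b + (X - _)]bE.
have -> : - b + (b + b' *m (T *m F) - b' *m (T *m F)) = 0 by rewrite addrK addNr.
by rewrite det_lblock d1 mulr1.
Qed.

(** Eliminating the block [X] instead brings out the correlation kernel [c X^-1 b - F]. *)
Lemma det_corr_block_unit X b c F T : X \in unitmx ->
  \det (corr_block X b c F T) =
  \det X * \det (1%:M + T *m (c *m invmx X *m b - F)).
Proof.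
move=> Xu; have -> : corr_block X b c F T = block_mx X 0 (T *m c) 1%:M *m
    block_mx 1%:M (- (invmx X *m b)) 0 (1%:M + T *m (c *m invmx X *m b - F)).
  rewrite mulmx_block !mulmx1 !mul0mx !mulmx0 !mul1mx !addr0 !mulmxN mulKVmx //.
  by congr block_mx; rewrite mulmxBr !mulmxA addrCA addKr.
by rewrite det_mulmx det_lblock det_ublock !det1 mulr1 mul1r.
Qed.

Definition minus_ind (S : {set 'I_m}) : 'M[R]_m :=
  diag_mx (\row_l - (l \in S)%:R).

(** Write each row of [K] as that of [1 - (1 - K)] and expand over the rows: those in [S] contribute
    [-(1 - K)], the others the identity. *)
Lemma det_incl_excl (K : 'M[R]_m) :
  \det K = \sum_(S in {set 'I_m}) (\prod_l (if l \in S then -1 else 1)) *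
    \det (1%:M + minus_ind S *m K).
Proof.
under eq_bigr => S _ do rewrite /determinant mulr_sumr.
rewrite exchange_big /=; apply: eq_bigr => s _.
rewrite [RHS](eq_bigr _ (fun S _ => mulrCA _ _ _)).
rewrite -mulr_sumr; congr (_ * _).
pose D l := (l == s l)%:R : R.
transitivity (\prod_l (- (D l - K l (s l)) + D l)).
  by apply: eq_bigr => l _; rewrite opprB subrK.
rewrite bigA_distr; apply: eq_bigr => S _; rewrite -big_split /=.
apply: eq_bigr => l _; rewrite !mxE (bigD1 l) //= big1 ?addr0; last first.
  by move=> j /negPf jl; rewrite !mxE eq_sym jl mulr0n mul0r.
rewrite !mxE eqxx mulr1n -/(D l); case: (l \in S) => /=; ring.
Qed.

End CorrelationAlgebra.

(** * Generating function of the occupied points *)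

Section CorrelationSums.
Variables (R : realType) (a : nat -> R) (N M m : nat).
Variables (q : 'I_m -> nat * nat) (f : nat -> nat -> R).
Hypothesis qN : forall l, ((q l).1 < N)%N.
Implicit Types (g : nat -> nat -> R) (t : 'I_m -> R) (h : nat -> R).

(** [left_ker] summed over its starting point, larger [x] contributing nothing. It is the kernel
    seen from the virtual coordinate, where [phi] equals 1. *)
Definition vker k y : R := \sum_(x < y.+1) left_ker a k x y.

Definition point_weight t (n y : nat) : R := 1 + \sum_l t l * (q l == (n, y))%:R.

(** A sum over increasing chains that start at [u], [k] levels below the top, and climb to the top
    level, with a factor [g] at all points but the first and [1/a] at all points but the last. *)
Fixpoint descend g k h u : R :=
  if k is k'.+1 then
    (a u)^-1 * \sum_(u.+1 <= y < M) g (N.-1 - k')%N y * descend g k' h y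
  else h u.

Lemma tower_descend g h n j : (n <= N)%N -> (j < n)%N ->
  tower a (fun=> 0%N) (fun n h => \sum_(y < M) g n y * h y)
    (fun n h u => \sum_(u.+1 <= y < M) g n y * h y) n (descend g (N - n) h) j =
  \sum_(y < M) g (n.-1 - j)%N y * descend g (N - n + j) h y.
Proof.
elim: n j => //= n IH j nN; case: j => [|j] jn.
  by rewrite /= subn0 addn0.
rewrite /= /unbump subn1 /=.
have -> : (N - n.+1 + j.+1 = N - n + j)%N by lia.
have -> : (n - j.+1 = n.-1 - j)%N by lia.
rewrite -IH ?(ltnW nN) //; congr tower; apply: funext => u.
have -> : (N - n = (N - n.+1).+1)%N by lia.
by rewrite /=; have -> : (N.-1 - (N - n.+1) = n)%N by lia.
Qed.

(** [left_ker] unfolds from its last point and [descend] from its first; both sum over the same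
    chains. *)
Lemma left_ker_first k v y : (y < M)%N ->
  left_ker a k.+1 v y = (a v)^-1 * \sum_(v.+1 <= w < M) left_ker a k w y.
Proof.
elim: k y => [|k IH] y yM.
  rewrite /=; under eq_bigr => w _ do rewrite mulrC.
  have [vy|yv] := ltnP v y.
    rewrite (bigD1 (Ordinal vy)) //= eqxx mulr1 big1 ?addr0; last first.
      by move=> w; rewrite -val_eqE /= => /negPf->; rewrite mulr0.
    under eq_bigr => w _ do rewrite eq_sym -[(_ == _)%:R]mulr1.
    by rewrite (sum_delta (fun=> 1)) ?vy // mulr1.
  rewrite [LHS]big1 => [|w _]; last by rewrite ltn_eqF ?mulr0 //; have := ltn_ord w; lia.
  rewrite big_nat_cond big1 ?mulr0 // => w /andP[/andP[vw _] _].
  by rewrite ltn_eqF // (leq_ltn_trans yv).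
rewrite [LHS]/= -/(left_ker a k.+1).
under eq_bigr => w _.
  rewrite [X in X * _](_ : _ = left_ker a k.+1 v w) // IH ?(ltn_trans _ yM) //.
  over.
under eq_bigr => w _ do rewrite -mulrA mulr_suml.
by rewrite -mulr_sumr exchange_big.
Qed.

Lemma descend1 k h x : (x < M)%N ->
  descend (fun _ _ => 1) k h x = \sum_(y < M) left_ker a k x y * h y.
Proof.
elim: k x => [|k IH] x xM.
  rewrite /= -(big_mkord xpredT (fun y => (y == x)%:R * h y)) sum_delta //.
rewrite [LHS]/=.
under eq_big_nat => y /andP[_ yM] do rewrite mul1r IH //.
rewrite exchange_big mulr_sumr; apply: eq_bigr => w _.
by rewrite left_ker_first // -mulr_suml mulrA.
Qed.

Definition depth (l : 'I_m) : nat := (N.-1 - (q l).1)%N.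

(** Expand the factors [1 + t] along a chain and sort the terms by the first factor that contributes
    its [t]: up to that point [q l] the chain is unweighted, beyond it all factors are kept. *)
Lemma descend_point t k h x : (forall l, ((q l).2 < M)%N) ->
    (k < N)%N -> (x < M)%N ->
  descend (point_weight t) k h x = \sum_(y < M) left_ker a k x y * h y +
    \sum_l (if (depth l < k)%N then
       t l * left_ker a (k - depth l) x (q l).2 *
       descend (point_weight t) (depth l) h (q l).2 else 0).
Proof.
move=> qM; elim: k x => [|k IH] x kN xM.
  by rewrite [X in _ + X]big1 // addr0 -descend1.
rewrite -descend1 // [LHS]/= [in RHS]/=.
set b := fun l => descend (point_weight t) (depth l) h (q l).2.
have pw y : point_weight t (N.-1 - k)%N y * descend (point_weight t) k h y =
    descend (point_weight t) k h y +
    \sum_l t l * ((depth l == k) && (y == (q l).2))%:R * b l.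
  rewrite /point_weight mulrDl mul1r mulr_suml; congr (_ + _).
  apply: eq_bigr => l _; rewrite -!mulrA; congr (_ * _).
  have -> : (q l == ((N.-1 - k)%N, y)) = (depth l == k) && (y == (q l).2).
    rewrite -pair_eqE /pair_eq /= [y == _]eq_sym; congr (_ && _).
    by apply/eqP/eqP; rewrite /depth; have := qN l; lia.
  case: eqP => [dk|_] /=; last by rewrite !mul0r.
  by case: eqP => [->|_]; rewrite ?mul0r // /b dk.
under eq_bigr => y _ do rewrite pw.
rewrite big_split mulrDr /=.
under eq_big_nat => y /andP[_ yM] do rewrite (IH y (ltnW kN) yM).
rewrite big_split mulrDr /= -addrA; congr (_ + _).
  by congr (_ * _); apply: eq_big_nat => y /andP[_ yM]; rewrite mul1r descend1.
rewrite -mulrDr -big_split /=.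
under eq_bigr => y _ do rewrite -big_split /=.
rewrite exchange_big mulr_sumr; apply: eq_bigr => l _ /=.
rewrite -/(b l); have [dk|dk] := eqVneq (depth l) k.
  rewrite dk ltnSn subSnn left_ker_first // ltnn /= mulrCA -mulrA; congr (_ * _).
  rewrite !(mulr_sumr, mulr_suml); apply: eq_bigr => y _.
  by rewrite add0r [y == _]eq_sym; ring.
have -> : (depth l < k.+1)%N = (depth l < k)%N by lia.
case: ifP => ltk; last by rewrite big1 ?mulr0 // => y _; rewrite /= mulr0 mul0r addr0.
have -> : (k.+1 - depth l = (k - depth l).+1)%N by lia.
rewrite left_ker_first // mulrCA -mulrA; congr (_ * _).
rewrite !(mulr_sumr, mulr_suml); apply: eq_bigr => y _.
by rewrite /= mulr0 mul0r addr0.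
Qed.

Lemma sum_weighted g : 
  \sum_(z <- arrs M N) (\prod_(n < N) \prod_(u <- level z n) g n u) *
    det_weight a N f z =
  \det (\matrix_(i < N, j < N)
    \sum_(y < M) g (N.-1 - j)%N y * descend g j (f i) y).
Proof.
pose om n k : R := \prod_(u <- k) g n u.
pose P n (h : nat -> R) := \sum_(y < M) g n y * h y.
pose Q n (h : nat -> R) u := \sum_(u.+1 <= y < M) g n y * h y.
have rule n : (n < N)%N -> level_rule M (fun=> 0%N) P Q om n.
  move=> nN h x sx Sx xM _; rewrite -sx.
  transitivity (\sum_(k <- tops M 0 x)
    \det (\matrix_(i < (size x).+1, j < (size x).+1)
      (fun i y => g (size x) y * h i y) i (nth 0%N k j))).
    apply: eq_big_seq => k; rewrite mem_tops => /fitsP[sk _ _ _].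
    rewrite (det_col_scale _ (fun i j => h i (nth 0%N k j))
       (fun j => g (size x) (nth 0%N k j))) /om; congr (_ * _).
    by rewrite (big_nth 0%N) sk big_mkord.
  rewrite (sum_tops_total (fun i y => g (size x) y * h i y)) //; congr (\det _); apply/matrixP => i j; rewrite !mxE.
  case: eqP => [->|/eqP j0]; first by rewrite big_mkord.
  have jx : (j.-1 < size x)%N by have := ltn_ord j; lia.
  rewrite /Q -{1}[j : nat]prednK ?lt0n // cutS // /unbump.
  by have -> : (0 < j)%N by [lia]; rewrite subn1.
have E := tower_sum a f (fun n => leq0n n) rule.
transitivity (\det (\matrix_(i < N, j < N) tower a (fun=> 0%N) P Q N (f i) j)).
  by rewrite -E; apply: eq_big_seq => z zM; rewrite (array_weight_edge _ _ _ zM).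
congr (\det _); apply/matrixP => i j; rewrite !mxE.
have := @tower_descend g (f i) N j (leqnn N) (ltn_ord j).
by rewrite subnn add0n => <-.
Qed.

(** Chain sums without marks: [corr_X] runs from the virtual coordinates to the rows of [f],
    [corr_b] from a marked point to the rows, [corr_c] from a virtual coordinate to a marked point,
    [corr_F] between marked points. *)
Definition corr_X : 'M[R]_N := \matrix_(i, j) \sum_(y < M) vker j y * f i y.
Definition corr_b : 'M[R]_(N, m) :=
  \matrix_(i, l) \sum_(y < M) left_ker a (depth l) (q l).2 y * f i y.
Definition corr_c : 'M[R]_(m, N) :=
  \matrix_(l, j) if (depth l <= j)%N then vker (j - depth l) (q l).2 else 0.
Definition corr_F : 'M[R]_m :=
  \matrix_(l, l') if (depth l < depth l')%N then
    left_ker a (depth l' - depth l) (q l').2 (q l).2 else 0.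

Lemma sum_vker k h :
  \sum_(x < M) \sum_(y < M) left_ker a k x y * h y = \sum_(y < M) vker k y * h y.
Proof.
rewrite exchange_big; apply: eq_bigr => y _; rewrite /= -mulr_suml; congr (_ * _).
rewrite /vker [RHS](big_ord_widen M (fun x => left_ker a k x y)) ?ltn_ord //.
rewrite [RHS]big_mkcond; apply: eq_bigr => x _; rewrite ltnS.
case: leqP => // yx; case: k => [|k]; first by rewrite /= ltn_eqF.
by rewrite left_ker_below // ltnW.
Qed.

(** [b'] collects the chains from the marked points with all factors kept. [descend_point] gives
    [b' = b + b' T F] and identifies the tower matrix with [X + b' T c]. As [F] is nonzero only when
    the depth increases, [1 - T F] has determinant 1. *)
Lemma sum_point_weight t : (forall l, ((q l).2 < M)%N) ->
  \sum_(z <- arrs M N) (\prod_(n < N) \prod_(u <- level z n) point_weight t n u) *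
    det_weight a N f z =
  \det (corr_block corr_X corr_b corr_c corr_F (diag_mx (\row_l t l))).
Proof.
move=> qM; rewrite sum_weighted.
pose b' : 'M[R]_(N, m) :=
  \matrix_(i, l) descend (point_weight t) (depth l) (f i) (q l).2.
have dN l : (depth l < N)%N by rewrite /depth; have := qN l; lia.
rewrite -(@det_corr_block _ _ _ corr_X corr_b b').
- congr (\det _); apply/matrixP => i j; rewrite !mxE.
  have pw y : point_weight t (N.-1 - j)%N y * descend (point_weight t) j (f i) y =
    descend (point_weight t) j (f i) y +
    \sum_l t l * ((depth l == j) && (y == (q l).2))%:R * b' i l.
    rewrite /point_weight mulrDl mul1r mulr_suml; congr (_ + _).
    apply: eq_bigr => l _; rewrite -!mulrA; congr (_ * _).
    have -> : (q l == ((N.-1 - j)%N, y)) = (depth l == j) && (y == (q l).2).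
      rewrite -pair_eqE /pair_eq /= [y == _]eq_sym; congr (_ && _).
      by apply/eqP/eqP; rewrite /depth; have := qN l; have := ltn_ord j; lia.
    case: eqP => [dk|_] /=; last by rewrite !mul0r.
    by case: eqP => [->|_]; rewrite ?mul0r // mxE dk.
  under eq_bigr => y _ do rewrite pw descend_point //.
  rewrite !big_split /= sum_vker -addrA; congr (_ + _).
  rewrite exchange_big [X in _ + X]exchange_big -big_split /=.
  apply: eq_bigr => l _; rewrite mul_diag_mx !mxE.
  have [dj|dj] := eqVneq (depth l) j.
    rewrite dj leqnn ltnn subnn big1 ?add0r // /vker.
    rewrite [\sum_(x < _.+1) _](_ : _ = 1); last first.
      rewrite (bigD1 ord_max) //= eqxx big1 ?addr0 // => x.
      by rewrite -val_eqE eq_sym => /negPf /= ->.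
    rewrite mulr1 -mulr_suml -mulr_sumr.
    rewrite [\sum_(y < M) _](_ : _ = 1) ?mulr1; last first.
      rewrite (bigD1 (Ordinal (qM l))) //= eqxx big1 ?addr0 // => y.
      by rewrite -val_eqE => /negPf /= ->.
    by rewrite mulrC.
  rewrite [X in _ + X]big1 ?addr0; last by move=> y _; rewrite /= mulr0 mul0r.
  have -> : (depth l <= j)%N = (depth l < j)%N by lia.
  case: ltnP => dj'; last by rewrite big1 ?mulr0.
  rewrite -mulr_suml -mulr_sumr mulrC; congr (_ * (_ * _)).
  rewrite /vker [RHS](big_ord_widen M (fun x => left_ker a (j - depth l) x (q l).2)) //.
  rewrite [RHS]big_mkcond; apply: eq_bigr => x _; rewrite ltnS.
  case: leqP => // yx; have -> : (j - depth l = (j - depth l).-1.+1)%N by lia.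
  by rewrite left_ker_below // ltnW.
- apply: (det_graded (d := depth)) => [l|l l' ll' dd]; rewrite mul_diag_mx !mxE.
    by rewrite eqxx ltnn mulr0 subr0.
  by rewrite (negPf ll') (negPf dd) mulr0 subr0.
- apply/matrixP => i l; rewrite !mxE descend_point //; congr (_ + _).
  apply: eq_bigr => l' _; rewrite mul_diag_mx !mxE.
  by case: ifP => _; rewrite ?mulr0 // mulrC.
Qed.

Lemma prod_neq (x : nat) (s : seq nat) :
  \prod_(u <- s) (x != u)%:R = (x \notin s)%:R :> R.
Proof.
elim: s => [|u s IH]; first by rewrite big_nil.
by rewrite big_cons IH inE negb_or -natrM mulnb.
Qed.

(** With [t = -1] on [S] the weight of a site is 0 or 1; injectivity of [q] excludes that several
    marks fall on one site. *)
Lemma point_weight_set (S : {set 'I_m}) z : injective q -> z \in arrs M N ->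
  \prod_(n < N) \prod_(u <- level z n) point_weight (fun l => - (l \in S)%:R) n u =
  \prod_l (if l \in S then ((q l).2 \notin level z (q l).1)%:R else 1) :> R.
Proof.
move=> qi zM; have [[_ zl _] _] := (mem_arrs M N z).1 zM.
have pw n u : point_weight (fun l => - (l \in S)%:R) n u =
    \prod_(l in S) (q l != (n, u))%:R.
  rewrite /point_weight; have [/existsP[l /andP[lS /eqP ql]]|/existsPn nl] :=
    boolP [exists l, (l \in S) && (q l == (n, u))].
    rewrite (bigD1 l) //= [RHS](bigD1 l) //= lS ql eqxx mul0r mulr1 big1 ?addr0 ?subrr //.
    by move=> l' ll'; rewrite -ql (inj_eq qi) (negPf ll') mulr0.
  rewrite big1 ?addr0; last first.
    by move=> l _; have := nl l; case: (l \in S) => /= [/negPf->|_]; rewrite ?mulr0 ?oppr0 ?mul0r.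
  by rewrite big1 // => l lS; have := nl l; rewrite lS /= => ->.
transitivity (\prod_(n < N) \prod_(l in S) \prod_(u <- level z n) (q l != (n : nat, u))%:R : R).
  apply: eq_bigr => n _; rewrite exchange_big; apply: eq_bigr => u _; exact: pw.
rewrite exchange_big -[RHS]big_mkcond /=; apply: eq_bigr => l lS.
rewrite (bigD1 (Ordinal (qN l))) //= [X in _ * X]big1 ?mulr1; last first.
  move=> n nl; rewrite big1 // => u _.
  by rewrite -pair_eqE /pair_eq /= eq_sym -val_eqE in nl *; rewrite (negPf nl).
rewrite -prod_neq; apply: eq_bigr => u _.
by rewrite -pair_eqE /pair_eq /= eqxx.
Qed.

(** The indicator that every mark is occupied is the product over [l] of 1 minus the indicator that
    [q l] is vacant, expanded over subsets [S]. *)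
Lemma sum_correlation : injective q -> (forall l, ((q l).2 < M)%N) ->
  \sum_(z <- arrs M N | [forall l, (q l).2 \in level z (q l).1]) det_weight a N f z =
  \sum_(S in {set 'I_m}) (\prod_l (if l \in S then -1 else 1)) *
    \det (corr_block corr_X corr_b corr_c corr_F (minus_ind R S)).
Proof.
move=> qi qM; under [RHS]eq_bigr => S _ do
  rewrite /minus_ind -sum_point_weight // mulr_sumr.
rewrite exchange_big big_mkcond; apply: eq_big_seq => z zM /=.
under eq_bigr => S _ do rewrite (point_weight_set _ qi zM) mulrA -big_split /=.
rewrite -mulr_suml.
pose e l : R := ((q l).2 \notin level z (q l).1)%:R.
transitivity ((\prod_l (- e l + 1)) * det_weight a N f z).
  case: ifP => [/forallP h|/negbT/forallPn[l nl]].
    by rewrite big1 ?mul1r // => l _; rewrite /e h oppr0 add0r.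
  by rewrite (bigD1 l) //= /e nl addNr !mul0r.
rewrite bigA_distr; congr (_ * _); apply: eq_bigr => S _.
by apply: eq_bigr => l _; case: ifP => _; rewrite ?mulN1r ?mul1r.
Qed.

End CorrelationSums.

(** * Masses as limits of finite sums *)

Section Exhaustion.
Variable R : realType.

Lemma esum_exhaust (T : choiceType) (D A : set T) (r : nat -> seq T) (h : T -> R) :
    (forall x, 0 <= h x) -> (forall M, uniq (r M)) ->
    (forall M M', (M <= M')%N -> {subset r M <= r M'}) ->
    (forall x, D x <-> exists M, x \in r M) ->
  (fun M => (\sum_(x <- r M | x \in A) h x)%:E) @ \oo -->
    (\esum_(x in D `&` A) (h x)%:E)%E.
Proof.
move=> h0 ru rs rD; pose S M : set T := [set` [seq x <- r M | x \in A]].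
have sE M : (\sum_(x <- r M | x \in A) h x)%:E = (\sum_(x \in S M) (h x)%:E)%E.
  by rewrite -fsbig_seq ?filter_uniq // big_filter sumEFin.
have Sfin M : finite_set (S M) by exact: finite_seq.
have hE0 x : (0 <= (h x)%:E)%E by rewrite lee_fin.
suff -> : (\esum_(x in D `&` A) (h x)%:E)%E =
    ereal_sup (range (fun M => (\sum_(x <- r M | x \in A) h x)%:E)).
  apply: ereal_nondecreasing_cvgn => M M' MM'; rewrite !sE.
  apply: lee_fsum_nneg_subset => // x /set_mem; rewrite /S /= mem_filter.
  case/andP => xA /(rs _ _ MM') xr.
  by apply/mem_set; rewrite /S /= mem_filter xA xr.
apply/eqP; rewrite eq_le; apply/andP; split; last first.
  apply: ge_ereal_sup => _ [M _ <-]; apply: esum_ge; exists (S M); last by rewrite sE.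
  split=> // x; rewrite /S /= mem_filter => /andP[/set_mem xA xM]; split=> //.
  by apply/rD; exists M.
apply: ge_ereal_sup => _ [X [Xfin XD] <-].
have /finite_seqP[s Xs] := Xfin.
have [M sM] : exists M, {subset s <= r M}.
  have : forall x, x \in s -> D x by move=> x xs; apply: (proj1 (XD x _)); rewrite Xs.
  elim: s {Xs} => [|x s IH] sD; first by exists 0%N.
  have [|M sM] := IH; first by move=> y ys; apply: sD; rewrite inE ys orbT.
  have /rD[M' xM'] := sD x (mem_head _ _).
  exists (maxn M M') => y; rewrite inE => /orP[/eqP->|/sM].
    by apply: rs xM'; rewrite leq_maxr.
  by apply: rs; rewrite leq_maxl.
apply: (@le_trans _ _ (\sum_(x \in S M) (h x)%:E)%E).
  apply: lee_fsum_nneg_subset => // x /set_mem Xx; apply/mem_set.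
  rewrite /S /= mem_filter sM ?andbT; last by move: Xx; rewrite Xs.
  by apply/mem_set; exact: (proj2 (XD x Xx)).
by rewrite -sE; apply: ereal_sup_ubound; exists M.
Qed.

Lemma esum_le_bound (T : choiceType) (D A : set T) (r : nat -> seq T) (h : T -> R) (B : R) :
    (forall x, 0 <= h x) -> (forall M, uniq (r M)) ->
    (forall M M', (M <= M')%N -> {subset r M <= r M'}) ->
    (forall x, D x <-> exists M, x \in r M) ->
    (forall M, \sum_(x <- r M) h x <= B) ->
  (\esum_(x in D `&` A) (h x)%:E <= B%:E)%E.
Proof.
move=> h0 ru rs rD hB; have cv := esum_exhaust (A := A) h0 ru rs rD.
rewrite -(cvg_lim _ cv) //; apply: lime_le; first by apply/cvg_ex; eexists; exact: cv.
near=> M; rewrite lee_fin; apply: le_trans (hB M).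
by rewrite big_mkcond; apply: ler_sum => x _; case: ifP.
Unshelve. all: by end_near. Qed.

(** Positive and negative parts converge separately; the bound [B] keeps both finite, so that their
    difference is meaningful. *)
Lemma mass_limit (D A : set array) (r : nat -> seq array) (W : array -> R) (B : R) :
    (forall M, uniq (r M)) ->
    (forall M M', (M <= M')%N -> {subset r M <= r M'}) ->
    (forall x, D x <-> exists M, x \in r M) ->
    (forall M, \sum_(x <- r M) `|W x| <= B) ->
  (fun M => \sum_(x <- r M | x \in A) W x) @ \oo --> mass W (D `&` A).
Proof.
move=> ru rs rD hB.
have part (h : array -> R) : (forall x, 0 <= h x) -> (forall x, h x <= `|W x|) ->
  (fun M => \sum_(x <- r M | x \in A) h x) @ \oo --> fine (\esum_(x in D `&` A) (h x)%:E)%E /\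
  (\esum_(x in D `&` A) (h x)%:E)%E \is a fin_num.
  move=> h0 hW.
  have fin : (\esum_(x in D `&` A) (h x)%:E)%E \is a fin_num.
    rewrite ge0_fin_numE; last by apply: esum_ge0 => x _; rewrite lee_fin.
    apply: (@le_lt_trans _ _ B%:E); last exact: ltry.
    apply: (esum_le_bound A h0 ru rs rD) => M; apply: le_trans (hB M).
    exact: ler_sum.
  split=> //.
  have := esum_exhaust (A := A) h0 ru rs rD; rewrite -(fineK fin).
  by move=> /fine_cvgP[].
have p0 (h : array -> R) x : 0 <= Num.max (h x) 0 by rewrite le_max lexx orbT.
have pW x : Num.max (W x) 0 <= `|W x| by rewrite ge_max normr_ge0 ler_norm.
have nW x : Num.max (- W x) 0 <= `|W x| by rewrite ge_max normr_ge0 -normrN ler_norm.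
have [pc pf] := part _ (p0 W) pW.
have [nc nf] := part _ (p0 (fun x => - W x)) nW.
rewrite /mass.
rewrite [X in fine (X - _)%E](_ : _ = (\esum_(x in D `&` A) (Num.max (W x) 0)%:E)%E); last first.
  by apply: eq_esum => x _; rewrite funeposE /= EFin_max.
rewrite [X in fine (_ - X)%E](_ : _ = (\esum_(x in D `&` A) (Num.max (- W x) 0)%:E)%E); last first.
  by apply: eq_esum => x _; rewrite funenegE /= EFin_max EFinN.
rewrite fineB //.
rewrite (_ : (fun M => \sum_(x <- r M | x \in A) W x) =
  (fun M => \sum_(x <- r M | x \in A) Num.max (W x) 0) -
  (fun M => \sum_(x <- r M | x \in A) Num.max (- W x) 0)).
  exact: cvgB.
apply: funext => M /=; rewrite /GRing.opp /GRing.add /= -sumrB.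
by apply: eq_bigr => x _; case: (leP (W x) 0) => W0; case: (leP (- W x) 0) => W1; lra.
Qed.

Lemma summable_exhaust (D : set array) (r : nat -> seq array) (W : array -> R) (B : R) :
    (forall M, uniq (r M)) ->
    (forall M M', (M <= M')%N -> {subset r M <= r M'}) ->
    (forall x, D x <-> exists M, x \in r M) ->
    (forall M, \sum_(x <- r M) `|W x| <= B) -> is_signed_measure D W.
Proof.
move=> ru rs rD hB; rewrite /is_signed_measure /summable.
apply: (@le_lt_trans _ _ B%:E); last exact: ltry.
have := esum_le_bound setT (h := fun x => `|W x|) (fun x => normr_ge0 _) ru rs rD hB.
by rewrite setIT; apply: le_trans; rewrite le_eqVlt; apply/orP; left; apply/eqP/eq_esum.
Qed.

End Exhaustion.

(** * Absolute summability of the weights *)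

Section Bounds.
Variables (R : realType) (a : nat -> R).

Lemma sum_geo_le (rho : R) lo hi : 0 < rho < 1 ->
  \sum_(lo <= y < hi) rho ^+ y <= (1 - rho)^-1.
Proof.
move=> /andP[r0 r1]; have [le|lt] := leqP lo hi; last first.
  by rewrite big_geq 1?ltnW // invr_ge0 subr_ge0 ltW.
apply: (@le_trans _ _ (\sum_(0 <= y < hi) rho ^+ y)).
  rewrite (big_cat_nat (n := lo) (m := 0%N)) //= lerDr.
  by apply: sumr_ge0 => y _; rewrite exprn_ge0 // ltW.
have := @geometric_le_lim R hi 1 rho ler01 r0; rewrite div1r => h.
apply: le_trans (h _); last by rewrite ger0_norm // ltW.
by rewrite le_eqVlt /series; apply/orP/or_introl/eqP/eq_bigr => y _; rewrite /geometric /= mul1r.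
Qed.

Lemma sum_tops_geo (rho : R) M lo x : 0 < rho < 1 ->
  \sum_(k <- tops M lo x) \prod_(u <- k) rho ^+ u <= (1 - rho)^-1 ^+ (size x).+1.
Proof.
move=> r01; have -> : \sum_(k <- tops M lo x) \prod_(u <- k) rho ^+ u =
    \sum_(k <- tops M lo x) \prod_(j < (size x).+1) rho ^+ nth 0%N k j.
  apply: eq_big_seq => k.
  rewrite mem_tops => /fitsP[sk _ _ _].
  by rewrite (big_nth 0%N) sk big_mkord.
rewrite (sum_tops_prod (fun _ y => rho ^+ y)) -[X in _ ^+ X]card_ord -prodr_const.
apply: ler_prod => j _; rewrite sum_geo_le // andbT.
by apply: sumr_ge0 => y _; rewrite exprn_ge0 //; case/andP: r01 => /ltW.
Qed.

Lemma sum_arrs_geo (rho : R) N : 0 < rho < 1 -> exists B, forall M,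
  \sum_(z <- arrs M N) \prod_(k <- z) \prod_(u <- k) rho ^+ u <= B.
Proof.
move=> r01; have r0 : 0 <= rho by case/andP: r01 => /ltW.
elim: N => [|N [B hB]]; first by exists 1 => M; rewrite big_seq1 big_nil.
exists (B * (1 - rho)^-1 ^+ N.+1) => M; rewrite /= big_allpairs_dep_seq.
have g0 : 0 <= (1 - rho)^-1 by rewrite invr_ge0 subr_ge0; case/andP: r01 => _ /ltW.
apply: (@le_trans _ _ (\sum_(z <- arrs M N)
    (\prod_(k <- z) \prod_(u <- k) rho ^+ u) * (1 - rho)^-1 ^+ N.+1)).
  rewrite big_seq [leRHS]big_seq; apply: ler_sum => z zM.
  rewrite [leLHS](eq_bigr (fun k => (\prod_(k <- z) \prod_(u <- k) rho ^+ u) * \prod_(u <- k) rho ^+ u)); last first.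
    by move=> k _; rewrite -cats1 big_cat big_seq1.
  rewrite -mulr_sumr ler_wpM2l //.
    by apply: prodr_ge0 => k _; apply: prodr_ge0 => u _; rewrite exprn_ge0.
  by have [<- _ _] := arrs_last zM; exact: sum_tops_geo.
by rewrite -mulr_suml ler_wpM2r // exprn_ge0.
Qed.

(** The last coordinate is the largest of its level, and it increases from each level to the
    next. *)
Lemma arrs_le_top M N z : z \in arrs M N -> forall k, k \in z ->
  forall u, u \in k -> (u <= nth 0%N (last [::] z) N.-1)%N.
Proof.
elim: N z => [|N IH] z /=; first by rewrite inE => /eqP->.
move=> /allpairsPdep[z' [k [z'M kt ->]]] k'; rewrite last_rcons mem_rcons inE.
move: kt; rewrite mem_tops => kf; have [Sk _] := fits_sorted kf.
case/fitsP: (kf) => sk _ ik _; have [sl _ _] := arrs_last z'M; rewrite sl in sk ik.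
case/orP => [/eqP->|k'z] u uk.
  rewrite -(nth_index 0%N uk).
  have iN : (index u k <= N)%N by rewrite -ltnS -sk index_mem.
  move: iN; rewrite leq_eqVlt => /orP[/eqP->//|iN].
  by apply/ltnW/(sorted_ltn_nth ltn_trans) => //; rewrite inE sk // ltnW.
apply: leq_trans (IH _ z'M _ k'z _ uk) _.
case: (N) sl z'M ik => [|n] sl z'M ik.
  by move: z'M k'z; rewrite inE => /eqP->.
by have /andP[_ /ltnW] := ik n (ltnSn n).
Qed.

Lemma det_norm_le N (A : 'M[R]_N) (B : 'I_N -> R) :
  (forall i j, `|A i j| <= B j) -> `|\det A| <= N`!%:R * \prod_j B j.
Proof.
move=> AB; rewrite /determinant; apply: le_trans (ler_norm_sum _ _ _) _.
rewrite (le_trans (y := \sum_(s : 'S_N) \prod_j B j)) //.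
  apply: ler_sum => s _; rewrite normrM normrX normrN1 expr1n mul1r normr_prod.
  rewrite [leRHS](reindex_inj (@perm_inj _ s)) /=; apply: ler_prod => i _.
  by rewrite normr_ge0 AB.
by rewrite sumr_const card_Sn mulr_natl.
Qed.

Variables (N : nat) (f : nat -> nat -> R) (c C r : R).
Hypothesis ac : forall u, 0 <= (a u)^-1 <= c.
Hypothesis r01 : 0 < r < 1.
Hypothesis fC : forall i y, (i < N)%N -> `|f i y| <= C * r ^+ y.

(** The available decay is [r] to the power of the largest coordinate alone. There are at most
    [N * N] coordinates, none larger, so the root [rho] of that order spreads the decay over the
    whole array, where the sums over all coordinates converge. *)
Lemma det_weight_bound : exists B, forall M,
  \sum_(z <- arrs M N) `|det_weight a N f z| <= B.
Proof.
have [N0|N0] := posnP N.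
  exists `|det_weight a 0 f [::]| => M; rewrite N0 big_seq1 //.
have /andP[r0 r1] := r01.
pose rho := expR (ln r / (N * N)%:R).
have NN0 : (0 : R) < (N * N)%:R by rewrite ltr0n muln_gt0 N0.
have rhoE : rho ^+ (N * N) = r.
  by rewrite /rho -expRM_natr divfK ?gt_eqF // lnK.
have rho01 : 0 < rho < 1.
  by rewrite expR_gt0 /rho expR_lt1 pmulr_llt0 ?invr_gt0 // ln_lt0 // r0.
have [B hB] := sum_arrs_geo N rho01.
have C0 : 0 <= C.
  by have := fC 0%N N0; rewrite expr0 mulr1; exact: le_trans.
have c0 : 0 <= c by have /andP[] := ac 0%N; exact: le_trans.
pose D := N`!%:R * C ^+ N * \prod_(n < N.-1) c ^+ n.+1.
have D0 : 0 <= D.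
  rewrite /D !mulr_ge0 ?exprn_ge0 //; by apply: prodr_ge0 => n _; rewrite exprn_ge0.
exists (D * B) => M; apply: le_trans (ler_wpM2l D0 (hB M)).
rewrite mulr_sumr big_seq [leRHS]big_seq; apply: ler_sum => z zM.
have [zIA _] := (mem_arrs M N z).1 zM; have [zs zl _] := zIA.
rewrite /det_weight normrM phi_weight_IA // /D [leRHS]mulrAC.
apply: ler_pM => //; last first.
  rewrite normr_prod; apply: ler_prod => n _; rewrite normr_ge0 /=.
  have [sn _] := zl n (leq_trans (ltn_ord n) (leq_pred _)).
  rewrite -sn normr_prod -[X in c ^+ X]card_ord -prodr_const (big_nth 0%N) big_mkord.
  apply: ler_prod => i _; rewrite normr_ge0 /=.
  by have /andP[h1 h2] := ac (nth 0%N (level z n) i); rewrite ger0_norm.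
apply: le_trans (det_norm_le (B := fun j => C * r ^+ entry z N.-1 j) _) _.
  by move=> i j; rewrite mxE fC.
rewrite big_split /= prodr_const card_ord mulrA ler_wpM2l ?mulr_ge0 ?exprn_ge0 //.
set top := entry z N.-1 N.-1.
apply: (@le_trans _ _ (r ^+ top)).
  have lN : (N.-1 < N)%N by rewrite prednK.
  rewrite (bigD1 (Ordinal lN)) //= -[leRHS]mulr1 ler_wpM2l ?exprn_ge0 ?(ltW r0) //.
  by apply: prodr_ile1 => i _; rewrite exprn_ge0 ?exprn_ile1 // ltW.
have /andP[rho0 rho1] := rho01.
have -> : r ^+ top = rho ^+ top ^+ N ^+ N by rewrite -rhoE -!exprM mulnC mulnA.
have -> : rho ^+ top ^+ N ^+ N = \prod_(k <- z) \prod_(j < N) rho ^+ top.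
  by rewrite prodr_const card_ord (big_nth [::]) zs prodr_const_nat subn0.
rewrite big_seq [leRHS]big_seq; apply: ler_prod => k kz.
rewrite prodr_ge0 /= => [|j _]; last by rewrite exprn_ge0 ?ltW.
have sk : (size k <= N)%N.
  have iz : (index k z < N)%N by rewrite -zs index_mem.
  by have [+ _] := zl _ iz; rewrite /level nth_index // => ->.
rewrite prodr_const card_ord (big_nth 0%N) big_mkord.
apply: (@le_trans _ _ (rho ^+ top ^+ size k)).
  by rewrite ler_wiXn2l ?exprn_ge0 ?exprn_ile1 ?ltW.
rewrite -[X in _ ^+ X]card_ord -prodr_const; apply: ler_prod => i _.
rewrite exprn_ge0 ?(ltW rho0) //= ler_wiXn2l ?(ltW rho0) ?(ltW rho1) //.
have := arrs_le_top zM kz (mem_nth 0%N (ltn_ord i)).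
by rewrite /top /entry /level -[last _ _]nth_last zs.
Qed.

Lemma arrs_subset M M' : (M <= M')%N -> {subset arrs M N <= arrs M' N}.
Proof.
move=> MM' z /mem_arrs[zI zM]; apply/mem_arrs; split=> // n.
by apply/allP => u /(allP (zM n)) /= uM; exact: leq_trans MM'.
Qed.

Lemma arrs_IA z : IA N z <-> exists M, z \in arrs M N.
Proof.
split=> [zI|[M /mem_arrs[]//]].
exists (\max_(k <- z) \max_(u <- k) u).+1; apply/mem_arrs; split=> // n.
apply/allP => u uz /=; rewrite ltnS.
have [nz|nz] := ltnP n (size z); last by rewrite /level nth_default in uz.
apply: leq_trans (@leq_bigmax_seq _ _ xpredT (fun k => \max_(u <- k) u) _ (mem_nth [::] nz) isT).
exact: (@leq_bigmax_seq _ _ xpredT id).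
Qed.

Lemma det_weight_summable : is_signed_measure (IA N) (det_weight a N f).
Proof.
have [B hB] := det_weight_bound.
exact: (summable_exhaust (fun M => arrs_uniq M N) arrs_subset arrs_IA hB).
Qed.

Lemma det_weight_mass (A : set array) :
  (fun M => \sum_(z <- arrs M N | z \in A) det_weight a N f z) @ \oo -->
    mass (det_weight a N f) (IA N `&` A).
Proof.
have [B hB] := det_weight_bound.
exact: (mass_limit (fun M => arrs_uniq M N) arrs_subset arrs_IA hB).
Qed.

End Bounds.

(** * Pairings of polynomially bounded and geometrically decaying sequences *)

Section Pairing.
Variable R : realType.
Implicit Types (g h : nat -> R).

Lemma cvg_det n (A : nat -> 'M[R]_n) (B : 'M[R]_n) :
  (forall i j, (fun M => A M i j) @ \oo --> B i j) ->
  (fun M => \det (A M)) @ \oo --> \det B.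
Proof.
move=> AB; rewrite /determinant.
apply: (@cvg_big _ _ _ _ _ (@add_continuous _)) => s _.
apply: cvgM; first exact: cvg_cst.
by apply: (@cvg_big _ _ _ _ _ (@mul_continuous _)) => i _; exact: AB.
Qed.

Lemma poly_geo_bound (r : R) p : 0 < r < 1 -> exists D rho, [/\ 0 <= D, 0 < rho < 1
  & forall y, y.+1%:R ^+ p * r ^+ y <= D * rho ^+ y].
Proof.
(* Of the [p + 1] factors [rho ^+ y] making up [r ^+ y], [p] absorb the powers of [y + 1]: the
   product [(y + 1) rho^y] is at most the sum of the [rho^j] with [j <= y]. *)
move=> /andP[r0 r1]; pose rho := expR (ln r / p.+1%:R).
have rho01 : 0 < rho < 1.
  by rewrite expR_gt0 /rho expR_lt1 pmulr_llt0 ?invr_gt0 ?ltr0n // ln_lt0 // r0.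
have /andP[rho0 rho1] := rho01.
have rhoE : rho ^+ p.+1 = r.
  by rewrite /rho -expRM_natr divfK ?pnatr_eq0 // lnK.
have i0 : 0 <= (1 - rho)^-1 by rewrite invr_ge0 subr_ge0 ltW.
exists ((1 - rho)^-1 ^+ p), rho; split=> // [|y]; first exact: exprn_ge0.
have -> : r ^+ y = rho ^+ y ^+ p * rho ^+ y.
  by rewrite -rhoE -!exprM -exprD mulnC mulnS addnC.
rewrite mulrA -exprMn ler_wpM2r ?exprn_ge0 ?(ltW rho0) //.
apply: lerXn2r; rewrite ?nnegrE ?mulr_ge0 ?exprn_ge0 ?ler0n ?(ltW rho0) //.
apply: le_trans (sum_geo_le 0 y.+1 rho01).
rewrite big_mkord mulr_natl -[X in _ *+ X]card_ord -sumr_const; apply: ler_sum => j _.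
by rewrite ler_wiXn2l ?(ltW rho0) ?(ltW rho1) // -ltnS.
Qed.

Definition poly_bounded g := exists D p, 0 <= D /\ forall y, `|g y| <= D * y.+1%:R ^+ p.

Definition pairing g h : R := limn (fun M => \sum_(y < M) g y * h y).

Lemma cvg_pairing g h (C r : R) : 0 < r < 1 -> poly_bounded g ->
    (forall y, `|h y| <= C * r ^+ y) ->
  (fun M => \sum_(y < M) g y * h y) @ \oo --> pairing g h.
Proof.
move=> r01 [D [p [D0 gD]]] hC.
have C0 : 0 <= C by have := hC 0%N; rewrite expr0 mulr1; exact: le_trans.
have [D' [rho [D'0 /andP[rho0 rho1] hD']]] := poly_geo_bound p r01.
suff : cvgn (fun M => \sum_(y < M) g y * h y) by [].
have -> : (fun M => \sum_(y < M) g y * h y) = series (fun y => g y * h y).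
  by apply: funext => M; rewrite /series /= big_mkord.
apply: normed_cvg; apply: (@series_le_cvg _ _ (geometric (D * C * D') rho)).
- by move=> y; exact: normr_ge0.
- by move=> y; rewrite /geometric /= !mulr_ge0 ?exprn_ge0 // ltW.
- move=> y; rewrite /geometric /= normrM.
  apply: le_trans (ler_pM _ _ (gD y) (hC y)) _ => //.
  by rewrite mulrACA -[leRHS]mulrA ler_wpM2l ?mulr_ge0.
- by apply: is_cvg_geometric_series; rewrite ger0_norm // ltW.
Qed.

Lemma pairing_lin g h h' (b b' C r C' r' : R) :
    0 < r < 1 -> 0 < r' < 1 -> poly_bounded g ->
    (forall y, `|h y| <= C * r ^+ y) -> (forall y, `|h' y| <= C' * r' ^+ y) ->
  pairing g (fun y => b * h y + b' * h' y) = b * pairing g h + b' * pairing g h'.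
Proof.
move=> r01 r01' gp hC hC'; apply: cvg_lim => //.
rewrite (_ : (fun M => _) = (fun M => b * (\sum_(y < M) g y * h y) +
    b' * (\sum_(y < M) g y * h' y))).
  apply: cvgD; apply: cvgM; try exact: cvg_cst.
    exact: cvg_pairing r01 gp hC.
  exact: cvg_pairing r01' gp hC'.
apply: funext => M; rewrite !mulr_sumr -big_split /=.
by apply: eq_bigr => y _; ring.
Qed.

Variable a : nat -> R.
Variable c : R.
Hypothesis ac : forall u, 0 <= (a u)^-1 <= c.

Lemma left_ker_poly_unif k : exists D, 0 <= D /\
  forall v y, `|left_ker a k v y| <= D * y.+1%:R ^+ k.
Proof.
have c0 : 0 <= c by have /andP[] := ac 0%N; exact: le_trans.
elim: k => [|k [D [D0 IH]]].
  by exists 1; split=> // v y; rewrite expr0 mulr1 /=; case: eqP; rewrite ?normr1 ?normr0.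
exists (D * c); split=> [|v y]; first exact: mulr_ge0.
apply: le_trans (ler_norm_sum _ _ _) _.
apply: (@le_trans _ _ (\sum_(w < y) D * y.+1%:R ^+ k * c)).
  apply: ler_sum => w _; have /andP[h1 h2] := ac w.
  rewrite normrM [`|(a w)^-1|]ger0_norm //; apply: ler_pM => //.
  apply: le_trans (IH v w) _; rewrite ler_wpM2l //.
  by apply: lerXn2r; rewrite ?nnegrE ?ler0n // ler_nat ltnS ltnW.
rewrite sumr_const card_ord exprS.
rewrite [leRHS](_ : _ = (D * y.+1%:R ^+ k * c) * y.+1%:R); last by ring.
by rewrite -[leLHS]mulr_natr ler_wpM2l ?ler_nat // !mulr_ge0 ?exprn_ge0 ?ler0n.
Qed.

Lemma left_ker_poly_bounded k v : poly_bounded (left_ker a k v).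
Proof. by have [D [D0 h]] := left_ker_poly_unif k; exists D, k. Qed.

Lemma vker_poly_bounded k : poly_bounded (vker a k).
Proof.
have [D [D0 h]] := left_ker_poly_unif k; exists D, k.+1; split=> // y.
apply: le_trans (ler_norm_sum _ _ _) _.
apply: (@le_trans _ _ (\sum_(w < y.+1) D * y.+1%:R ^+ k)).
  by apply: ler_sum => w _; exact: h.
by rewrite sumr_const card_ord exprS -[leLHS]mulr_natl mulrCA.
Qed.

Lemma right_ker_poly_bounded k v : poly_bounded (right_ker a k v).
Proof.
exists (\sum_(y < v.+1) `|right_ker a k v y|), 0%N.
split=> [|y]; first exact: sumr_ge0.
rewrite expr0 mulr1; have [yv|vy] := leqP y v.
  by rewrite (bigD1 (Ordinal (yv : (y < v.+1)%N))) //= lerDl sumr_ge0.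
by rewrite right_ker_above // normr0 sumr_ge0.
Qed.

End Pairing.

(** * The correlation kernel *)

Section Determinantal.
Variables (R : realType) (a : nat -> R) (N : nat) (f : nat -> nat -> R) (c C r : R).
Hypothesis ac : forall u, 0 <= (a u)^-1 <= c.
Hypothesis r01 : 0 < r < 1.
Hypothesis fC : forall i y, (i < N)%N -> `|f i y| <= C * r ^+ y.

Definition total_mx : 'M[R]_N := \matrix_(i, j) pairing (vker a j) (f i).

(** The entry of [c X^-1 b - F] at two points, now with sums over all sites; [N.-1 - p.1] is the
    depth of [p] below the top level. *)
Definition corr_ker (p p' : 'I_N * nat) : R :=
  (\row_j (if (N.-1 - p.1 <= j)%N then vker a (j - (N.-1 - p.1)) p.2 else 0) *m
    invmx total_mx *m
    \col_i pairing (left_ker a (N.-1 - p'.1) p'.2) (f i)) ord0 ord0 -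
  (if (N.-1 - p.1 < N.-1 - p'.1)%N then
     left_ker a ((N.-1 - p'.1) - (N.-1 - p.1)) p'.2 p.2 else 0).

(** For each large [M] the finite sum is an inclusion-exclusion over determinants whose entries
    converge; invertibility of the limit of [X] then brings out the kernel. *)
Lemma det_weight_determinantal : \det total_mx = 1 ->
  determinantal N (det_weight a N f).
Proof.
move=> det1X; exists corr_ker => m q _ uq.
pose q' (l : 'I_m) : nat * nat := ((tnth q l).1 : nat, (tnth q l).2).
have q'i : injective q'.
  move=> l l' [] /ord_inj e1 e2; apply: (tuple_uniqP _ uq).
  by case: (tnth q l) (tnth q l') e1 e2 => [? ?] [? ?] /= -> ->.
have q'N l : ((q' l).1 < N)%N by rewrite /q' /=.
set E := [set z | _].
have lim1 := det_weight_mass (A := E) ac r01 fC.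
pose b : 'M[R]_(N, m) :=
  \matrix_(i, l) pairing (left_ker a (depth N q' l) (q' l).2) (f i).
pose cc := corr_c a N q'; pose F := corr_F a N q'.
have lim2 : (fun M => \sum_(z <- arrs M N | z \in E) det_weight a N f z) @ \oo -->
   \sum_(S in {set 'I_m}) (\prod_l (if l \in S then -1 else 1)) *
     \det (corr_block total_mx b cc F (minus_ind R S)).
  pose G M := \sum_(S in {set 'I_m}) (\prod_l (if l \in S then -1 else 1)) *
     \det (corr_block (corr_X a N M f) (corr_b a N M q' f) cc F (minus_ind R S)).
  suff : G @ \oo --> \sum_(S in {set 'I_m}) (\prod_l (if l \in S then -1 else 1)) *
     \det (corr_block total_mx b cc F (minus_ind R S)).
    apply: cvg_trans; apply: near_eq_cvg; near=> M.
    rewrite /G -(sum_correlation a f q'N q'i).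
      apply: eq_bigl => z; rewrite /E; apply/idP/idP => [/forallP h|/set_mem h].
        by apply/mem_set => l; exact: h.
      by apply/forallP => l; exact: h.
    move=> l; apply: leq_ltn_trans (_ : (\max_l (q' l).2 < M)%N).
      exact: (leq_bigmax l).
    by near: M; exact: nbhs_infty_gt.
  apply: (@cvg_big _ _ _ _ _ (@add_continuous _)) => S _.
  apply: cvgM; first exact: cvg_cst.
  apply: cvg_det => i j; rewrite -(splitK i) -(splitK j) /corr_block.
  case: (fintype.split i) => i'; case: (fintype.split j) => j' /=.
  - rewrite block_mxEul mxE; under eq_fun do rewrite block_mxEul mxE.
    exact: cvg_pairing r01 (vker_poly_bounded ac _) (fun y => fC y (ltn_ord i')).
  - rewrite block_mxEur !mxE; under eq_fun do rewrite block_mxEur !mxE.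
    apply: cvgN.
    exact: cvg_pairing r01 (left_ker_poly_bounded ac _ _) (fun y => fC y (ltn_ord i')).
  - by under eq_fun do rewrite block_mxEdl; rewrite block_mxEdl; exact: cvg_cst.
  - by under eq_fun do rewrite block_mxEdr; rewrite block_mxEdr; exact: cvg_cst.
rewrite -(cvg_lim _ lim1) // (cvg_lim _ lim2) //.
have Xu : total_mx \in unitmx by rewrite unitmxE det1X unitr1.
under eq_bigr => S _ do rewrite det_corr_block_unit // det1X mul1r.
rewrite -det_incl_excl; congr (\det _); apply/matrixP => l l'; rewrite !mxE.
congr (_ - _).
rewrite [RHS]mxE; apply: eq_bigr => i _; rewrite !mxE; congr (_ * _).
by apply: eq_bigr => j _; rewrite !mxE.
Unshelve. all: by end_near. Qed.

End Determinantal.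

(** * Kernels of one particle and the edge marginals *)

Section OneParticle.
Variables (R : realType) (a : nat -> R) (c : R).
Hypothesis ac : forall u, 0 <= (a u)^-1 <= c.
Hypothesis a0 : forall u, a u != 0.
Variable b : R.
Hypothesis ab : forall u, `|a u| <= b.
Implicit Types (T : nat -> nat -> R).

(** What the determinantal arguments need of [T_f], isolated so that discrete and continuous time
    share them. [kernel_comm] says that the generator in [x] acts as its adjoint in [y]. In
    [kernel_bound] the rate [r] is common to all [x], the constant is not. *)
Record kernel_law T : Prop := KernelLaw {
  kernel_tri : forall x y, (y < x)%N -> T x y = 0;
  kernel_comm : forall x y, a x * fdiff (T^~ y) x =
    (if y is y'.+1 then a y' * T x y' else 0) - a y * T x y;
  kernel_bound : exists r, 0 < r < 1 /\
    forall x, exists C, forall y, `|T x y| <= C * r ^+ y;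
  kernel_total : forall x, pairing (fun=> 1) (T x) = 1 }.

Definition act T (k : nat -> R) (x : nat) : R := pairing k (T x).

Lemma poly_bounded_cst (d : R) : poly_bounded (fun=> d).
Proof. by exists `|d|, 0%N; split=> // y; rewrite expr0 mulr1. Qed.

Lemma poly_bounded_shift k : poly_bounded k -> poly_bounded (fun y => a y * k y.+1).
Proof.
have b0 : 0 <= b by apply: le_trans (ab 0%N).
move=> [D [p [D0 kD]]]; exists (b * (D * 2 ^+ p)), p; split.
  by rewrite !mulr_ge0 ?exprn_ge0.
move=> y; rewrite normrM -mulrA; apply: ler_pM => //.
apply: le_trans (kD _) _; rewrite -mulrA -exprMn ler_wpM2l //.
apply: lerXn2r; rewrite ?nnegrE ?mulr_ge0 ?ler0n //.
by rewrite -natrM ler_nat; lia.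
Qed.

Lemma poly_boundedZ k : poly_bounded k -> poly_bounded (fun y => a y * k y).
Proof.
have b0 : 0 <= b by apply: le_trans (ab 0%N).
move=> [D [p [D0 kD]]]; exists (b * D), p; split; first exact: mulr_ge0.
by move=> y; rewrite normrM -mulrA; apply: ler_pM.
Qed.

Lemma iter_kernel_bound T s r : 0 < r < 1 ->
    (forall x, exists C, forall y, `|T x y| <= C * r ^+ y) ->
  forall m x, exists C, forall y,
    `|iter m (lgen a s) (T^~ y) x| <= C * r ^+ y.
Proof.
move=> r01 TC; elim=> [|m IH] x; first exact: TC.
have [C1 h1] := IH x; have [C2 h2] := IH x.+1.
exists (`|s| * `|a x| * (C2 + C1)) => y; rewrite iterS.
have := h2 y; have := h1 y; set g := iter m _ _; rewrite /lgen /fdiff => h1y h2y.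
rewrite !normrM mulrA -[leRHS]mulrA ler_wpM2l ?mulr_ge0 //.
by apply: le_trans (ler_normB _ _) _; rewrite mulrDl lerD.
Qed.

Lemma pairing_iter T s k : kernel_law T -> poly_bounded k ->
  forall m x, pairing k (fun y => iter m (lgen a s) (T^~ y) x) =
    iter m (lgen a s) (act T k) x.
Proof.
move=> [_ _ [r [r01 TC]] _] kp; elim=> [//|m IH] x /=.
rewrite /lgen /fdiff -!IH.
have [C1 h1] := iter_kernel_bound s r01 TC m x.
have [C2 h2] := iter_kernel_bound s r01 TC m x.+1.
rewrite (_ : (fun y => _) = (fun y => (s * a x) * iter m (lgen a s) (T^~ y) x.+1 +
    (- (s * a x)) * iter m (lgen a s) (T^~ y) x)); last first.
  by apply: funext => y; rewrite /lgen /fdiff; ring.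
rewrite (pairing_lin _ _ r01 r01 kp h2 h1); ring.
Qed.

Lemma sum_by_parts T (k : nat -> R) x M : kernel_law T ->
  \sum_(y < M.+1) k y * (a x * fdiff (T^~ y) x) =
  \sum_(y < M.+1) (a y * fdiff k y) * T x y - (a M * k M.+1) * T x M.
Proof.
move=> Tl; elim: M => [|M IH].
  by rewrite !big_ord1 (kernel_comm Tl) /fdiff /=; ring.
by rewrite big_ord_recr IH [in RHS]big_ord_recr /= (kernel_comm Tl) /fdiff; ring.
Qed.

(** Summation by parts: [kernel_comm] moves the difference from [x] to [y] and then onto [k]. The
    boundary term tends to 0, being the general term of a convergent series. *)
Lemma lgen_act T s k x : kernel_law T -> poly_bounded k ->
  lgen a s (act T k) x = act T (lgen a s k) x.
Proof.
move=> Tl kp; have [_ _ [r [r01 TC]] _] := Tl.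
have [C hC] := TC x.
have kS := poly_bounded_shift kp; have kZ := poly_boundedZ kp.
rewrite -[lgen _ _ _ _](pairing_iter s Tl kp 1) /= /act /lgen.
apply: cvg_lim => //.
have L1 : (fun M => \sum_(y < M) (a y * fdiff k y) * T x y) @ \oo -->
    pairing (fun y => a y * k y.+1) (T x) - pairing (fun y => a y * k y) (T x).
  rewrite (_ : (fun M => _) = (fun M => \sum_(y < M) (a y * k y.+1) * T x y -
     \sum_(y < M) (a y * k y) * T x y)).
    by apply: cvgB; apply: cvg_pairing r01 _ hC.
  by apply: funext => M; rewrite -sumrB; apply: eq_bigr => y _; rewrite /fdiff; ring.
have L0 : (fun M => (a M * k M.+1) * T x M) @ \oo --> 0.
  have := cvg_pairing r01 kS hC.
  rewrite (_ : (fun M => _) = series (fun y => (a y * k y.+1) * T x y)); last first.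
    by apply: funext => M; rewrite /series /= big_mkord.
  by move=> h; apply: cvg_series_cvg_0; apply/cvg_ex; eexists; exact: h.
have E : pairing (fun y => s * (a y * fdiff k y)) (T x) =
    s * (pairing (fun y => a y * k y.+1) (T x) - pairing (fun y => a y * k y) (T x)).
  apply: cvg_lim => //.
  rewrite (_ : (fun M => _) = (fun M => s * \sum_(y < M) (a y * fdiff k y) * T x y)).
    by apply: cvgM; [exact: cvg_cst|exact: L1].
  by apply: funext => M; rewrite mulr_sumr; apply: eq_bigr => y _; ring.
rewrite -/(pairing _ _) E -(cvg_shiftS (fun M => \sum_(y < M) k y * _)) /=.
rewrite (_ : (fun M => _) = (fun M => s * (\sum_(y < M.+1) (a y * fdiff k y) * T x y -
   (a M * k M.+1) * T x M))).
  rewrite -[X in s * X]subr0; apply: cvgM; first exact: cvg_cst.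
  by apply: cvgB L0; rewrite (cvg_shiftS (fun M => \sum_(y < M) _)).
apply: funext => M; rewrite -sum_by_parts // mulr_sumr.
by apply: eq_bigr => y _; ring.
Qed.

Lemma act_lowering T s (ker : nat -> nat -> nat -> R) : kernel_law T ->
    (forall k v, poly_bounded (ker k v)) -> lowering a s ker ->
  lowering a s (fun k v => act T (ker k v)).
Proof.
move=> Tl kp kl k v u; rewrite lgen_act //.
by congr (act T _ u); apply: funext => y; exact: kl.
Qed.

Lemma iter_lowering s (e : nat -> nat -> nat -> R) : lowering a s e ->
  forall m k v u, iter m (lgen a s) (e k v) u =
    if (m <= k)%N then e (k - m)%N v u else iter (m - k) (lgen a s) (e 0%N v) u.
Proof.
move=> el m k; elim: k m => [|k IH] m v u; first by case: m => [|m]; rewrite ?subn0.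
case: m => [|m]; first by rewrite subn0.
rewrite iterSr subSS ltnS -IH; congr (iter m (lgen a s) _ u).
by apply: funext => w; exact: el.
Qed.

(** The sign of the reversal is distributed over the factors, since the antidiagonal entries to
    which this is applied carry alternating signs themselves. *)
Lemma det_antitri n (A : nat -> nat -> R) :
    (forall i j, (i + j < n.-1)%N -> A i j = 0) ->
  \det (\matrix_(i < n, j < n) A i j) =
  \prod_(i < n) ((-1) ^+ (n.-1 - i) * A i (n.-1 - i)%N).
Proof.
elim: n A => [|n IH] A A0; first by rewrite det_mx00 big_ord0.
rewrite (expand_det_row _ ord0) (bigD1 ord_max) //= big1 ?addr0; last first.
  move=> j jn; rewrite mxE A0 ?mul0r // add0n.
  by have := ltn_ord j; move: jn; rewrite -val_eqE /=; lia.
rewrite big_ord_recl mxE /= subn0 /cofactor add0n mulrCA mulrA; congr (_ * _).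
transitivity (\det (\matrix_(i < n, j < n) A i.+1 j)).
  by congr (\det _); apply/matrixP => i j; rewrite !mxE lift_max.
rewrite (IH (fun i => A i.+1)); last by move=> i j ij; apply: A0; lia.
by apply: eq_bigr => i _; rewrite /bump /= add1n (_ : n.-1 - i = n - i.+1)%N //; lia.
Qed.

Lemma vker_lowering : lowering a 1 (fun k _ => vker a k).
Proof.
move=> k _ u; rewrite /lgen /fdiff /vker mul1r big_ord_recr /= -/(left_ker a k.+1).
rewrite [X in _ * (_ + X - _)](_ : _ = 0); last exact: (left_ker_below a k (leqnn _)).
rewrite addr0 -sumrB mulr_sumr; apply: eq_bigr => x _.
by have := left_ker_lowering a0 k x u; rewrite /lgen mul1r.
Qed.

Lemma vker0 y : vker a 0 y = 1.
Proof.
rewrite /vker (bigD1 ord_max) //= eqxx big1 ?addr0 // => x.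
by rewrite -val_eqE eq_sym => /negPf /= ->.
Qed.

Lemma act_vker0 T x : kernel_law T -> act T (vker a 0) x = 1.
Proof.
move=> Tl; rewrite -[RHS](kernel_total Tl x); congr pairing.
by apply: funext => y; exact: vker0.
Qed.

Lemma iter_lgen_const s d m u : iter m.+1 (lgen a s) (fun=> d) u = 0.
Proof.
elim: m u => [|m IH] u; first by rewrite /= /lgen /fdiff subrr !mulr0.
by rewrite iterS /lgen /fdiff !IH subrr !mulr0.
Qed.

Definition right_rows N T (x : seq nat) (i y : nat) : R :=
  iter (N.-1 - i) (lgen a (-1)) (T^~ y) (nth 0%N x i).

Definition left_rows T (x : seq nat) (i y : nat) : R :=
  iter i (lgen a 1) (T^~ y) (nth 0%N x i).

(** Row [i] applies [L^i] to [act T (vker j)], which gives [act T (vker (j - i))]: the constant 1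
    for [i = j], and 0 for [i > j] as a difference of this constant. The matrix is triangular with
    unit diagonal. *)
Lemma det_total_left N T x : kernel_law T ->
  \det (total_mx a N (left_rows T x)) = 1.
Proof.
move=> Tl; have vl := act_lowering Tl (fun k _ => vker_poly_bounded ac k) vker_lowering.
have E (i j : nat) : pairing (vker a j) (left_rows T x i) =
    if (i <= j)%N then act T (vker a (j - i)) (nth 0%N x i) else 0.
  rewrite (pairing_iter 1 Tl (vker_poly_bounded ac j) i).
  rewrite (iter_lowering vl i j 0); case: leqP => // ji.
  rewrite (_ : act T (vker a 0) = fun=> 1); last first.
    by apply: funext => u; exact: act_vker0.
  by rewrite -(subnSK ji) iter_lgen_const.
rewrite -det_tr det_trig.
  by rewrite big1 // => i _; rewrite !mxE E leqnn subnn act_vker0.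
by apply/is_trig_mxP => i j ij; rewrite !mxE E leqNgt ij.
Qed.

(** Row [i] carries the power [N - 1 - i] of [-L], so the matrix is antitriangular. The family
    [(-1)^k vker k] is lowered by [-L], and its signs cancel those of the antidiagonal. *)
Lemma det_total_right N T x : kernel_law T ->
  \det (total_mx a N (right_rows N T x)) = 1.
Proof.
move=> Tl; pose e k (_ : nat) y := (-1) ^+ k * vker a k y.
have el : lowering a (-1) e.
  move=> k v u; have := vker_lowering k v u; rewrite /e /lgen /fdiff => <-.
  by rewrite exprS; ring.
have ep k v : poly_bounded (e k v).
  have [D [p [D0 h]]] := vker_poly_bounded ac k; exists D, p; split=> // y.
  by rewrite /e normrM normrX normrN1 expr1n mul1r.
have vl := act_lowering Tl ep el.
have E i j : pairing (vker a j) (right_rows N T x i) = (-1) ^+ j *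
    if (N.-1 - i <= j)%N then act T (e (j - (N.-1 - i))%N 0%N) (nth 0%N x i) else 0.
  have -> : vker a j = fun y => (-1) ^+ j * e j 0%N y.
    by apply: funext => y; rewrite /e mulrA -exprD addnn -signr_odd odd_double mul1r.
  have [_ _ [r [r01 TC]] _] := Tl.
  have [C hC] := iter_kernel_bound (-1) r01 TC (N.-1 - i) (nth 0%N x i).
  transitivity ((-1) ^+ j * pairing (e j 0%N) (right_rows N T x i)).
    apply: cvg_lim => //; rewrite (_ : (fun M => _) = fun M => (-1) ^+ j *
      \sum_(y < M) e j 0%N y * right_rows N T x i y).
      by apply: cvgM; [exact: cvg_cst|exact: cvg_pairing r01 (ep j 0%N) hC].
    by apply: funext => M; rewrite mulr_sumr; apply: eq_bigr => y _; ring.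
  congr (_ * _); rewrite (pairing_iter (-1) Tl (ep j 0%N)).
  rewrite (iter_lowering vl _ j 0); case: leqP => // ji.
  rewrite (_ : act T (e 0%N 0%N) = fun=> 1); last first.
    apply: funext => u; rewrite -(act_vker0 u Tl); congr (act T _ u).
    by apply: funext => y; rewrite /e expr0 mul1r.
  by rewrite -(subnSK ji) iter_lgen_const.
rewrite (det_antitri (A := fun i j => pairing (vker a j) (right_rows N T x i))).
  rewrite big1 // => i _; rewrite E leqnn subnn mulrA -exprD addnn -signr_odd odd_double mul1r.
  rewrite -(act_vker0 (nth 0%N x i) Tl); congr (act T _ _).
  by apply: funext => y; rewrite /e expr0 mul1r.
by move=> i j ij; rewrite E leqNgt ifF ?mulr0 //; lia.
Qed.

End OneParticle.

(** * Reduction of the claims to edge determinants *)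

Section EdgeClaims.
Variables (R : realType) (a : nat -> R) (c : R).
Hypothesis ac : forall u, 0 <= (a u)^-1 <= c.
Hypothesis a0 : forall u, a u != 0.
Variable b : R.
Hypothesis ab : forall u, `|a u| <= b.
Variables (N : nat) (T : nat -> nat -> R).
Hypothesis Tl : kernel_law a T.

Definition right_det (v x : seq nat) : R :=
  det_fun N (det_family a (-1) (fun k w => act T (right_ker a k w)) (nth 0%N v)) x.

Definition left_det (v x : seq nat) : R :=
  det_fun N (det_family a 1 (fun k w => act T (left_ker a k w)) (nth 0%N v)) x.

Lemma family_pairing s (ker : nat -> nat -> nat -> R) (v : nat -> nat) i n u :
    (forall k w, poly_bounded (ker k w)) -> lowering a s ker ->
    (i < N)%N -> (n < N)%N ->
  pairing (ker (N.-1 - n)%N (v n)) (fun y => iter (N.-1 - i) (lgen a s) (T^~ y) u) =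
  det_family a s (fun k w => act T (ker k w)) v i n u.
Proof.
move=> kp kl iN nN; rewrite (pairing_iter s Tl (kp _ _)).
have al := act_lowering ab Tl kp kl.
rewrite (iter_lowering al) /det_family; case: leqP => h.
  have -> : (N.-1 - n - (N.-1 - i) = i - n)%N by lia.
  case: leqP => // h'; have -> : i = n by lia.
  by rewrite subnn.
have -> : (i <= n)%N by lia.
by have -> : (N.-1 - i - (N.-1 - n) = n - i)%N by lia.
Qed.

Lemma rows_bound s x : exists r C, 0 < r < 1 /\ forall m i y, (m < N)%N -> (i < N)%N ->
  `|iter m (lgen a s) (T^~ y) (nth 0%N x i)| <= C * r ^+ y.
Proof.
have [_ _ [r [r01 TC]] _] := Tl; exists r.
have h m i := iter_kernel_bound a s r01 TC m (nth 0%N x i).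
have [C hC] := choice (fun p : nat * nat => h p.1 p.2).
(* The constants depend on the order of the difference and on the row; finitely many occur, and
   their sum serves for all. *)
exists (\sum_(p : 'I_N * 'I_N) `|C (p.1 : nat, p.2 : nat)|); split=> // m i y mN iN.
apply: le_trans (hC (m, i) y) _; rewrite ler_wpM2r ?exprn_ge0 //.
  by case/andP: r01 => /ltW.
apply: le_trans (ler_norm _) _.
by rewrite (bigD1 (Ordinal mN, Ordinal iN)) //= lerDl sumr_ge0.
Qed.

Lemma max_above (v : seq nat) M : (\max_(u <- v) u < M)%N -> all (ltn^~ M) v.
Proof.
move=> vM; apply/allP => u uv; apply: leq_ltn_trans vM.
exact: (@leq_bigmax_seq _ _ xpredT id).
Qed.

Lemma right_weightE (x : N.-tuple nat) :
  right_weight a T x = det_weight a N (right_rows a N T x).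
Proof.
apply: funext => z; congr (\det _ * _); apply/matrixP => i j; rewrite !mxE.
rewrite /right_rows -tnth_nth; congr (iter _ _ _ _); apply: funext => g.
by apply: funext => u; rewrite /lgen mulN1r mulNr.
Qed.

Lemma left_weightE (x : N.-tuple nat) :
  left_weight a T x = det_weight a N (left_rows a T x).
Proof.
apply: funext => z; congr (\det _ * _); apply/matrixP => i j; rewrite !mxE.
rewrite /left_rows -tnth_nth; congr (iter _ _ _ _); apply: funext => g.
by apply: funext => u; rewrite /lgen mul1r.
Qed.

(** The mass of the arrays with edge [v] is the limit of [sum_right_edge], whose entries converge to
    those of [right_det]. What remains for each model of time is that [right_det] is the transition
    probability. *)
Lemma right_claim (x : N.-tuple nat) (E : N.-tuple nat -> R) :
    (forall v, @weyl N v -> right_det v x = E v) ->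
  right_edge_claim a T x E.
Proof.
move=> xE; have [r [C [r01 hC]]] := rows_bound (-1) x.
have fC i y : (i < N)%N -> `|right_rows a N T x i y| <= C * r ^+ y.
  by move=> iN; apply: hC => //; lia.
rewrite /right_edge_claim right_weightE; split.
- exact: det_weight_summable ac r01 fC.
- move=> v vW; rewrite -xE // /right_det /det_fun size_tuple eqxx.
  have lim1 := det_weight_mass (A := [set z | right_edge N z = v]) ac r01 fC.
  rewrite -(cvg_lim _ lim1) //; apply: cvg_lim => //.
  have cv : (fun M => \det (\matrix_(i < N, j < N)
      \sum_(y < M) right_ker a (N.-1 - j) (nth 0%N v j) y * right_rows a N T x i y)) @ \oo
      --> \det (\matrix_(i < N, j < N)
       det_family a (-1) (fun k w => act T (right_ker a k w)) (nth 0%N v) i j (nth 0%N x i)).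
    apply: cvg_det => i j; rewrite mxE; under eq_fun do rewrite mxE.
    rewrite -(family_pairing _ _ (right_ker_poly_bounded a) (right_ker_lowering a0)) //.
    exact: cvg_pairing r01 (right_ker_poly_bounded a _ _) (fun y => fC i y (ltn_ord i)).
  apply: cvg_trans cv; apply: near_eq_cvg; near=> M.
  have vM : all (ltn^~ M) v by apply: max_above; near: M; exact: nbhs_infty_gt.
  rewrite -(sum_right_edge a (right_rows a N T x) (size_tuple v) vW vM).
  rewrite [RHS]big_mkcond; apply: eq_bigr => z _.
  case: ifPn => [/set_mem /= zv|/negP zv].
    by rewrite big1 ?mul1r // => n _; rewrite -zv -tnth_nth tnth_mktuple eqxx.
  have [/forallP h|/forallPn[n hn]] := boolP [forall n : 'I_N, entry z n n == nth 0%N v n].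
    case: zv; apply/mem_set => /=; apply: eq_from_tnth => n.
    by rewrite tnth_mktuple (tnth_nth 0%N); exact/eqP.
  by rewrite (bigD1 n) //= (negPf hn) !mul0r.
- by apply: (det_weight_determinantal ac r01 fC); exact: (det_total_right ac a0 ab).
Unshelve. all: by end_near. Qed.

(** Tuples of the left edge list the leader last, while [left_det] is indexed from the leader on.
    Reversing rows and columns by the same permutation reconciles them. *)
Lemma det_rev_both (A : nat -> nat -> R) :
  \det (\matrix_(i < N, j < N) A (N.-1 - i)%N (N.-1 - j)%N) =
  \det (\matrix_(i < N, j < N) A i j).
Proof.
pose s : 'S_N := perm (@rev_ord_inj N).
have -> : \matrix_(i < N, j < N) A (N.-1 - i)%N (N.-1 - j)%N =
    row_perm s (col_perm s (\matrix_(i < N, j < N) A i j)).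
  apply/matrixP => i j; rewrite !mxE !permE /=.
  by congr A; have := ltn_ord i; have := ltn_ord j; lia.
rewrite row_permE col_permE !det_mulmx !det_perm odd_permV mulrCA mulrA.
by rewrite -mulrA -signr_addb addbb expr0 mulr1.
Qed.

Lemma left_claim (x : N.-tuple nat) (E : N.-tuple nat -> R) :
    (forall v, @weyl_closed N v -> left_det (rev v) (rev x) = E v) ->
  left_edge_claim a T x E.
Proof.
move=> xE; have [r [C [r01 hC]]] := rows_bound 1 x.
have fC i y : (i < N)%N -> `|left_rows a T x i y| <= C * r ^+ y.
  by move=> iN; apply: hC.
rewrite /left_edge_claim left_weightE; split.
- exact: det_weight_summable ac r01 fC.
- move=> v vW; rewrite -xE // /left_det /det_fun size_rev size_tuple eqxx.
  have lim1 := det_weight_mass (A := [set z | left_edge N z = v]) ac r01 fC.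
  rewrite -(cvg_lim _ lim1) //; apply: cvg_lim => //.
  have cv : (fun M => \det (\matrix_(i < N, j < N)
      \sum_(y < M) left_ker a j (nth 0%N v j) y * left_rows a T x i y)) @ \oo
      --> \det (\matrix_(i < N, j < N)
       det_family a 1 (fun k w => act T (left_ker a k w)) (nth 0%N (rev v)) i j (nth 0%N (rev x) i)).
    rewrite -(det_rev_both (fun i j => det_family a 1 (fun k w => act T (left_ker a k w))
      (nth 0%N (rev v)) i j (nth 0%N (rev x) i))).
    apply: cvg_det => i j; rewrite mxE; under eq_fun do rewrite mxE.
    have iN := ltn_ord i; have jN := ltn_ord j.
    rewrite -(family_pairing _ _ (left_ker_poly_bounded ac) (left_ker_lowering a0)); [|lia..].
    have ei : (N.-1 - (N.-1 - i) = i)%N by lia.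
    have ej : (N.-1 - (N.-1 - j) = j)%N by lia.
    rewrite ei ej !nth_rev ?size_tuple; [|lia..].
    have -> : (N - (N.-1 - i).+1 = i)%N by lia.
    have -> : (N - (N.-1 - j).+1 = j)%N by lia.
    exact: cvg_pairing r01 (left_ker_poly_bounded ac _ _) (fun y => fC i y (ltn_ord i)).
  apply: cvg_trans cv; apply: near_eq_cvg; near=> M.
  have vM : all (ltn^~ M) v by apply: max_above; near: M; exact: nbhs_infty_gt.
  rewrite -(sum_left_edge a (left_rows a T x) (size_tuple v) vW vM).
  rewrite [RHS]big_mkcond; apply: eq_bigr => z _.
  have revn (n : 'I_N) : (N.-1 - (N.-1 - n) = n)%N by have := ltn_ord n; lia.
  have rN (n : 'I_N) : (N.-1 - n < N)%N by have := ltn_ord n; lia.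
  case: ifPn => [/set_mem /= zv|/negP zv].
    rewrite big1 ?mul1r // => n _; rewrite -zv -[X in nth _ _ X]/(nat_of_ord (Ordinal (rN n))).
    by rewrite -tnth_nth tnth_mktuple /= revn eqxx.
  have [/forallP h|/forallPn[n hn]] := boolP [forall n : 'I_N, entry z n 0 == nth 0%N v (N.-1 - n)].
    case: zv; apply/mem_set => /=; apply: eq_from_tnth => n.
    rewrite tnth_mktuple (tnth_nth 0%N).
    by have /eqP := h (Ordinal (rN n)); rewrite /= revn.
  by rewrite (bigD1 n) //= (negPf hn) !mul0r.
- by apply: (det_weight_determinantal ac r01 fC); exact: (det_total_left ac a0 ab).
Unshelve. all: by end_near. Qed.

End EdgeClaims.

(** * Contour integrals *)

Local Open Scope complex_scope.

Section ComplexCurves.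
Variable R : realType.
Local Notation C := (complex R).
Local Notation Re := complex.Re.
Local Notation Im := complex.Im.
Implicit Types (u v : R -> C) (x y : C) (t : R).

Lemma cReM x y : Re (x * y) = Re x * Re y - Im x * Im y.
Proof. by case: x => ? ?; case: y. Qed.

Lemma cImM x y : Im (x * y) = Re x * Im y + Im x * Re y.
Proof. by case: x => ? ?; case: y => ? ?. Qed.

Lemma cReD x y : Re (x + y) = Re x + Re y.
Proof. by case: x => ? ?; case: y. Qed.

Lemma cImD x y : Im (x + y) = Im x + Im y.
Proof. by case: x => ? ?; case: y. Qed.

Lemma cReN x : Re (- x) = - Re x. Proof. by case: x. Qed.
Lemma cImN x : Im (- x) = - Im x. Proof. by case: x. Qed.

Definition sqn x : R := Re x ^+ 2 + Im x ^+ 2.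

Lemma cReV x : Re x^-1 = Re x / sqn x.
Proof. by case: x. Qed.

Lemma cImV x : Im x^-1 = - (Im x / sqn x).
Proof. by case: x. Qed.

Lemma sqn_neq0 x : x != 0 -> sqn x != 0.
Proof.
apply: contra => /eqP; rewrite /sqn => h.
have /andP[/eqP r0 /eqP i0] : (Re x ^+ 2 == 0) && (Im x ^+ 2 == 0).
  by rewrite -paddr_eq0 ?sqr_ge0 // h.
by move/eqP: r0; move/eqP: i0; rewrite !sqrf_eq0 eq_complex /= => -> ->.
Qed.

Lemma eq_ReIm x y : Re x = Re y -> Im x = Im y -> x = y.
Proof. by case: x => ? ?; case: y => ? ? /= -> ->. Qed.

Definition ccont u := forall t, 0 <= t <= 1 ->
  continuous_at t (fun s => Re (u s)) /\ continuous_at t (fun s => Im (u s)).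

Lemma ccont_cst x : ccont (fun=> x).
Proof. by move=> t _; split; exact: cst_continuous. Qed.

Lemma ccontD u v : ccont u -> ccont v -> ccont (fun t => u t + v t).
Proof.
move=> cu cv t t01; have [u1 u2] := cu t t01; have [v1 v2] := cv t t01; split.
  rewrite (_ : (fun s => _) = fun s => Re (u s) + Re (v s)); last exact/funext/(fun=> cReD _ _).
  exact: (continuousD u1 v1).
rewrite (_ : (fun s => _) = fun s => Im (u s) + Im (v s)); last exact/funext/(fun=> cImD _ _).
exact: (continuousD u2 v2).
Qed.

Lemma ccontM u v : ccont u -> ccont v -> ccont (fun t => u t * v t).
Proof.
move=> cu cv t t01; have [u1 u2] := cu t t01; have [v1 v2] := cv t t01; split.
  rewrite (_ : (fun s => _) = fun s => Re (u s) * Re (v s) - Im (u s) * Im (v s)); last exact/funext/(fun=> cReM _ _).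
  exact: (continuousB (continuousM u1 v1) (continuousM u2 v2)).
rewrite (_ : (fun s => _) = fun s => Re (u s) * Im (v s) + Im (u s) * Re (v s)); last exact/funext/(fun=> cImM _ _).
exact: (continuousD (continuousM u1 v2) (continuousM u2 v1)).
Qed.

Lemma ccontN u : ccont u -> ccont (fun t => - u t).
Proof.
move=> cu t t01; have [u1 u2] := cu t t01; split.
  rewrite (_ : (fun s => _) = fun s => - Re (u s)); last exact/funext/(fun=> cReN _).
  exact: (continuousN u1).
rewrite (_ : (fun s => _) = fun s => - Im (u s)); last exact/funext/(fun=> cImN _).
exact: (continuousN u2).
Qed.

Lemma ccontV u : ccont u -> (forall t, 0 <= t <= 1 -> u t != 0) ->
  ccont (fun t => (u t)^-1).
Proof.
move=> cu u0 t t01; have [u1 u2] := cu t t01.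
have c : continuous_at t (fun s => sqn (u s)).
  exact: (continuousD (continuousM u1 u1) (continuousM u2 u2)).
have cV : continuous_at t (fun s => (sqn (u s))^-1).
  by apply: continuousV c; apply: sqn_neq0; exact: u0.
split.
  rewrite (_ : (fun s => _) = fun s => Re (u s) * (sqn (u s))^-1); last exact/funext/(fun=> cReV _).
  exact: (continuousM u1 cV).
rewrite (_ : (fun s => _) = fun s => - (Im (u s) * (sqn (u s))^-1)); last exact/funext/(fun=> cImV _).
by have h := continuousM u2 cV; exact: (continuousN h).
Qed.

Lemma ccont_prod (I : eqType) (r : seq I) (f : I -> R -> C) :
  (forall i, i \in r -> ccont (f i)) -> ccont (fun t => \prod_(i <- r) f i t).
Proof.
elim: r => [_|i r IH h].
  by rewrite (_ : (fun t => _) = fun=> 1); [exact: ccont_cst|apply/funext => t; rewrite big_nil].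
rewrite (_ : (fun t => _) = fun t => f i t * \prod_(j <- r) f j t); last by apply/funext => t; rewrite big_cons.
apply: ccontM; first by apply: h; rewrite mem_head.
by apply: IH => j jr; apply: h; rewrite inE jr orbT.
Qed.

Lemma integrable01 (f : R -> R) : (forall t, 0 <= t <= 1 -> continuous_at t f) ->
  (@lebesgue_measure R).-integrable `[0, 1] (EFin \o f).
Proof.
move=> cf; apply: continuous_compact_integrable; first exact: segment_compact.
apply: continuous_in_subspaceT => t /set_mem; rewrite /= in_itv /= => t01; exact: cf.
Qed.

Lemma ftc01 (f F : R -> R) : (forall t, 0 <= t <= 1 -> continuous_at t f) ->
    (forall t, 0 <= t <= 1 -> is_derive t 1 F (f t)) ->
  \int[lebesgue_measure]_(t in `[0, 1]) f t = F 1 - F 0.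
Proof.
move=> cf dF; rewrite /Rintegral (@continuous_FTC2 _ f F) //.
- apply: continuous_in_subspaceT => t /set_mem; rewrite /= in_itv /= => t01; exact: cf.
- have cF t : 0 <= t <= 1 -> continuous_at t F.
    move=> t01; have dt := dF t t01.
    by apply/differentiable_continuous/derivable1_diffP; exact: ex_derive.
  split.
  + move=> t; rewrite in_itv /= => /andP[t0 t1].
    by have dt := dF t; apply: ex_derive; apply: dt; rewrite !ltW.
  + by apply: cvg_at_right_filter; apply: cF; rewrite lexx ler01.
  + by apply: cvg_at_left_filter; apply: cF; rewrite lexx ler01.
- move=> t; rewrite in_itv /= => /andP[t0 t1].
  have t01 : 0 <= t <= 1 by rewrite !ltW.
  by have dt := dF t t01; rewrite derive1E; exact: derive_val.
Qed.

Definition cint u : C :=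
  (\int[lebesgue_measure]_(t in `[0, 1]) Re (u t)) +i*
  (\int[lebesgue_measure]_(t in `[0, 1]) Im (u t)).

Lemma eq_cint u v : (forall t, 0 <= t <= 1 -> u t = v t) -> cint u = cint v.
Proof.
move=> uv; congr (_ +i* _); apply: eq_Rintegral => t /set_mem;
  by rewrite /= in_itv /= => t01; rewrite uv.
Qed.

Lemma cintD u v : ccont u -> ccont v ->
  cint (fun t => u t + v t) = cint u + cint v.
Proof.
move=> cu cv; rewrite /cint; apply: eq_ReIm => /=.
  under eq_Rintegral do rewrite cReD.
  by rewrite RintegralD //; apply: integrable01 => t t01; [case: (cu t t01)|case: (cv t t01)].
under eq_Rintegral do rewrite cImD.
by rewrite RintegralD //; apply: integrable01 => t t01; [case: (cu t t01)|case: (cv t t01)].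
Qed.

Lemma cintZ x u : ccont u -> cint (fun t => x * u t) = x * cint u.
Proof.
move=> cu; have i1 : (@lebesgue_measure R).-integrable `[0, 1] (EFin \o (fun t => Re (u t))).
  by apply: integrable01 => t /cu[].
have i2 : (@lebesgue_measure R).-integrable `[0, 1] (EFin \o (fun t => Im (u t))).
  by apply: integrable01 => t /cu[].
have cZ (r : R) (f : R -> R) t : continuous_at t f -> continuous_at t (fun s => r * f s).
  by move=> cf; apply: continuousM cf; exact: cst_continuous.
have iZ r (f : R -> R) : (forall t, 0 <= t <= 1 -> continuous_at t f) ->
  (@lebesgue_measure R).-integrable `[0, 1] (EFin \o (fun t => r * f t)).
  by move=> cf; apply: integrable01 => t /cf; exact: cZ.
have c1 t : 0 <= t <= 1 -> continuous_at t (fun s => Re (u s)) by move=> /cu[].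
have c2 t : 0 <= t <= 1 -> continuous_at t (fun s => Im (u s)) by move=> /cu[].
rewrite /cint; apply: eq_ReIm; rewrite ?cReM ?cImM /=.
  under eq_Rintegral do rewrite cReM -mulNr.
  by rewrite RintegralD ?RintegralZl ?mulNr //; exact: iZ.
under eq_Rintegral do rewrite cImM.
by rewrite RintegralD ?RintegralZl //; exact: iZ.
Qed.

Definition cder u t (d : C) :=
  is_derive t 1 (fun s => Re (u s)) (Re d) /\ is_derive t 1 (fun s => Im (u s)) (Im d).

Lemma cint_ftc u v : ccont v -> (forall t, 0 <= t <= 1 -> cder u t (v t)) ->
  cint v = u 1 - u 0.
Proof.
move=> cv du; apply: eq_ReIm.
  rewrite cReD cReN; apply: (@ftc01 (fun t => Re (v t)) (fun t => Re (u t))).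
    by move=> t t01; case: (cv t t01).
  by move=> t t01; case: (du t t01).
rewrite cImD cImN; apply: (@ftc01 (fun t => Im (v t)) (fun t => Im (u t))).
  by move=> t t01; case: (cv t t01).
by move=> t t01; case: (du t t01).
Qed.

Lemma cder_cst x t : cder (fun=> x) t 0.
Proof. by split; apply: is_derive_cst. Qed.

Lemma is_derive_ext (f g : R -> R) t d : (forall s, f s = g s) ->
  is_derive t 1 g d -> is_derive t 1 f d.
Proof. by move=> fg; rewrite (_ : f = g) //; exact/funext. Qed.

Lemma cderD u v t d e : cder u t d -> cder v t e -> cder (fun s => u s + v s) t (d + e).
Proof.
move=> [u1 u2] [v1 v2]; split.
  rewrite cReD; apply: (is_derive_ext (fun s => cReD (u s) (v s))); exact: is_deriveD.
rewrite cImD; apply: (is_derive_ext (fun s => cImD (u s) (v s))); exact: is_deriveD.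
Qed.

Lemma cderM u v t d e : cder u t d -> cder v t e ->
  cder (fun s => u s * v s) t (u t * e + d * v t).
Proof.
move=> [u1 u2] [v1 v2]; split.
  apply: (is_derive_ext (fun s => cReM (u s) (v s))).
  have h := is_deriveB (is_deriveM u1 v1) (is_deriveM u2 v2).
  by apply: (is_derive_eq h); rewrite cReD !cReM /GRing.scale /=; ring.
apply: (is_derive_ext (fun s => cImM (u s) (v s))).
have h := is_deriveD (is_deriveM u1 v2) (is_deriveM u2 v1).
by apply: (is_derive_eq h); rewrite cImD !cImM /GRing.scale /=; ring.
Qed.

Lemma cderV u t d : u t != 0 -> cder u t d -> cder (fun s => (u s)^-1) t (- d / u t ^+ 2).
Proof.
move=> u0 [u1 u2]; have n0 := sqn_neq0 u0.
have hn := is_deriveD (is_deriveM u1 u1) (is_deriveM u2 u2).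
have hV := is_deriveV (f := fun s => sqn (u s)) n0 hn.
rewrite [- d / _](_ : _ = - d * ((u t)^-1 * (u t)^-1)); last by rewrite -invfM -expr2.
split.
  apply: (is_derive_ext (fun s => cReV (u s))).
  apply: (is_derive_eq (is_deriveM u1 hV)).
  move: n0; rewrite !(cReM, cImM, cReV, cImV, cReN, cImN) /GRing.scale /sqn /=.
  move: (Re (u t)) (Im (u t)) (Re d) (Im d) => p q p' q' n0.
  by field.
apply: (is_derive_ext (fun s => cImV (u s))).
apply: (is_derive_eq (is_deriveN (is_deriveM u2 hV))).
move: n0; rewrite !(cReM, cImM, cReV, cImV, cReN, cImN) /GRing.scale /sqn /=.
move: (Re (u t)) (Im (u t)) (Re d) (Im d) => p q p' q' n0.
by field.
Qed.

End ComplexCurves.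

(** * Primitives along a closed curve *)

Section Contours.
Variables (R : realType) (gamma : R -> complex R).
Hypothesis gcc : closed_curve gamma.
Local Notation C := (complex R).
Local Notation Re := complex.Re.
Local Notation Im := complex.Im.
Implicit Types (F G : C -> C) (cs : seq C).

Definition on_curve F := ccont (fun t => F (gamma t)).
Local Notation I := (contour_integral gamma).

Lemma is_derive_derive1 (f : R -> R) t : derivable f t 1 -> is_derive t 1 f (derive1 f t).
Proof. by move=> df; rewrite derive1E; exact: DeriveDef. Qed.

Lemma cder_gamma t : cder gamma t (velocity gamma t).
Proof.
have [[d1 _] [d2 _] _] := gcc.
by split; rewrite /velocity /=; exact: is_derive_derive1.
Qed.

Lemma ccont_gamma : ccont gamma.
Proof.
have [[d1 _] [d2 _] _] := gcc.
by move=> t _; split; apply/differentiable_continuous/derivable1_diffP.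
Qed.

Lemma ccont_velocity : ccont (velocity gamma).
Proof. by have [[_ c1] [_ c2] _] := gcc; move=> t _; split; [exact: c1|exact: c2]. Qed.

Lemma contourE F : I F = cint (fun t => F (gamma t) * velocity gamma t).
Proof. by []. Qed.

Lemma eq_contour F G : (forall t, 0 <= t <= 1 -> F (gamma t) = G (gamma t)) -> I F = I G.
Proof. by move=> FG; rewrite !contourE; apply: eq_cint => t /FG ->. Qed.

Lemma contourD F G : on_curve F -> on_curve G ->
  I (fun w => F w + G w) = I F + I G.
Proof.
move=> cF cG; rewrite !contourE -cintD; try exact: ccontM _ ccont_velocity.
by apply: eq_cint => t _; rewrite mulrDl.
Qed.

Lemma contourZ c F : on_curve F -> I (fun w => c * F w) = c * I F.
Proof.
move=> cF; rewrite !contourE -cintZ; last exact: ccontM _ ccont_velocity.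
by apply: eq_cint => t _; rewrite mulrA.
Qed.

Lemma contour_lin c d F G : on_curve F -> on_curve G ->
  I (fun w => c * F w + d * G w) = c * I F + d * I G.
Proof.
move=> cF cG; rewrite contourD ?contourZ //; exact: ccontM (ccont_cst _) _.
Qed.

Lemma contour_primitive F G : on_curve F ->
    (forall t, 0 <= t <= 1 -> cder (fun s => G (gamma s)) t (F (gamma t) * velocity gamma t)) ->
  I F = 0.
Proof.
move=> cF dG; rewrite contourE (cint_ftc (u := fun t => G (gamma t))) //.
  by have [_ _ ->] := gcc; rewrite subrr.
exact: ccontM _ ccont_velocity.
Qed.

Lemma cderX (u : R -> C) t d n : cder u t d ->
  cder (fun s => u s ^+ n.+1) t (n.+1%:R * u t ^+ n * d).
Proof.
move=> du; elim: n => [|n IH].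
  by rewrite expr0 !mul1r (_ : (fun s => _) = u) //; apply/funext => s; rewrite expr1.
rewrite (_ : (fun s => _) = fun s => u s * u s ^+ n.+1); last by apply/funext => s; rewrite exprS.
have h := cderM du IH; congr (cder _ _ _): h.
by rewrite -[n.+2]add1n natrD exprS; ring.
Qed.

Lemma cderZ (u : R -> C) t d c : cder u t d -> cder (fun s => c * u s) t (c * d).
Proof.
move=> du; have h := cderM (cder_cst c t) du; congr (cder _ _ _): h.
by rewrite mul0r addr0.
Qed.

Lemma on_curve_exp (u : R -> C) n : ccont u -> ccont (fun t => u t ^+ n).
Proof.
move=> cu; elim: n => [|n IH]; first by under eq_fun do rewrite expr0; exact: ccont_cst.
rewrite (_ : (fun t => _) = fun t => u t * u t ^+ n); last by apply/funext => s; rewrite exprS.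
exact: ccontM.
Qed.

Lemma contour_pow k : I (fun w => w ^+ k) = 0.
Proof.
have k0 : k.+1%:R != 0 :> C by rewrite pnatr_eq0.
apply: (contour_primitive (G := fun w => k.+1%:R^-1 * w ^+ k.+1)).
  exact: on_curve_exp ccont_gamma.
move=> t _; have h := cderZ k.+1%:R^-1 (cderX k (cder_gamma t)).
by congr (cder _ _ _): h; rewrite !mulrA mulVf // mul1r.
Qed.

Definition avoids (c : C) := forall t, 0 <= t <= 1 -> gamma t != c.

Lemma cder_sub c t : cder (fun s => gamma s - c) t (velocity gamma t).
Proof. by have h := cderD (cder_gamma t) (cder_cst (- c) t); rewrite addr0 in h. Qed.

Lemma ccont_sub c : ccont (fun s => gamma s - c).
Proof. exact: ccontD ccont_gamma (ccont_cst _). Qed.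

Lemma on_curve_inv c : avoids c -> on_curve (fun w => (w - c)^-1).
Proof.
by move=> gc; apply: ccontV (ccont_sub c) _ => t t01; rewrite subr_eq0 gc.
Qed.

Lemma contour_inv_pow c m : avoids c -> I (fun w => (w - c)^-1 ^+ m.+2) = 0.
Proof.
move=> gc; have m0 : m.+1%:R != 0 :> C by rewrite pnatr_eq0.
apply: (contour_primitive (G := fun w => (- m.+1%:R^-1) * (w - c)^-1 ^+ m.+1)).
  exact: on_curve_exp (on_curve_inv gc).
move=> t t01; have g0 : gamma t - c != 0 by rewrite subr_eq0 gc.
have h := cderZ (- m.+1%:R^-1) (cderX m (cderV g0 (cder_sub c t))).
congr (cder _ _ _): h; rewrite -exprVn -[m.+2]addn2 exprD.
by move: (m.+1%:R) m0 ((gamma t - c)^-1) => k k0 g; field.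
Qed.

Lemma Re_log_der (z v : C) : sqn z != 0 ->
  2^-1 * ((sqn z)^-1 * (Re z * Re v + Re z * Re v + (Im z * Im v + Im z * Im v))) =
  Re (z^-1 * v).
Proof.
rewrite cReM cReV cImV /sqn; case: z v => [p q] [p' q'] /= n0; by field.
Qed.

Lemma Im_log_der (z v : C) : sqn z != 0 -> Re z != 0 ->
  (1 + (Im z / Re z) ^+ 2)^-1 *
    (Im z * (- Re z ^- 2 * Re v) + (Re z)^-1 * Im v) = Im (z^-1 * v).
Proof.
rewrite cImM cReV cImV /sqn; case: z v => [p q] [p' q'] /= n0 p0; field.
by rewrite p0 n0.
Qed.

(** To the right of [c] the principal logarithm of [w - c] is a primitive. Since [sqn] is the
    squared modulus, its real part carries the factor 1/2; its imaginary part is an arctangent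
    because the real part of [w - c] is positive. *)
Lemma contour_inv_right (c : R) : (forall t, 0 <= t <= 1 -> c < Re (gamma t)) ->
  avoids c%:C /\ I (fun w => (w - c%:C)^-1) = 0.
Proof.
move=> gc; have av : avoids c%:C.
  move=> t t01; apply/eqP => h; have := gc t t01.
  by rewrite h ltxx.
split=> //; apply: (contour_primitive
  (G := fun w => (2^-1 * ln (sqn (w - c%:C))) +i* atan (Im (w - c%:C) / Re (w - c%:C)))).
  exact: on_curve_inv.
move=> t t01; have [u1 u2] := cder_sub c%:C t.
have g0 : gamma t - c%:C != 0 by rewrite subr_eq0 av.
have n0 := sqn_neq0 g0.
have re0 : 0 < Re (gamma t - c%:C) by rewrite cReD cReN /= subr_gt0 gc.
have s0 : 0 < sqn (gamma t - c%:C).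
  by rewrite /sqn ltr_pwDl ?sqr_ge0 // exprn_gt0.
have r0 : Re (gamma t - c%:C) != 0 by rewrite gt_eqF.
split.
  have hn := is_deriveD (is_deriveM u1 u1) (is_deriveM u2 u2).
  have hl := is_derive1_comp (f := @ln R) (g := fun s => sqn (gamma s - c%:C)) (is_derive1_ln s0) hn.
  have h2 := is_deriveZ 2^-1 hl.
  by apply: (is_derive_eq h2); rewrite -Re_log_der.
have hV := is_deriveV (f := fun s => Re (gamma s - c%:C)) r0 u1.
have hq := is_deriveM u2 hV.
have ha := is_derive1_comp (f := @atan R) (g := fun s => Im (gamma s - c%:C) / Re (gamma s - c%:C)) (is_derive1_atan _) hq.
by apply: (is_derive_eq ha); rewrite -Im_log_der.
Qed.

End Contours.

(** * Partial fractions *)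

Section Residues.
Variables (R : realType) (gamma : R -> complex R).
Hypothesis gcc : closed_curve gamma.
Local Notation C := (complex R).
Local Notation Re := complex.Re.
Local Notation Im := complex.Im.
Local Notation I := (contour_integral gamma).
Local Notation on_curve := (on_curve gamma).
Local Notation avoids := (avoids gamma).
Implicit Types (F G : C -> C) (cs : seq C) (l : seq (step R)).

Definition poles cs (w : C) : C := \prod_(c <- cs) (w - c)^-1.

Lemma poles_cons c cs w : poles (c :: cs) w = (w - c)^-1 * poles cs w.
Proof. by rewrite /poles big_cons. Qed.

Lemma on_curve_poles cs : (forall c, c \in cs -> avoids c) -> on_curve (poles cs).
Proof.
elim: cs => [|c cs IH] av.
  by rewrite (_ : poles [::] = fun=> 1); [exact: ccont_cst|apply/funext => w; rewrite /poles big_nil].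
rewrite (_ : poles _ = fun w => (w - c)^-1 * poles cs w); last exact/funext/poles_cons.
apply: ccontM; first by apply: on_curve_inv => //; apply: av; rewrite mem_head.
by apply: IH => d dcs; apply: av; rewrite in_cons dcs orbT.
Qed.

Lemma perm_poles cs cs' : perm_eq cs cs' -> poles cs = poles cs'.
Proof. by move=> p; apply/funext => w; rewrite /poles (perm_big _ p). Qed.

(** If all poles coincide, the integrand is a power of [(w - c)^-1]. Otherwise separate two distinct
    poles: the two resulting products have equally many factors, hence by induction equal integrals,
    and they enter with opposite signs. Below, [om] is 2 pi i for the points [a_x] and 0 for the
    poles of [f]. *)
Lemma contour_poles om cs :
    (forall c, c \in cs -> avoids c /\ I (fun w => (w - c)^-1) = om) ->
  I (poles cs) = if size cs == 1%N then om else 0.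
Proof.
elim: {cs}(size cs) {-2}cs (leqnn (size cs)) => [|n IH] cs.
  rewrite leqn0 size_eq0 => /eqP -> _ /=; rewrite -[RHS](contour_pow gcc 0).
  by apply: eq_contour => t _; rewrite /poles big_nil expr0.
case: cs => [|c1 s] sn h.
  rewrite -[RHS](contour_pow gcc 0).
  by apply: eq_contour => t _; rewrite /poles big_nil expr0.
have [av1 I1] := h c1 (mem_head _ _).
have [/all_pred1P sE|/allPn[c cs c1c]] := boolP (all (pred1 c1) s).
  have pE w : poles (c1 :: s) w = (w - c1)^-1 ^+ (size s).+1.
    rewrite /poles big_cons sE size_nseq exprS; congr (_ * _).
    by rewrite big_nseq; elim: (size s) => [|k IHk] //=; rewrite exprS IHk.
  rewrite (funext pE) /=; case: (size s) => [|m]; last exact: contour_inv_pow.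
  by rewrite -[RHS]I1; apply: eq_contour => t _; rewrite expr1.
have ps := perm_to_rem cs; set s' := rem c s in ps.
have [avc Ic] := h c (mem_behead (s := c1 :: s) cs).
have hs' d : d \in s' -> avoids d /\ I (fun w => (w - d)^-1) = om.
  by move=> /mem_rem ds; apply: h; rewrite in_cons ds orbT.
have ss : size s = (size s').+1 by rewrite (perm_size ps).
have c1c0 : c1 - c != 0 by rewrite subr_eq0 eq_sym.
have co d : d \in [:: c1; c] -> on_curve (poles (d :: s')).
  move=> dd; apply: on_curve_poles => e; rewrite inE => /orP[/eqP ->|/hs'[]//].
  by move: dd; rewrite !inE => /orP[] /eqP ->.
transitivity (I (fun w => (c1 - c)^-1 * poles (c1 :: s') w + (- (c1 - c)^-1) * poles (c :: s') w)).
  apply: eq_contour => t t01; rewrite !poles_cons (perm_poles ps) poles_cons.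
  have g1 : gamma t - c1 != 0 by rewrite subr_eq0 av1.
  have g2 : gamma t - c != 0 by rewrite subr_eq0 avc.
  move: (poles s' _) => q.
  move: (gamma t) g1 g2 => z g1 g2; field.
  by rewrite g1 g2 c1c0.
rewrite contour_lin //; [|exact: co (mem_head _ _)|by apply: co; rewrite !inE eqxx orbT].
rewrite !IH /= ?ss //.
- by rewrite mulNr subrr.
- by move: sn; rewrite /= ss.
- by move=> d; rewrite inE => /orP[/eqP ->//|/hs'].
- by move: sn; rewrite /= ss.
- by move=> d; rewrite inE => /orP[/eqP ->//|/hs'].
Qed.

(** The identity [w / (w - c) = 1 + c / (w - c)] lowers the power of [w] until only poles remain. *)
Lemma contour_pow_poles k cs :
    (forall c, c \in cs -> avoids c /\ I (fun w => (w - c)^-1) = 0) ->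
  I (fun w => w ^+ k * poles cs w) = 0.
Proof.
elim: k cs => [|k IH] cs h.
  rewrite (eq_contour (G := poles cs)); last by move=> t _; rewrite expr0 mul1r.
  by rewrite (contour_poles h) if_same.
have co s j : (forall c, c \in s -> c \in cs) -> on_curve (fun w => w ^+ j * poles s w).
  move=> scs; apply: ccontM; first exact: on_curve_exp (ccont_gamma gcc).
  by apply: on_curve_poles => c /scs/h[].
case: cs h co => [|c s] h co.
  rewrite -[RHS](contour_pow gcc k.+1).
  by apply: eq_contour => t _; rewrite /poles big_nil mulr1.
have [avc _] := h c (mem_head _ _).
transitivity (I (fun w => 1 * (w ^+ k * poles s w) + c * (w ^+ k * poles (c :: s) w))).
  apply: eq_contour => t t01; rewrite poles_cons exprS.
  have g1 : gamma t - c != 0 by rewrite subr_eq0 avc.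
  move: (poles s _) (_ ^+ k) => q p; move: (gamma t) g1 => z g1; by field.
rewrite contour_lin //; [|by apply: co => d; rewrite inE => ->; rewrite orbT|exact: co].
by rewrite !IH ?mulr0 ?addr0 // => d ds; apply: h; rewrite inE ds orbT.
Qed.

Definition steps_fun l (w : C) : C := \prod_(s <- l) step_fun s w.

(** For [be = 0] the geometric factor is 1 and has no pole. *)
Definition pole_free (s : step R) : Prop :=
  if s is Geometric be then
    0 <= be /\ (0 < be -> forall t, 0 <= t <= 1 -> - be^-1 < Re (gamma t))
  else True.

Definition all_pole_free l := forall s, List.In s l -> pole_free s.

Lemma steps_fun_cons s l w : steps_fun (s :: l) w = step_fun s w * steps_fun l w.
Proof. by rewrite /steps_fun big_cons. Qed.

Lemma geometric_pole (be : R) w : 0 < be ->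
  step_fun (Geometric be) w = (be^-1)%:C * (w - (- be^-1)%:C)^-1.
Proof.
move=> be0; have b0 : be%:C != 0 by rewrite (inj_eq (@complexI R)) gt_eqF.
have e1 : (be^-1)%:C = be%:C^-1 by exact: fmorphV.
have e2 : (- be^-1)%:C = - be%:C^-1 by rewrite rmorphN /= e1.
rewrite /= e1 e2 opprK -invfM; congr (_^-1).
by rewrite mulrDr mulfV // addrC.
Qed.

Lemma steps_fun_nil : steps_fun [::] = fun=> 1.
Proof. by apply/funext => w; rewrite /steps_fun big_nil. Qed.

Lemma on_curve_step s : pole_free s -> on_curve (step_fun s).
Proof.
case: s => [al _|be [be0 pf]].
  apply: ccontD; first exact: ccont_cst.
  rewrite (_ : (fun t => _) = fun t => (- al%:C) * gamma t); last first.
    by apply/funext => t; rewrite mulNr.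
  exact: ccontM (ccont_cst _) (ccont_gamma gcc).
have [be1|be1] := ltP 0 be; last first.
  have -> : be = 0 by apply/le_anti; rewrite be0 be1.
  rewrite (_ : step_fun _ = fun=> 1); first exact: ccont_cst.
  by apply/funext => w; rewrite /= mul0r addr0 invr1.
rewrite (_ : step_fun _ = fun w => (be^-1)%:C * (w - (- be^-1)%:C)^-1); last first.
  by apply/funext => w; exact: geometric_pole.
apply: ccontM (ccont_cst _) _; apply: on_curve_inv => //.
by have [] := contour_inv_right gcc (pf be1).
Qed.

Lemma on_curve_steps l : all_pole_free l -> on_curve (steps_fun l).
Proof.
elim: l => [|s l IH] pf.
  rewrite (_ : steps_fun [::] = fun=> 1); first exact: ccont_cst.
  by apply/funext => w; rewrite /steps_fun big_nil.
rewrite (_ : steps_fun _ = fun w => step_fun s w * steps_fun l w); last first.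
  exact/funext/steps_fun_cons.
apply: ccontM; first by apply: on_curve_step; apply: pf; left.
by apply: IH => s' sl; apply: pf; right.
Qed.

(* Partial fractions: only the simple poles could contribute, and the contour
   winds around none of them. *)
Lemma contour_pow_steps k l : all_pole_free l ->
  I (fun w => w ^+ k * steps_fun l w) = 0.
Proof.
move=> pf.
suff H cs : (forall c, c \in cs -> avoids c /\ I (fun w => (w - c)^-1) = 0) ->
    I (fun w => (w ^+ k * poles cs w) * steps_fun l w) = 0.
  rewrite -(H [::]) //; apply: eq_contour => t _.
  by rewrite /poles big_nil mulr1.
elim: l pf k cs => [|s l IH] pf k cs h.
  rewrite -[RHS](contour_pow_poles k h); apply: eq_contour => t _.
  by rewrite /steps_fun big_nil mulr1.
have pfl : all_pole_free l by move=> s' sl; apply: pf; right.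
have co j : on_curve (fun w => (w ^+ j * poles cs w) * steps_fun l w).
  apply: ccontM (on_curve_steps pfl).
  apply: ccontM; first exact: on_curve_exp (ccont_gamma gcc).
  by apply: on_curve_poles => c /h[].
have [pfs] : pole_free s /\ True by split=> //; apply: pf; left.
case: s pf {pfs} (pfs) => [al|be] pf pfs _.
  transitivity (I (fun w => 1 * ((w ^+ k * poles cs w) * steps_fun l w) +
      (- al%:C) * ((w ^+ k.+1 * poles cs w) * steps_fun l w))).
    by apply: eq_contour => t _; rewrite steps_fun_cons /= exprS; ring.
  by rewrite contour_lin // !IH // !mulr0 addr0.
have [be0 pfs'] := pfs; have [be1|be1] := ltP 0 be; last first.
  have b0 : be = 0 by apply/le_anti; rewrite be0 be1.
  rewrite -[RHS](IH pfl k cs h); apply: eq_contour => t _.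
  by rewrite steps_fun_cons /= b0 mul0r addr0 invr1 mul1r.
have cc := contour_inv_right gcc (pfs' be1).
transitivity (I (fun w => (be^-1)%:C * ((w ^+ k * poles ((- be^-1)%:C :: cs) w) * steps_fun l w))).
  apply: eq_contour => t _; rewrite steps_fun_cons geometric_pole // poles_cons; ring.
have h' c : c \in (- be^-1)%:C :: cs -> avoids c /\ I (fun w => (w - c)^-1) = 0.
  by rewrite inE => /orP[/eqP ->|/h].
rewrite contourZ // ?IH ?mulr0 //; apply: ccontM (on_curve_steps pfl).
apply: ccontM; first exact: on_curve_exp (ccont_gamma gcc).
by apply: on_curve_poles => c /h'[].
Qed.

Variable a : nat -> R.
Hypothesis a0 : forall x, 0 < a x.
Hypothesis enc : forall x, encircles gamma (a x)%:C.

Lemma aC_neq0 x : (a x)%:C != 0 :> C.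
Proof. by rewrite (inj_eq (@complexI R)) gt_eqF. Qed.

Lemma avoids_a x : avoids (a x)%:C.
Proof. by move=> t t01; have [+ _] := enc x; apply; rewrite in_itv. Qed.

Lemma charpolS x w : charpol a x.+1 w = charpol a x w * (1 - w / (a x)%:C).
Proof. by rewrite /charpol big_ord_recr. Qed.

Lemma charpol_factor x (w : C) : 1 - w / (a x)%:C = - ((a x)%:C)^-1 * (w - (a x)%:C).
Proof. by have := aC_neq0 x; move=> ax; field. Qed.

Lemma charpol_neq0 x t : 0 <= t <= 1 -> charpol a x (gamma t) != 0.
Proof.
move=> t01; apply/prodf_neq0 => k _; rewrite charpol_factor mulf_neq0 //.
  by rewrite oppr_eq0 invr_eq0 aC_neq0.
by rewrite subr_eq0 avoids_a.
Qed.

Lemma on_curve_charpol x : on_curve (charpol a x).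
Proof.
apply: (@ccont_prod R _ _ (fun (k : 'I_x) t => 1 - gamma t / (a k)%:C)) => k _; apply: ccontD; first exact: ccont_cst.
rewrite (_ : (fun t => _) = fun t => (- (a k)%:C^-1) * gamma t); last first.
  by apply/funext => t; rewrite mulNr mulrC.
exact: ccontM (ccont_cst _) (ccont_gamma gcc).
Qed.

Lemma on_curve_ratio x y F : on_curve F ->
  on_curve (fun w => charpol a x w / charpol a y w * F w).
Proof.
move=> cF; apply: ccontM cF; apply: ccontM; first exact: on_curve_charpol.
apply: ccontV; first exact: on_curve_charpol.
by move=> t t01; exact: charpol_neq0.
Qed.

(** The power [k] is free because each factor of [charpol] may raise it. *)
Lemma contour_charpol x l k : all_pole_free l ->
  I (fun w => charpol a x w * (w ^+ k * steps_fun l w)) = 0.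
Proof.
move=> pf; elim: x k => [|x IH] k.
  rewrite -[RHS](contour_pow_steps k pf); apply: eq_contour => t _.
  by rewrite /charpol big_ord0 mul1r.
have co j : on_curve (fun w => charpol a x w * (w ^+ j * steps_fun l w)).
  apply: ccontM; first exact: on_curve_charpol.
  by apply: ccontM; [exact: on_curve_exp (ccont_gamma gcc)|exact: on_curve_steps].
transitivity (I (fun w => 1 * (charpol a x w * (w ^+ k * steps_fun l w)) +
   (- ((a x)%:C)^-1) * (charpol a x w * (w ^+ k.+1 * steps_fun l w)))).
  by apply: eq_contour => t _; rewrite charpolS exprS; ring.
by rewrite contour_lin // !IH // !mulr0 addr0.
Qed.

Definition Tc F x y : C := - (two_pi_i R)^-1 * ((a y)%:C)^-1 *
  I (fun w => charpol a x w / charpol a y.+1 w * F w).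

Lemma TfE F x y : Tf a gamma F x y = Re (Tc F x y). Proof. by []. Qed.

Lemma eq_Tc F G : (forall t, 0 <= t <= 1 -> F (gamma t) = G (gamma t)) ->
  Tc F = Tc G.
Proof.
move=> FG; apply/funext => x; apply/funext => y; congr (_ * _).
by apply: eq_contour => t t01; rewrite FG.
Qed.

Lemma eq_Tf F G : (forall t, 0 <= t <= 1 -> F (gamma t) = G (gamma t)) ->
  Tf a gamma F = Tf a gamma G.
Proof. by move=> FG; apply/funext => x; apply/funext => y; rewrite !TfE (eq_Tc FG). Qed.

Lemma ReZ (k : R) (z : C) : Re (k%:C * z) = k * Re z.
Proof. by case: z => p q /=; rewrite mul0r subr0. Qed.

Lemma Tc_mul al F x y : on_curve F ->
  Tc (fun w => (1 - al%:C * w) * F w) x y =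
  Tc F x y + (al * a x)%:C * (Tc F x.+1 y - Tc F x y).
Proof.
move=> cF; rewrite /Tc; set q := - _ * _.
transitivity (q * I (fun w => (1 - (al * a x)%:C) * (charpol a x w / charpol a y.+1 w * F w) +
   (al * a x)%:C * (charpol a x.+1 w / charpol a y.+1 w * F w))).
  congr (_ * _); apply: eq_contour => t _; rewrite (charpolS x) rmorphM /=.
  have ax := aC_neq0 x; move: (charpol a y.+1 _)^-1 => p; by field.
have co1 := on_curve_ratio x y.+1 cF; have co2 := on_curve_ratio x.+1 y.+1 cF.
by rewrite contour_lin //; ring.
Qed.

Lemma Tf_mul al F x y : on_curve F ->
  Tf a gamma (fun w => (1 - al%:C * w) * F w) x y =
  Tf a gamma F x y + al * (a x * fdiff (Tf a gamma F ^~ y) x).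
Proof. by move=> cF; rewrite !TfE Tc_mul // cReD ReZ cReD cReN -mulrA. Qed.

Lemma two_pi_i_neq0 : two_pi_i R != 0.
Proof. by rewrite /two_pi_i eq_complex /= negb_and mulf_neq0 ?orbT // ?gt_eqF // pi_gt0. Qed.

Lemma charpol_ratio x k w : charpol a x w != 0 ->
  charpol a x w / charpol a (x + k) w =
  \prod_(j < k) (1 - w / (a (x + j)%N)%:C)^-1.
Proof.
move=> px; elim: k => [|k IH]; first by rewrite big_ord0 addn0 divff.
by rewrite addnS charpolS invfM mulrA IH big_ord_recr.
Qed.

Lemma charpol_ratio_below x k w : charpol a x w != 0 ->
  charpol a (x + k) w / charpol a x w =
  \prod_(j < k) (1 - w / (a (x + j)%N)%:C).
Proof.
move=> px; elim: k => [|k IH]; first by rewrite big_ord0 addn0 divff.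
by rewrite addnS charpolS mulrAC IH big_ord_recr.
Qed.

End Residues.

Lemma charpol_shift (R : realType) (a : nat -> R) x k (w : complex R) :
  \prod_(j < k) (1 - w / (a (x + j)%N)%:C) = charpol (fun j => a (x + j)%N) k w.
Proof. by []. Qed.

(** * Algebraic properties of the kernel *)

Section Transition.
Variables (R : realType) (gamma : R -> complex R).
Hypothesis gcc : closed_curve gamma.
Local Notation C := (complex R).
Local Notation Re := complex.Re.
Local Notation I := (contour_integral gamma).
Variable a : nat -> R.
Hypothesis a0 : forall x, 0 < a x.
Hypothesis enc : forall x, encircles gamma (a x)%:C.
Implicit Types (l : seq (step R)).

(** For [y < x] the quotient [p_x / p_(y+1)] is a polynomial, namely [charpol] of a shifted
    sequence, so no point [a_k] contributes. *)
Lemma Tc_below l x y : all_pole_free gamma l -> (y < x)%N ->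
  Tc gamma a (steps_fun l) x y = 0.
Proof.
move=> pf yx; rewrite /Tc; apply/eqP; rewrite mulf_eq0; apply/orP; right; apply/eqP.
rewrite -[RHS](contour_charpol gcc (fun j => a (y.+1 + j)%N) (x - y.+1) 0 pf).
apply: eq_contour => t t01; rewrite expr0 mul1r; congr (_ * _).
rewrite -{1}(subnKC yx) charpol_ratio_below // ?charpol_shift //.
by apply: charpol_neq0.
Qed.

(** Both sides are multiples of the integral of [w f p_x / p_(y+1)]: on the left by the difference
    [p_(x+1) - p_x], on the right by writing [p_x / p_y] over [p_(y+1)]. For [y = 0] the absent term
    is the integral of [p_x f], which vanishes. *)
Lemma Tc_comm l x y : all_pole_free gamma l ->
  (a x)%:C * (Tc gamma a (steps_fun l) x.+1 y - Tc gamma a (steps_fun l) x y) =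
  (if y is y'.+1 then (a y')%:C * Tc gamma a (steps_fun l) x y' else 0) -
  (a y)%:C * Tc gamma a (steps_fun l) x y.
Proof.
move=> pf; have cF := on_curve_steps gcc pf; set F := steps_fun l in cF *.
have co := on_curve_ratio gcc a0 enc _ _ cF.
rewrite /Tc; set q := - (two_pi_i R)^-1; have ay := aC_neq0 a0 y; have ax := aC_neq0 a0 x.
have key : (a x)%:C * ((a y)%:C)^-1 *
   (1 * I (fun w => charpol a x.+1 w / charpol a y.+1 w * F w) +
    (-1) * I (fun w => charpol a x w / charpol a y.+1 w * F w)) =
   - 1 * I (fun w => 1 * (charpol a x w / charpol a y.+1 w * F w) +
   (-1) * (charpol a x w / charpol a y w * F w)).
  transitivity (I (fun w => ((a x)%:C * ((a y)%:C)^-1) *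
    (1 * (charpol a x.+1 w / charpol a y.+1 w * F w) +
     (-1) * (charpol a x w / charpol a y.+1 w * F w)))).
    rewrite contourZ ?contour_lin //.
    by apply: ccontD; apply: ccontM (ccont_cst _) _; exact: co.
  rewrite -contourZ //; last first.
    by apply: ccontD; apply: ccontM (ccont_cst _) _; exact: co.
  apply: eq_contour => t t01; have py := charpol_neq0 a0 enc y t01.
  have := charpol_neq0 a0 enc y.+1 t01; rewrite !charpolS mulf_eq0 negb_or => /andP[_ p2].
  have p3 : (a y)%:C - gamma t != 0.
    have -> : (a y)%:C - gamma t = (1 - gamma t / (a y)%:C) * (a y)%:C by field.
    by rewrite mulf_neq0.
  move: (gamma t) (charpol a y _) (charpol a x _) py p3 => w p p' py p3.
  by move: (F w) => f; field; rewrite ay ax py p3.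
transitivity (- q * I (fun w => 1 * (charpol a x w / charpol a y.+1 w * F w) +
   (-1) * (charpol a x w / charpol a y w * F w))).
  rewrite (_ : - q = q * - 1); last by rewrite mulrN1.
  by rewrite -[RHS]mulrA -key; ring.
rewrite contour_lin // {key}; case: y ay => [|y] ay.
  rewrite [X in -1 * X](_ : _ = 0); first by field.
  rewrite -[RHS](contour_charpol gcc a x 0 pf).
  by apply: eq_contour => t _; rewrite /charpol big_ord0 invr1 mulr1 expr0 mul1r.
by have ay' := aC_neq0 a0 y; field; rewrite ay ay'.
Qed.

Lemma contour_prod_inv x k : I (fun w => \prod_(j < k) (1 - w / (a (x + j)%N)%:C)^-1) =
  if k == 1%N then - (a x)%:C * two_pi_i R else 0.
Proof.
pose cs := [seq (a (x + j)%N)%:C | j <- iota 0 k].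
have E w : \prod_(j < k) (1 - w / (a (x + j)%N)%:C)^-1 =
    (\prod_(j < k) (- (a (x + j)%N)%:C)) * poles cs w.
  have -> : poles cs w = \prod_(j < k) (w - (a (x + j)%N)%:C)^-1.
    rewrite /poles big_map -(big_mkord xpredT (fun j => (w - (a (x + j)%N)%:C)^-1)).
    by rewrite /index_iota subn0.
  rewrite -big_split /=.
  apply: eq_bigr => j _; rewrite charpol_factor // invfM invrN invrK //.
have h c : c \in cs -> avoids gamma c /\ I (fun w => (w - c)^-1) = two_pi_i R.
  move=> /mapP[j _ ->]; split; first exact: avoids_a.
  by have [] := enc (x + j).
rewrite (funext E) contourZ //; last by apply: on_curve_poles => // c /h[].
rewrite (contour_poles gcc h) size_map size_iota.
by case: eqP => [->|_]; rewrite ?mulr0 // big_ord1 addn0.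
Qed.

Lemma Tc1 x y : Tc gamma a (fun=> 1) x y = (x == y)%:R.
Proof.
case: (ltngtP x y) => [xy|yx|<-].
- rewrite /Tc; apply/eqP; rewrite mulf_eq0; apply/orP; right; apply/eqP.
  transitivity (I (fun w => \prod_(j < (y - x).+1) (1 - w / (a (x + j)%N)%:C)^-1)).
    apply: eq_contour => t t01; rewrite mulr1 -charpol_ratio ?charpol_neq0 //.
    by rewrite addnS subnKC // ltnW.
  by rewrite contour_prod_inv ifF //; lia.
- by rewrite -steps_fun_nil Tc_below.
- have ax := aC_neq0 a0 x; have p0 := two_pi_i_neq0 R.
  have I1 : I (fun w => charpol a x w / charpol a x.+1 w * 1) = - (a x)%:C * two_pi_i R.
    rewrite -[RHS](contour_prod_inv x 1); apply: eq_contour => t t01.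
    by rewrite mulr1 -charpol_ratio ?charpol_neq0 // addn1.
  by transitivity (1 : C) => //; rewrite /Tc I1; field; rewrite ax p0.
Qed.

Lemma Tf_below l x y : all_pole_free gamma l -> (y < x)%N ->
  Tf a gamma (steps_fun l) x y = 0.
Proof. by move=> pf yx; rewrite TfE Tc_below. Qed.

Lemma Tf_comm l x y : all_pole_free gamma l ->
  a x * fdiff (Tf a gamma (steps_fun l) ^~ y) x =
  (if y is y'.+1 then a y' * Tf a gamma (steps_fun l) x y' else 0) -
  a y * Tf a gamma (steps_fun l) x y.
Proof.
move=> pf; transitivity (Re ((a x)%:C *
    (Tc gamma a (steps_fun l) x.+1 y - Tc gamma a (steps_fun l) x y))).
  by rewrite ReZ cReD cReN.
rewrite Tc_comm // cReD cReN ReZ.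
by case: y => [|y] //; rewrite TfE ReZ.
Qed.

Lemma Tf1 x y : Tf a gamma (steps_fun [::]) x y = (x == y)%:R.
Proof.
by rewrite TfE steps_fun_nil Tc1; case: (x == y).
Qed.

Lemma Tf_bernoulli al l x y : all_pole_free gamma l ->
  Tf a gamma (steps_fun (Bernoulli al :: l)) x y =
  Tf a gamma (steps_fun l) x y + al * (a x * fdiff (Tf a gamma (steps_fun l) ^~ y) x).
Proof.
move=> pf; rewrite -(Tf_mul gcc a0 enc al x y (on_curve_steps gcc pf)).
by rewrite (funext (steps_fun_cons (Bernoulli al) l)).
Qed.

(** On the curve [1 + be w] does not vanish, so multiplying by it undoes the geometric factor; on
    kernels this is [Tf_mul] with parameter [- be]. *)
Lemma Tf_geometric be l x y : all_pole_free gamma (Geometric be :: l) ->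
  Tf a gamma (steps_fun l) x y =
  Tf a gamma (steps_fun (Geometric be :: l)) x y +
  (- be) * (a x * fdiff (Tf a gamma (steps_fun (Geometric be :: l)) ^~ y) x).
Proof.
move=> pf; rewrite -(Tf_mul gcc a0 enc (- be) x y (on_curve_steps gcc pf)).
rewrite (eq_Tf a (G := steps_fun l)) // => t t01; rewrite steps_fun_cons /= rmorphN mulNr opprK.
rewrite mulrA mulfV ?mul1r //.
have [be0 pfb] : pole_free gamma (Geometric be) by apply: pf; left.
move: be0; rewrite le_eqVlt => /orP[/eqP <-|be1]; first by rewrite mul0r addr0 oner_neq0.
apply/eqP => h; have := pfb be1 t t01.
have -> : Re (gamma t) = - be^-1; last by rewrite ltxx.
have := f_equal (@complex.Re R) h; rewrite cReD ReZ /= => h'.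
apply: (mulfI (lt0r_neq0 be1)); rewrite mulrN mulfV ?lt0r_neq0 //.
by apply/eqP; rewrite -addr_eq0 addrC h'.
Qed.

End Transition.

(** * Geometric decay and total mass of the kernel *)

Section GeometricDecay.
Variables (R : realType) (a : nat -> R) (b : R).
Hypothesis a0 : forall x, 0 < a x.
Hypothesis ab : forall x, a x <= b.
Implicit Types T : nat -> nat -> R.

Definition upper T := forall x y, (y < x)%N -> T x y = 0.

Definition intertwines T := forall x y, a x * fdiff (T^~ y) x =
  (if y is y'.+1 then a y' * T x y' else 0) - a y * T x y.

(** Uniform in the starting point, unlike [kernel_bound]: the induction over steps compares [T x]
    with [T x.+1]. *)
Definition geo_bound T (r C : R) := forall x k, `|T x (x + k)%N| <= C * r ^+ k.

(** In row [x + 1] the site [x + k] lies only [k - 1] from the diagonal, which costs the factor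
    [r^-1]. *)
Lemma geo_bound_bernoulli al T T' r C : upper T -> 0 < r -> 0 <= C ->
    (forall x y, T' x y = T x y + al * (a x * fdiff (T^~ y) x)) ->
  geo_bound T r C -> geo_bound T' r (C * (1 + `|al| * (b * (r^-1 + 1)))).
Proof.
move=> up r0 C0 E h x k; rewrite E; have ri := invr_gt0 r; rewrite r0 in ri.
apply: le_trans (ler_normD _ _) _; rewrite [leRHS](_ : _ = C * r ^+ k + C * r ^+ k * (`|al| * (b * (r^-1 + 1)))); last by ring.
apply: lerD => //.
have CR : 0 <= C * r ^+ k by rewrite mulr_ge0 // exprn_ge0 // ltW.
have h1 : `|T x.+1 (x + k)%N| <= r^-1 * (C * r ^+ k).
  case: k CR => [|k] CR.
    by rewrite up ?addn0 // normr0 mulr_ge0 // ltW.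
  have := h x.+1 k; rewrite addSnnS exprS => h1; apply: le_trans h1 _.
  by rewrite [leRHS](_ : _ = C * r ^+ k) //; field; rewrite gt_eqF.
rewrite !normrM (gtr0_norm (a0 x)).
have h2 : `|fdiff (T^~ (x + k)%N) x| <= (r^-1 + 1) * (C * r ^+ k).
  rewrite mulrDl mul1r; apply: le_trans (ler_normB _ _) _.
  by apply: lerD.
rewrite [leRHS](_ : _ = `|al| * (b * ((r^-1 + 1) * (C * r ^+ k)))); last by ring.
by rewrite ler_wpM2l //; apply: ler_pM => //; exact: ltW.
Qed.

(** Solved for [T' x], the relation is a recursion in [k] whose coefficient [be a_x / (1 + be a_x)]
    is at most [rho < 1] and whose source [T] decays at rate [r]. Any [r' < 1] with [r' >= r] and
    [r' > rho] is a possible rate. *)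
Lemma geo_bound_geometric be T T' r C : upper T' -> 0 <= be -> 0 < r < 1 -> 0 <= C ->
    (forall x y, T x y = T' x y + (- be) * (a x * fdiff (T'^~ y) x)) ->
    geo_bound T r C ->
  exists r' C', [/\ 0 < r' < 1, 0 <= C' & geo_bound T' r' C'].
Proof.
move=> up be0 /andP[r0 r1] C0 E h.
have b0 : 0 < b by apply: lt_le_trans (ab 0%N).
have bb : 0 <= be * b by rewrite mulr_ge0 // ltW.
pose rho := be * b / (1 + be * b); have d0 : 0 < 1 + be * b by rewrite ltr_pwDl.
have rho0 : 0 <= rho by rewrite divr_ge0 // ltW.
have rho1 : rho < 1 by rewrite ltr_pdivrMr // mul1r ltrDr ltr01.
pose r' := Num.max r ((1 + rho) / 2).
have rr' : r <= r' by rewrite le_max lexx.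
have rhor' : rho < r' by rewrite lt_max; apply/orP; right; rewrite ltr_pdivlMr //; lra.
have r'1 : r' < 1 by rewrite gt_max r1 ltr_pdivrMr //=; lra.
have r'0 : 0 < r' by apply: lt_le_trans rr'.
have d1 : 0 < r' - rho by rewrite subr_gt0.
(* [C'] solves [rho C' + C r' = C' r'], which closes the recursion, and it is at least [C], which
   settles [k = 0]. *)
pose C' := C * r' / (r' - rho); have C'0 : 0 <= C'.
  by rewrite divr_ge0 ?mulr_ge0 // ltW.
have eC : rho * C' + C * r' = C' * r'.
  by rewrite /C'; field; rewrite gt_eqF.
have CC' : C <= C' by rewrite /C' -mulrA ler_peMr // ler_pdivlMr // mul1r gerBl.
exists r', C'; split; rewrite ?r'0 // => x k.
elim: k x => [|k IH] x.
  have nz : 0 < 1 + be * a x by rewrite ltr_pwDl // mulr_ge0 // ltW.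
  have := h x 0; rewrite E addn0 /fdiff (up x.+1) // expr0 !mulr1 => hx.
  apply: le_trans CC'; apply: le_trans hx.
  rewrite (_ : _ + _ = (1 + be * a x) * T' x x); last by ring.
  by rewrite normrM ler_peMl // gtr0_norm // lerDl mulr_ge0 // ltW.
have bx0 : 0 <= be * a x by rewrite mulr_ge0 // ltW.
have nz : 0 < 1 + be * a x by rewrite ltr_pwDl.
have e1 : T' x (x + k.+1)%N = be * a x / (1 + be * a x) * T' x.+1 (x.+1 + k)%N +
    (1 + be * a x)^-1 * T x (x + k.+1)%N.
  by rewrite E /fdiff addSnnS; field; rewrite gt_eqF.
rewrite e1; apply: le_trans (ler_normD _ _) _.
rewrite (normrM (_ / _)) (normrM _^-1).
have -> : C' * r' ^+ k.+1 = rho * (C' * r' ^+ k) + 1 * (C * r' ^+ k.+1).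
  by rewrite exprS mulrA -eC; ring.
apply: lerD; apply: ler_pM => //.
- rewrite ger0_norm; last by rewrite divr_ge0 // ltW.
  rewrite ler_pdivrMr //.
  rewrite /rho mulrAC ler_pdivlMr //.
  have := ab x; rewrite -subr_ge0 => h1.
  by have : 0 <= be * (b - a x); [rewrite mulr_ge0|lra].
- by rewrite ger0_norm ?invr_ge0 ?(ltW nz) // invf_le1 // lerDl.
- apply: le_trans (h _ _) _; rewrite ler_wpM2l // lerXn2r // ?nnegrE ltW //.
Qed.

Lemma geo_bound_row T r C : upper T -> 0 < r -> 0 <= C -> geo_bound T r C ->
  forall x y, `|T x y| <= (C * (r ^+ x)^-1) * r ^+ y.
Proof.
move=> up r0 C0 h x y; have rx : 0 < r ^+ x by rewrite exprn_gt0.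
case: (ltnP y x) => yx.
  by rewrite up // normr0 mulr_ge0 // ?divr_ge0 // ?exprn_ge0 // ltW.
rewrite -(subnKC yx); apply: le_trans (h _ _) _.
by rewrite exprD mulrA mulfVK ?gt_eqF.
Qed.

(** By the intertwining relation [a_x] times the difference of the partial sums of rows [x + 1] and
    [x] telescopes to minus [a_y T(x, y)] at the last site [y], which tends to 0. *)
Lemma total_cst T r C : upper T -> 0 < r < 1 -> 0 <= C -> geo_bound T r C ->
    intertwines T ->
  forall x, pairing (fun=> 1) (T x) = pairing (fun=> 1) (T 0%N).
Proof.
move=> up r01 C0 h co; have [r0 _] := andP r01.
have row := geo_bound_row up r0 C0 h.
have cv x := cvg_pairing r01 (poly_bounded_cst (1 : R)) (row x).
elim=> [//|x IH]; rewrite -IH; apply/eqP; rewrite -subr_eq0; apply/eqP.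
apply: (mulfI (lt0r_neq0 (a0 x))); rewrite mulr0.
have l1 : (fun M => a x * (\sum_(y < M) 1 * T x.+1 y - \sum_(y < M) 1 * T x y)) @ \oo
   --> a x * (pairing (fun=> 1) (T x.+1) - pairing (fun=> 1) (T x)).
  by apply: cvgM; [exact: cvg_cst|exact: cvgB].
have l2 : (fun M => - (a M * T x M)) @ \oo --> (0 : R).
  suff hz : (fun M => a M * T x M) @ \oo --> (0 : R).
    have hn := cvgN hz; rewrite oppr0 in hn; exact: hn.
  have pa : poly_bounded a.
    by exists b, 0%N; split=> [|y]; rewrite ?expr0 ?mulr1 ?gtr0_norm // (le_trans _ (ab 0%N)) ?ltW.
  have := cvg_pairing r01 pa (row x).
  rewrite (_ : (fun M => _) = series (fun y => a y * T x y)); last first.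
    by apply: funext => M; rewrite /series /= big_mkord.
  by move=> hs; apply: cvg_series_cvg_0; apply/cvg_ex; eexists; exact: hs.
have e : (fun M => - (a M * T x M)) =
    (fun M => a x * (\sum_(y < M.+1) 1 * T x.+1 y - \sum_(y < M.+1) 1 * T x y)).
  apply: funext; elim=> [|M IHM].
    by rewrite !big_ord1 !mul1r -/(fdiff (T^~ 0%N) x) co sub0r.
  rewrite big_ord_recr [X in _ - X]big_ord_recr /= !mul1r.
  have := co x M.+1; rewrite /fdiff /= => e.
  rewrite opprD addrACA mulrDr -IHM e; ring.
rewrite e (cvg_shiftS (fun M => a x * (\sum_(y < M) 1 * T x.+1 y - \sum_(y < M) 1 * T x y))) in l2.
by rewrite -(cvg_lim _ l1) // (cvg_lim _ l2).
Qed.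

End GeometricDecay.

(** * Decay and mass for products of steps *)

Section StepKernels.
Variables (R : realType) (gamma : R -> complex R) (a : nat -> R) (b : R).
Hypothesis gcc : closed_curve gamma.
Hypothesis a0 : forall x, 0 < a x.
Hypothesis ab : forall x, a x <= b.
Hypothesis enc : forall x, encircles gamma (a x)%:C.
Implicit Types (l : seq (step R)).
Local Notation T l := (Tf a gamma (steps_fun l)).

Lemma all_pole_free_tail s l : all_pole_free gamma (s :: l) -> all_pole_free gamma l.
Proof. by move=> pf u ul; apply: pf; right. Qed.

Lemma upper_Tf l : all_pole_free gamma l -> upper (T l).
Proof. by move=> pf x y; exact: Tf_below. Qed.

Lemma intertwines_Tf l : all_pole_free gamma l -> intertwines a (T l).
Proof. by move=> pf x y; exact: Tf_comm. Qed.

Lemma geo_bound_delta r : 0 <= r -> geo_bound (T [::]) r 1.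
Proof.
move=> r0 x k; rewrite Tf1 // mul1r; case: eqP => [e|_]; last by rewrite normr0 exprn_ge0.
have -> : k = 0%N by lia.
by rewrite normr1.
Qed.

Lemma geo_bound_Tf l : all_pole_free gamma l ->
  exists r C, [/\ 0 < r < 1, 0 <= C & geo_bound (T l) r C].
Proof.
elim: l => [|s l IH] pf.
  exists 2^-1, 1; split=> //; last by apply: geo_bound_delta; rewrite invr_ge0.
  by rewrite invr_gt0 ltr0n invf_lt1 ?ltr1n ?ltr0n.
have pfl := all_pole_free_tail pf; have [r [C [r01 C0 h]]] := IH pfl.
have [r0 _] := andP r01; have b0 : 0 < b by apply: lt_le_trans (ab 0%N).
case: s pf => [al|be] pf.
  have h' := geo_bound_bernoulli a0 ab (upper_Tf pfl) r0 C0
    (fun x y => Tf_bernoulli gcc a0 enc al x y pfl) h.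
  exists r, (C * (1 + `|al| * (b * (r^-1 + 1)))); split=> //.
  by rewrite mulr_ge0 // addr_ge0 // !mulr_ge0 ?addr_ge0 ?invr_ge0 // ltW.
have [be0 _] : pole_free gamma (Geometric be) by apply: pf; left.
apply: (geo_bound_geometric a0 ab (upper_Tf pf) be0 r01 C0 _ h) => x y.
exact: Tf_geometric.
Qed.

(** A row of [T2] is an affine combination of two rows of [T1], whose masses agree. For a Bernoulli
    step [T1] is the old kernel, for a geometric one the new. *)
Lemma total_step al (T1 T2 : nat -> nat -> R) r1 C1 :
    0 < r1 < 1 -> 0 <= C1 -> upper T1 -> geo_bound T1 r1 C1 -> intertwines a T1 ->
    (forall x y, T2 x y = T1 x y + al * (a x * fdiff (T1^~ y) x)) ->
  forall x, pairing (fun=> 1) (T2 x) = pairing (fun=> 1) (T1 x).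
Proof.
move=> r01 C0 up h co E x; have [r0 _] := andP r01.
have row := geo_bound_row up r0 C0 h.
rewrite (_ : T2 x = fun y => (al * a x) * T1 x.+1 y + (1 - al * a x) * T1 x y); last first.
  by apply: funext => y; rewrite E /fdiff; ring.
rewrite (pairing_lin _ _ r01 r01 (poly_bounded_cst 1) (row x.+1) (row x)).
by rewrite !(total_cst a0 ab up r01 C0 h co); ring.
Qed.

Lemma total_Tf l x : all_pole_free gamma l -> pairing (fun=> 1) (T l x) = 1.
Proof.
elim: l x => [|s l IH] x pf.
  apply: cvg_lim => //; apply: cvg_near_cst; near=> M.
  have xM : (x < M)%N by near: M; exact: nbhs_infty_gt.
  rewrite (bigD1 (Ordinal xM)) //= Tf1 // eqxx mul1r big1 ?addr0 // => y.
  by rewrite Tf1 // -val_eqE eq_sym => /negPf /= ->; rewrite mulr0.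
have pfl := all_pole_free_tail pf; rewrite -[RHS](IH x pfl).
case: s pf => [al|be] pf.
  have [r [C [r01 C0 h]]] := geo_bound_Tf pfl.
  exact: total_step r01 C0 (upper_Tf pfl) h (intertwines_Tf pfl)
    (fun x y => Tf_bernoulli gcc a0 enc al x y pfl) x.
have [r [C [r01 C0 h]]] := geo_bound_Tf pf.
by rewrite (total_step r01 C0 (upper_Tf pf) h (intertwines_Tf pf)
    (fun x y => Tf_geometric gcc a0 enc x y pf)).
Unshelve. all: by end_near. Qed.

Lemma kernel_law_Tf l : all_pole_free gamma l -> kernel_law a (T l).
Proof.
move=> pf; split.
- exact: upper_Tf.
- exact: intertwines_Tf.
- have [r [C [r01 C0 h]]] := geo_bound_Tf pf; exists r; split=> // x.
  have [r0 _] := andP r01; exists (C * (r ^+ x)^-1).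
  exact: geo_bound_row (upper_Tf pf) r0 C0 h x.
- by move=> x; exact: total_Tf.
Qed.

End StepKernels.

(** * Poles of the step functions *)

Section PoleFree.
Variable R : realType.
Local Notation C := (complex R).
Implicit Types (l : seq (step R)) (be : R).

Definition nonneg_step (s : step R) : Prop :=
  match s with Bernoulli al => 0 <= al | Geometric be => 0 <= be end.

Lemma max_geometric l be : List.In (Geometric be) l ->
  exists2 bm, List.In (Geometric bm) l & forall be', List.In (Geometric be') l -> be' <= bm.
Proof.
elim: l be => [//|s l IH] be /= hb.
have [[be' hbe']|none] := pselect (exists be', List.In (Geometric be') l).
  have [bm mb mx] := IH be' hbe'; case: s hb => [al|b0] hb.
    by exists bm; [right|move=> b1 [//|]; exact: mx].
  have [h|h] := leP b0 bm.
    by exists bm; [right|move=> b1 [[<-]//|]; exact: mx].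
  exists b0; [by left|move=> b1 [[<-]//|/mx h1]].
  exact: le_trans h1 (ltW h).
exists be => // be' [e|h]; last by case: none; exists be'.
case: hb => [e'|h]; last by case: none; exists be.
by move: e; rewrite e' => -[->].
Qed.

(** For real [x] between the rightmost pole and 0, a Bernoulli factor is [1 - al x >= 1] and a
    geometric one the inverse of a number in the interval from 0 to 1. *)
Lemma step_real_ge1 s (x bm : R) : nonneg_step s -> x <= 0 ->
    (forall be, s = Geometric be -> be <= bm) -> 0 < 1 + bm * x ->
  exists2 r : R, 1 <= r & step_fun s x%:C = r%:C.
Proof.
case: s => [al|be] s0 x0 sm hx.
  exists (1 - al * x); last by rewrite /= rmorphB rmorphM.
  by rewrite lerDl oppr_ge0 mulr_ge0_le0.
have be1 := sm be erefl; have h0 : 0 < 1 + be * x.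
  apply: lt_le_trans hx _; rewrite lerD2l -subr_ge0 -mulrBl.
  by rewrite mulr_le0 // subr_le0.
exists (1 + be * x)^-1; last by rewrite fmorphV rmorphD rmorphM.
by rewrite invf_ge1 // gerDl mulr_ge0_le0.
Qed.

Lemma steps_real_ge1 l (x bm : R) : (forall s, List.In s l -> nonneg_step s) -> x <= 0 ->
    (forall be, List.In (Geometric be) l -> be <= bm) -> 0 < 1 + bm * x ->
  exists2 r : R, 1 <= r & steps_fun l x%:C = r%:C.
Proof.
move=> + x0 + hx; elim: l => [|s l IH] nn mx.
  by exists 1 => //; rewrite steps_fun_nil.
have [r r1 hr] := IH (fun s h => nn s (or_intror h)) (fun be h => mx be (or_intror h)).
have [r' r'1 hr'] : exists2 r : R, 1 <= r & step_fun s x%:C = r%:C.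
  apply: step_real_ge1 hx => //; first by apply: nn; left.
  by move=> be e; apply: mx; left.
exists (r' * r); last by rewrite steps_fun_cons hr hr' rmorphM.
by rewrite mulr_ege1.
Qed.

Lemma steps_fun_pole l be : 0 < be -> List.In (Geometric be) l ->
  steps_fun l (- be^-1)%:C = 0.
Proof.
move=> be0; elim: l => [//|s l IH] [->|h]; rewrite steps_fun_cons; last first.
  by rewrite IH // mulr0.
by rewrite geometric_pole // subrr invr0 mulr0 mul0r.
Qed.

(* At the rightmost pole the product takes the junk value 0, while it is at
   least 1 on the real segment from this pole to 0. *)
Lemma holomorphic_poles l eps be : (forall s, List.In s l -> nonneg_step s) ->
    holomorphic_on (right_half_plane eps) (steps_fun l) ->
  List.In (Geometric be) l -> 0 < be -> - be^-1 <= - eps.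
Proof.
move=> nn hol lb be0; rewrite leNgt; apply/negP => ce.
have [bm lbm mx] := max_geometric lb.
have bm0 : 0 < bm by apply: lt_le_trans (mx _ lb).
pose c : R := - bm^-1.
have cE : - eps < c.
  by apply: lt_le_trans ce _; rewrite lerN2 lef_pV2 ?posrE // mx.
have cont : {for (c%:C : C^o), continuous (steps_fun l : C^o -> C^o)}.
  by apply/differentiable_continuous/derivable1_diffP/hol.
move/cvgrPdist_lt: cont => /(_ 1 ltr01) /nbhs_ballP[e e0 he].
(* The radius comes as a positive element of the complex numbers, hence has no imaginary part. *)
have eE : e = (complex.Re e)%:C.
  move: e0; rewrite /= ltcE /= => /andP[/eqP i0 _].
  by case: e {he} i0 => ? ? /= ->.
have re0 : 0 < complex.Re e by move: e0; rewrite /= ltcE => /andP[].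
(* Halving puts [c + h] inside the ball and strictly between the pole [c] and 0. *)
pose h := Num.min (complex.Re e / 2) (bm^-1 / 2).
have h0 : 0 < h by rewrite lt_min !divr_gt0 ?invr_gt0 // ltr0n.
have he' : h < complex.Re e.
  by rewrite gt_min ltr_pdivrMr ?ltr0n // -[X in X < _]mulr1 ltr_pM2l // ltr1n.
have hb : h < bm^-1.
  by rewrite gt_min orbC ltr_pdivrMr ?ltr0n // -[X in X < _]mulr1 ltr_pM2l ?invr_gt0 // ltr1n.
have [r r1 hr] : exists2 r : R, 1 <= r & steps_fun l (c + h)%:C = r%:C.
  apply: (steps_real_ge1 (bm := bm)) => //.
    by rewrite /c addrC subr_le0 ltW.
  by rewrite /c mulrDr mulrN mulfV ?gt_eqF // addrA subrr add0r mulr_gt0.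
have : ball (c%:C : C^o) e (c + h)%:C.
  rewrite -ball_normE /= eE rmorphD opprD addrA subrr sub0r normrN.
  by rewrite normc_def /= expr0n /= addr0 sqrtr_sqr gtr0_norm // ltcR.
move=> /he; rewrite /= hr steps_fun_pole // sub0r normrN.
rewrite normc_def /= expr0n /= addr0 sqrtr_sqr ger0_norm ?(le_trans ler01) //.
by rewrite (ltcR r 1) ltNge r1.
Qed.

Lemma step_ok_nonneg (a : nat -> R) s : step_ok a s -> nonneg_step s.
Proof. by case: s => [al /andP[]|be []]. Qed.

Lemma discrete_fE (st : nat -> step R) s t :
  discrete_f st s t = steps_fun [seq st k | k <- index_iota s t].
Proof. by apply: funext => z; rewrite /discrete_f /steps_fun big_map. Qed.

Lemma admissible_pole_free (a : nat -> R) l gamma : (forall s, List.In s l -> nonneg_step s) ->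
  admissible_contour a (steps_fun l) gamma -> all_pole_free gamma l.
Proof.
move=> nn [_ [[eps [e0 hol hg]] _]] s sl.
case: s sl (nn s sl) => [//|be] sl be0; split=> // be1 t t01.
apply: le_lt_trans (holomorphic_poles nn hol sl be1) _.
by apply: hg; rewrite in_itv.
Qed.

End PoleFree.

(** * Discrete time: the one-step equation *)

Lemma left_bits_sorted p l bs : sorted geq (left_bits p l bs) /\ all (geq p) (left_bits p l bs).
Proof.
elim: l p bs => [//|u l IH] p bs /=.
have [s1 a1] := IH (minn p (u + head false bs)) (behead bs).
rewrite path_sortedE; last by move=> x y z /=; lia.
rewrite s1 a1 geq_minl; split=> //=; apply/allP => w wl.
by have /= := allP a1 w wl; lia.
Qed.

Section Sweeps.
Variables (R : realType) (a : nat -> R).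
Implicit Types (F G H : seq nat -> R) (l k v : seq nat) (M : nat).

Variant edge := RightEdge | LeftEdge.

(* A step moves the particles one after the other, starting with the leader.
   The landing site of a particle at [u] is a function of its noise and of the
   barrier set by the previous particle ([None] for the leader). *)
Definition landing (e : edge) (st : step R) (q : option nat) (u m : nat) : nat :=
  match e, st with
  | RightEdge, Bernoulli _ => maxn (odflt 0 q) (u + m)
  | RightEdge, Geometric _ => maxn (odflt 0 q) u + m
  | LeftEdge, _ => if q is Some p then minn p (u + m) else u + m
  end%N.

Definition noise_site (e : edge) (st : step R) (q : option nat) (u : nat) : nat :=
  match e, st with RightEdge, Geometric _ => maxn (odflt 0 q) u | _, _ => u end.

Definition barrier (e : edge) (st : step R) (u c : nat) : option nat :=
  match e, st with
  | RightEdge, _ => Some c.+1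
  | LeftEdge, Bernoulli _ => Some c
  | LeftEdge, Geometric _ => Some u
  end.

Definition landing_law e (st : step R) q u c : R :=
  match st with
  | Bernoulli al => (1 - al * a u) * (landing e st q u 0%N == c)%:R +
                    al * a u * (landing e st q u 1%N == c)%:R
  | Geometric be =>
      if e is RightEdge then geo a be (maxn (odflt 0%N q) u) c
      else if q is Some p then geo_stop a be p u c else geo a be u c
  end.

Fixpoint sweep_mean e st M q l F : R :=
  if l is u :: l' then
    \sum_(c < M) landing_law e st q u c *
      sweep_mean e st M (barrier e st u c) l' (fun k => F ((c : nat) :: k))
  else F [::].

(** The probability of ending at [v] without ever reaching site [M]. Positions never decrease, so
    the truncation loses nothing when [v] lies below [M]. *)
Fixpoint edge_prob e M v (sts : seq (step R)) l : R :=
  if sts is st :: sts' then sweep_mean e st M None l (edge_prob e M v sts')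
  else (l == v)%:R.

Lemma geo_below be m c : (c < m)%N -> geo a be m c = 0.
Proof. by rewrite /geo ltnNge => /negPf ->. Qed.

Lemma landing_law_right st q u c : (c < odflt 0%N q)%N -> landing_law RightEdge st q u c = 0.
Proof.
move=> cq; case: st => [al|be] /=; last by rewrite geo_below //; lia.
by rewrite !gtn_eqF ?mulr0 ?addr0 //; lia.
Qed.

(** A sweep charges only ordered configurations, so functions known to agree on these alone may be
    exchanged. *)
Lemma eq_sweep_right st M q l F G :
    (forall k, size k = size l -> all (ltn^~ M) k -> sorted ltn k ->
       all (leq (odflt 0%N q)) k -> F k = G k) ->
  sweep_mean RightEdge st M q l F = sweep_mean RightEdge st M q l G.
Proof.
elim: l q F G => [|u l IH] q F G FG /=; first exact: FG.
apply: eq_bigr => c _; have [cq|qc] := ltnP c (odflt 0%N q).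
  by rewrite landing_law_right // !mul0r.
congr (_ * _).
apply: IH => k sk kM sok qk; apply: FG => /=.
- by rewrite sk.
- by rewrite ltn_ord.
- by rewrite path_sortedE ?sok ?andbT //; exact: ltn_trans.
- rewrite qc /=; apply/allP => w wk; have /= := allP qk w wk; lia.
Qed.

Definition below (q : option nat) w := if q is Some p then (w <= p)%N else true.

Lemma eq_sweep_left st M q l F G : sorted geq l -> all (below q) l ->
    (forall k, size k = size l -> all (ltn^~ M) k -> sorted geq k ->
       all (below q) k -> F k = G k) ->
  sweep_mean LeftEdge st M q l F = sweep_mean LeftEdge st M q l G.
Proof.
elim: l q F G => [|u l IH] q F G sl bl FG /=; first exact: FG.
move: sl bl; rewrite /= path_sortedE; last by move=> x y z /=; lia.
move=> /andP[lu sl] /andP[uq _].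
apply: eq_bigr => c _; have [h|h] := boolP ((u <= c)%N && below q c); last first.
  suff -> : landing_law LeftEdge st q u c = 0 by rewrite !mul0r.
  clear IH FG; case: st q uq h => [al|be] [p|] /= uq; rewrite ?andbT.
  - move=> h; have /negPf -> : minn p (u + 0) != c by lia.
    have /negPf -> : minn p (u + 1) != c by lia.
    by rewrite !mulr0 addr0.
  - move=> h; have /negPf -> : (u + 0)%N != c by lia.
    have /negPf -> : (u + 1)%N != c by lia.
    by rewrite !mulr0 addr0.
  - move=> h; rewrite /geo_stop; case: ltnP => cp; first by rewrite geo_below //; lia.
    by case: eqP => // cpe; lia.
  - by rewrite -ltnNge => h; rewrite geo_below.
case/andP: h => uc qc; congr (_ * _); apply: IH => //.
  apply/allP => w wl; have /= := allP lu w wl; case: (st) => /= ?; lia.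
move=> k sk kM sok qk; apply: FG => /=.
- by rewrite sk.
- by rewrite ltn_ord.
- rewrite path_sortedE ?sok ?andbT; last by move=> x y z /=; lia.
  by apply/allP => w wk; have := allP qk w wk; case: (st) => /= ?; lia.
- rewrite qc /=; apply/allP => w wk; have := allP qk w wk.
  by case: (q) qc => // p /=; case: (st) => /= ?; lia.
Qed.

Lemma sum_ord_delta M (F : nat -> R) c0 : ((M <= c0)%N -> F c0 = 0) ->
  \sum_(c < M) (c0 == c)%:R * F c = F c0.
Proof.
move=> F0; have [h|h] := ltnP c0 M; last first.
  rewrite F0 // big1 // => c _; rewrite gtn_eqF ?mul0r //.
  exact: leq_trans (ltn_ord c) h.
rewrite (bigD1 (Ordinal h)) //= eqxx mul1r big1 ?addr0 // => c.
by rewrite -val_eqE eq_sym => /negPf /= ->; rewrite mul0r.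
Qed.

Lemma bits_mean0 th l (F : seq bool -> R) : (forall b, F b = 0) -> bits_mean a th l F = 0.
Proof.
elim: l F => [|u l IH] F F0 /=; first exact: F0.
by rewrite !IH ?mulr0 ?addr0 // => b; exact: F0.
Qed.

Lemma sweep_bernoulli_right al M q l F : vanishes_above M F ->
  sweep_mean RightEdge (Bernoulli al) M (Some q) l F =
  bits_mean a al l (fun b => F (right_bits q l b)).
Proof.
elim: l q F => [//|u l IH] q F vF /=; rewrite addn0 addn1.
pose S c := bits_mean a al l (fun b => F (c :: right_bits c.+1 l b)).
transitivity (\sum_(c < M) ((1 - al * a u) * ((maxn q u == c)%:R * S c) +
    al * a u * ((maxn q u.+1 == c)%:R * S c))).
  apply: eq_bigr => c _; rewrite IH; last exact: vanishes_above_cons.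
  by rewrite -/(S c); ring.
have S0 c : (M <= c)%N -> S c = 0.
  by move=> Mc; apply: bits_mean0 => b; apply: (vF _ c) => //; rewrite mem_head.
by rewrite big_split /= -!mulr_sumr !sum_ord_delta //; exact: S0.
Qed.

Lemma sweep_bernoulli_left al M q l F : vanishes_above M F ->
  sweep_mean LeftEdge (Bernoulli al) M (Some q) l F =
  bits_mean a al l (fun b => F (left_bits q l b)).
Proof.
elim: l q F => [//|u l IH] q F vF /=; rewrite addn0 addn1.
pose S c := bits_mean a al l (fun b => F (c :: left_bits c l b)).
transitivity (\sum_(c < M) ((1 - al * a u) * ((minn q u == c)%:R * S c) +
    al * a u * ((minn q u.+1 == c)%:R * S c))).
  apply: eq_bigr => c _; rewrite IH; last exact: vanishes_above_cons.
  by rewrite -/(S c); ring.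
have S0 c : (M <= c)%N -> S c = 0.
  by move=> Mc; apply: bits_mean0 => b; apply: (vF _ c) => //; rewrite mem_head.
by rewrite big_split /= -!mulr_sumr !sum_ord_delta //; exact: S0.
Qed.

Lemma sweep_geometric_right be M q l F :
  sweep_mean RightEdge (Geometric be) M (Some q) l F = right_geo_sum a be M q l F.
Proof. by elim: l q F => //= u l IH q F; apply: eq_bigr => c _; rewrite IH. Qed.

Lemma sweep_geometric_left be M q l F :
  sweep_mean LeftEdge (Geometric be) M (Some q) l F = left_geo_sum a be M q l F.
Proof. by elim: l q F => //= u l IH q F; apply: eq_bigr => c _; rewrite IH. Qed.

Lemma sweep_right0 st M l F :
  sweep_mean RightEdge st M None l F = sweep_mean RightEdge st M (Some 0%N) l F.
Proof. by case: l. Qed.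

(** Only landing sites below [M] are summed, and for these a barrier at [M] acts as none. *)
Lemma sweep_leftM st M l F :
  sweep_mean LeftEdge st M None l F = sweep_mean LeftEdge st M (Some M) l F.
Proof.
case: l => //= u l; apply: eq_bigr => c _; congr (_ * _); have cM := ltn_ord c.
case: st => [al|be] /=; last by rewrite /geo_stop cM.
have E m : (minn M (u + m) == c) = (u + m == c)%N by lia.
by rewrite !E.
Qed.

End Sweeps.

(** * The edge determinants and the one-step equation *)

Section EdgeDeterminants.
Variables (R : realType) (a : nat -> R) (c b : R).
Hypothesis ac : forall u, 0 <= (a u)^-1 <= c.
Hypothesis a0 : forall u, 0 < a u.
Hypothesis ab : forall u, a u <= b.
Implicit Types (l v : seq nat) (M N : nat) (T : nat -> nat -> R).

Lemma a_neq0 u : a u != 0. Proof. by rewrite gt_eqF. Qed.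

Lemma act_step th T T' k : kernel_law a T -> poly_bounded k ->
    (forall x y, T' x y = T x y + th * (a x * fdiff (T^~ y) x)) ->
  forall x, act T' k x = act T k x + th * (a x * fdiff (act T k) x).
Proof.
move=> [_ _ [r [r01 TC]] _] kp E x; have [C1 h1] := TC x; have [C2 h2] := TC x.+1.
rewrite /act (_ : T' x = fun y => (th * a x) * T x.+1 y + (1 - th * a x) * T x y); last first.
  by apply: funext => y; rewrite E /fdiff; ring.
by rewrite (pairing_lin _ _ r01 r01 kp h2 h1) /fdiff; ring.
Qed.

Lemma act_eq0 T k x : (forall y, k y * T x y = 0) -> act T k x = 0.
Proof.
move=> h; apply: cvg_lim => //; rewrite (_ : (fun M => _) = fun=> 0); first exact: cvg_cst.
by apply: funext => M; rewrite big1.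
Qed.

Lemma act_identity T k x : (forall x y, T x y = (x == y)%:R) -> act T k x = k x.
Proof.
move=> Td; apply: cvg_lim => //; apply: cvg_near_cst; near=> M.
have xM : (x < M)%N by near: M; exact: nbhs_infty_gt.
rewrite (bigD1 (Ordinal xM)) //= Td eqxx mulr1 big1 ?addr0 // => y.
by rewrite Td -val_eqE eq_sym => /negPf /= ->; rewrite mulr0.
Unshelve. all: by end_near. Qed.

Lemma shift_all_det_fun0 th N h l : size l != N -> shift_all a th (det_fun N h) l = 0.
Proof.
move=> sl; rewrite (eq_shift_all a th (G := fun k => 0 * 0)) ?shift_allZ ?mul0r //.
by move=> k sk; rewrite /det_fun sk (negPf sl) ?mul0r.
Qed.

Section OneStep.
Variables (N : nat) (v : seq nat) (T T' : nat -> nat -> R) (th : R).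
Hypothesis Tl : kernel_law a T.
Hypothesis step : forall x y, T' x y = T x y + th * (a x * fdiff (T^~ y) x).

Lemma shift_all_right :
  shift_all a th (right_det a N T v) = right_det a N T' v.
Proof.
apply: funext => l; have [sl|sl] := eqVneq (size l) N; last first.
  by rewrite shift_all_det_fun0 // /right_det /det_fun (negPf sl).
apply: shift_all_family => // k w x; apply: act_step => //.
exact: right_ker_poly_bounded.
Qed.

Lemma shift_all_left :
  shift_all a th (left_det a N T v) = left_det a N T' v.
Proof.
apply: funext => l; have [sl|sl] := eqVneq (size l) N; last first.
  by rewrite shift_all_det_fun0 // /left_det /det_fun (negPf sl).
apply: shift_all_family => // k w x; apply: act_step => //.
exact: left_ker_poly_bounded ac _ _.
Qed.

End OneStep.

Section OneKernel.
Variables (N M : nat) (v : seq nat) (T : nat -> nat -> R).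
Hypothesis Tl : kernel_law a T.
Hypothesis vM : all (ltn^~ M) v.
Hypothesis sv : size v = N.

Lemma norm_ab u : `|a u| <= b. Proof. by rewrite gtr0_norm. Qed.

Lemma nth_lt j : (j < N)%N -> (nth 0%N v j < M)%N.
Proof. by move=> jN; apply: (allP vM); rewrite mem_nth // sv. Qed.

Lemma right_det_neumann : neumann (right_det a N T v).
Proof.
apply: neumann_family; [exact: a_neq0|by rewrite oppr_eq0 oner_eq0|].
exact (act_lowering norm_ab Tl (right_ker_poly_bounded a) (right_ker_lowering a_neq0)).
Qed.

Lemma left_det_neumann : neumann (left_det a N T v).
Proof.
apply: neumann_family; [exact: a_neq0|by rewrite oner_eq0|].
exact (act_lowering norm_ab Tl (left_ker_poly_bounded ac) (left_ker_lowering a_neq0)).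
Qed.

Lemma right_act_above k w u : (w < u)%N -> act T (right_ker a k w) u = 0.
Proof.
move=> wu; apply: act_eq0 => y; have [yu|uy] := ltnP y u.
  by rewrite (kernel_tri Tl) // mulr0.
by rewrite right_ker_above ?mul0r // (leq_trans wu).
Qed.

Lemma right_det_above : vanishes_above M (right_det a N T v).
Proof.
apply: vanishes_above_det => i j u iN jN Mu; rewrite /det_family.
have vu : (nth 0%N v j < u)%N := leq_trans (nth_lt jN) Mu.
case: leqP => _; last exact: right_act_above.
apply: (@iter_lgen_above _ a _ M) => // w Mw.
exact: right_act_above (leq_trans (nth_lt jN) Mw).
Qed.

(** Only the row of the leader is sure to vanish above [M]: it consists of differences of [act T] on
    indicators. The other rows may contain [left_ker] of positive order, which lives above [v]. *)
Lemma left_det_above u l : (M <= u)%N -> left_det a N T v (u :: l) = 0.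
Proof.
move=> Mu; have [sl|sl] := eqVneq (size (u :: l)) N; last first.
  by rewrite /left_det /det_fun (negPf sl).
have N0 : (0 < N)%N by rewrite -sl.
apply: (det_fun_row0 (i := Ordinal N0)) => j; rewrite /det_family /=.
apply: (@iter_lgen_above _ a _ M) => // w Mw; apply: act_eq0 => y /=.
have vw := leq_trans (nth_lt (ltn_ord j)) Mw.
case: eqP => [->|]; rewrite ?mul0r //.
by rewrite (kernel_tri Tl) // mulr0.
Qed.

End OneKernel.

Section OneSweep.
Variables (N M : nat) (v : seq nat) (T T' : nat -> nat -> R).
Hypothesis Tl : kernel_law a T.
Hypothesis Tl' : kernel_law a T'.
Hypothesis vM : all (ltn^~ M) v.
Hypothesis sv : size v = N.

Lemma right_sweep_bernoulli al l : sorted ltn l ->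
    (forall x y, T' x y = T x y + al * (a x * fdiff (T^~ y) x)) ->
  sweep_mean a RightEdge (Bernoulli al) M None l (right_det a N T v) =
  right_det a N T' v l.
Proof.
move=> sl st; rewrite sweep_right0 sweep_bernoulli_right; last exact: right_det_above.
by rewrite bits_mean_right ?(shift_all_right _ _ Tl st) //; exact: right_det_neumann.
Qed.

Lemma right_sweep_geometric be l : sorted ltn l -> 0 <= be ->
    (forall x y, T x y = T' x y + (- be) * (a x * fdiff (T'^~ y) x)) ->
  sweep_mean a RightEdge (Geometric be) M None l (right_det a N T v) =
  right_det a N T' v l.
Proof.
move=> sl be0 st; rewrite sweep_right0 sweep_geometric_right.
rewrite -(shift_all_right _ _ Tl' st) right_geo_sum_shift ?cascade0 //.
- by move=> u; rewrite gt_eqF // ltr_pwDl // mulr_ge0 // ltW.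
- exact: right_det_neumann.
- exact: right_det_above.
Qed.

Lemma left_sweep_bernoulli al l : sorted geq l -> all (ltn^~ M) l ->
    (forall x y, T' x y = T x y + al * (a x * fdiff (T^~ y) x)) ->
  sweep_mean a LeftEdge (Bernoulli al) M None l (left_det a N T v) =
  left_det a N T' v l.
Proof.
(* [left_det] need not vanish when a follower is above [M], as [sweep_bernoulli_left] requires, so
   it is cut off by hand; the sweep does not notice. *)
move=> sl lM st; pose F1 k := if all (ltn^~ M) k then left_det a N T v k else 0.
rewrite sweep_leftM (@eq_sweep_left _ a _ _ _ _ _ F1) //; last first.
- by move=> k _ kM _ _; rewrite /F1 kM.
- by apply/allP => w /(allP lM) /= h; lia.
rewrite sweep_bernoulli_left; last first.
  move=> k u uk Mu; rewrite /F1; case: ifP => // /allP /(_ u uk) /=; lia.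
rewrite -(shift_all_left _ _ Tl st) -(bits_mean_left a al _ sl lM); last exact: left_det_neumann.
(* A decreasing list with a coordinate at or above [M] has its leader there, where [left_det]
   vanishes. *)
apply: eq_bits_mean => bs; rewrite /F1; case: ifPn => // nall.
have [] := left_bits_sorted M l bs; case: (left_bits M l bs) nall => [//|w k] nall s1 a1.
apply/esym/(left_det_above Tl vM sv); rewrite leqNgt; apply/negP => wM.
case/negP: nall; rewrite /= wM; apply/allP => w' w'k.
move: s1; rewrite /= path_sortedE; last by move=> x y z /=; lia.
by move=> /andP[/allP /(_ w' w'k) /=]; lia.
Qed.

Lemma left_sweep_geometric be l : sorted geq l -> all (ltn^~ M) l -> 0 <= be ->
    (forall x y, T x y = T' x y + (- be) * (a x * fdiff (T'^~ y) x)) ->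
  sweep_mean a LeftEdge (Geometric be) M None l (left_det a N T v) =
  left_det a N T' v l.
Proof.
move=> sl lM be0 st; rewrite sweep_leftM sweep_geometric_left.
rewrite -(shift_all_left _ _ Tl' st) left_geo_sum_shift //.
- by move=> u; rewrite gt_eqF // ltr_pwDl // mulr_ge0 // ltW.
- exact: left_det_neumann.
- by move=> k; rewrite !(left_det_above Tl' vM).
- by right; split=> // k; rewrite (left_det_above Tl' vM).
- rewrite path_sortedE ?sl ?andbT; last by move=> x y z /=; lia.
  by apply/allP => w /(allP lM) /= h; lia.
Qed.

End OneSweep.

Section StepLists.
Variable gamma : R -> complex R.
Hypothesis gcc : closed_curve gamma.
Hypothesis enc : forall x, encircles gamma (real_complex R (a x)).
Variables (N M : nat) (v : seq nat).
Hypothesis vM : all (ltn^~ M) v.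
Hypothesis sv : size v = N.
Local Notation T sts := (Tf a gamma (steps_fun sts)).

(** The first step is a factor of [f] and the outermost average of the probability, so both sides
    obey the same recursion. Without steps [T] is the identity and the determinant an indicator. *)
Lemma edge_prob_right sts l : all_pole_free gamma sts -> sorted ltn v ->
  size l = N -> sorted ltn l -> edge_prob a RightEdge M v sts l = right_det a N (T sts) v l.
Proof.
move=> + vs; elim: sts l => [|st sts IH] l pf sl ls.
  rewrite /= -(det_right_ker_initial a sl sv ls vs) /right_det; congr (det_fun _ (det_family _ _ _ _) _).
  apply: funext => k; apply: funext => w; apply: funext => u; rewrite act_identity //.
  by move=> x y; exact: Tf1.
have pfl := all_pole_free_tail pf.
have law sts' : all_pole_free gamma sts' -> kernel_law a (T sts').
  exact: kernel_law_Tf gcc a0 ab enc _.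
rewrite /= (@eq_sweep_right _ a _ _ _ _ _ (right_det a N (T sts) v)); last first.
  by move=> k sk _ ks _; apply: IH => //; rewrite sk.
case: st pf => [al|be] pf.
  apply: right_sweep_bernoulli ls _ => //; [exact: law|].
  by move=> x y; exact: Tf_bernoulli.
have [be0 _] : pole_free gamma (Geometric be) by apply: pf; left.
apply: right_sweep_geometric ls be0 _ => //; [exact: law|].
by move=> x y; exact: Tf_geometric.
Qed.

Lemma edge_prob_left sts l : all_pole_free gamma sts -> sorted geq v ->
    size l = N -> sorted geq l -> all (ltn^~ M) l ->
  edge_prob a LeftEdge M v sts l = left_det a N (T sts) v l.
Proof.
move=> + vs; elim: sts l => [|st sts IH] l pf sl ls lM.
  rewrite /= -(det_left_ker_initial a sl sv ls vs) /left_det; congr (det_fun _ (det_family _ _ _ _) _).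
  apply: funext => k; apply: funext => w; apply: funext => u; rewrite act_identity //.
  by move=> x y; exact: Tf1.
have pfl := all_pole_free_tail pf.
have law sts' : all_pole_free gamma sts' -> kernel_law a (T sts').
  exact: kernel_law_Tf gcc a0 ab enc _.
rewrite /= (@eq_sweep_left _ a _ _ _ _ _ (left_det a N (T sts) v)) //; last first.
- by move=> k sk kM ks _; apply: IH => //; rewrite sk.
- exact/allP.
case: st pf => [al|be] pf.
  apply: left_sweep_bernoulli ls lM _ => //; [exact: law|].
  by move=> x y; exact: Tf_bernoulli.
have [be0 _] : pole_free gamma (Geometric be) by apply: pf; left.
apply: left_sweep_geometric ls lM be0 _ => //; [exact: law|].
by move=> x y; exact: Tf_geometric.
Qed.

End StepLists.

End EdgeDeterminants.

(** * Discrete time: the law of the edge systems *)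

#[local] Arguments landing : simpl never.
#[local] Arguments barrier : simpl never.

Section Chains.
Variable R : realType.
Implicit Types (l v : seq nat) (M : nat) (st : step R) (e : edge).

Fixpoint sweep e st (xi : nat -> nat -> nat) n q l : seq nat :=
  if l is u :: l' then
    let w := landing e st q u (xi n (noise_site e st q u)) in
    w :: sweep e st xi n.+1 (barrier e st u w) l'
  else [::].

Fixpoint chain e (xi : nat * nat * nat -> nat) s (sts : seq (step R)) l : seq nat :=
  if sts is st :: sts' then
    chain e xi s.+1 sts' (sweep e st (fun n u => xi (s, n, u)) 0 None l)
  else l.

(** The event measured by [edge_prob]. Bounding the sites makes it a finite disjoint union over the
    landing sites. *)
Fixpoint hits e M (xi : nat * nat * nat -> nat) v s (sts : seq (step R)) l : bool :=
  if sts is st :: sts' then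
    let l' := sweep e st (fun n u => xi (s, n, u)) 0 None l in
    all (ltn^~ M) l' && hits e M xi v s.+1 sts' l'
  else l == v.

Lemma sweep_right_le st xi n q l M :
  all (ltn^~ M) (sweep RightEdge st xi n q l) -> all (ltn^~ M) l.
Proof.
elim: l n q => [//|u l IH] n q /= /andP[wM /IH ->]; rewrite andbT.
by case: st wM {IH} => [al|be]; rewrite /landing; lia.
Qed.

Lemma sweep_left_le st xi n q l : sorted geq l -> all (below q) l ->
  [/\ sorted geq (sweep LeftEdge st xi n q l), all (below q) (sweep LeftEdge st xi n q l)
    & forall M, all (ltn^~ M) (sweep LeftEdge st xi n q l) -> all (ltn^~ M) l].
Proof.
have tr : transitive geq by move=> x y z /=; lia.
elim: l n q => [//|u l IH] n q /=; rewrite path_sortedE // => /andP[ul sl] /andP[uq _].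
set w := landing _ _ _ _ _; have [uw wq] : (u <= w)%N /\ below q w.
  by rewrite /w /landing; case: (q) uq => [p|] /=; lia.
have [|s1 b1 m1] := IH n.+1 (barrier LeftEdge st u w) sl.
  by apply/allP => x /(allP ul) /=; rewrite /barrier; case: (st) => /= ?; lia.
have bw : all (geq w) (sweep LeftEdge st xi n.+1 (barrier LeftEdge st u w) l).
  by apply/allP => x /(allP b1) /=; rewrite /barrier; case: (st) => /= ?; lia.
split.
- by rewrite path_sortedE // bw s1.
- rewrite wq /=; apply/allP => x /(allP bw) /=; case: (q) wq => //= p; lia.
- by move=> M /andP[wM /m1 ->]; rewrite andbT; lia.
Qed.

Lemma chain_right_le xi s sts l M :
  all (ltn^~ M) (chain RightEdge xi s sts l) -> all (ltn^~ M) l.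
Proof. by elim: sts s l => [//|st sts IH] s l /= /IH /sweep_right_le. Qed.

Lemma chain_left_le xi s sts l M : sorted geq l ->
  all (ltn^~ M) (chain LeftEdge xi s sts l) -> all (ltn^~ M) l.
Proof.
elim: sts s l => [//|st sts IH] s l sl /=.
have [|s1 _ m1] := sweep_left_le st (fun n u => xi (s, n, u)) 0 sl (q := None).
  by apply/allP.
by move=> /(IH _ _ s1) /m1.
Qed.

Lemma hits_right xi s sts l v M : all (ltn^~ M) v ->
  hits RightEdge M xi v s sts l = (chain RightEdge xi s sts l == v).
Proof.
move=> vM; elim: sts s l => [//|st sts IH] s l /=; rewrite IH.
case: eqP => [e|]; last by rewrite andbF.
by rewrite (chain_right_le (xi := xi) (s := s.+1) (sts := sts)) // e.
Qed.

Lemma hits_left xi s sts l v M : all (ltn^~ M) v -> sorted geq l ->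
  hits LeftEdge M xi v s sts l = (chain LeftEdge xi s sts l == v).
Proof.
move=> vM; elim: sts s l => [//|st sts IH] s l sl /=.
have [|s1 _ _] := sweep_left_le st (fun n u => xi (s, n, u)) 0 sl (q := None).
  by apply/allP.
rewrite IH //; case: eqP => [e|]; last by rewrite andbF.
by rewrite (chain_left_le (xi := xi) (s := s.+1) (sts := sts)) // e.
Qed.

Lemma sweep_rightE st xi (x : seq nat) n :
  sweep RightEdge st xi n
    (if n is n'.+1 then Some (right_update st xi (nth 0%N x) n').+1 else None) (drop n x) =
  [seq right_update st xi (nth 0%N x) i | i <- iota n (size x - n)].
Proof.
elim: {n}(size x - n)%N {-2}n (erefl (size x - n)%N) => [|k IH] n en.
  by rewrite en drop_oversize; [|lia].
rewrite (drop_nth 0%N) /=; last by lia.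
set w := landing _ _ _ _ _; have -> : w = right_update st xi (nth 0%N x) n.
  rewrite /w /landing; case: (st) => [al|be]; case: (n) => [|n'] //=; rewrite ?max0n //.
  by rewrite maxnC.
have e : (size x - n.+1)%N = k by lia.
by rewrite en /=; congr (_ :: _); rewrite -[in RHS]e -IH.
Qed.

Lemma sweep_leftE st xi (x : seq nat) n :
  sweep LeftEdge st xi n
    (if n is n'.+1 then barrier LeftEdge st (nth 0%N x n') (left_update st xi (nth 0%N x) n')
     else None) (drop n x) =
  [seq left_update st xi (nth 0%N x) i | i <- iota n (size x - n)].
Proof.
elim: {n}(size x - n)%N {-2}n (erefl (size x - n)%N) => [|k IH] n en.
  by rewrite en drop_oversize; [|lia].
rewrite (drop_nth 0%N); last by lia.
cbn [sweep iota map].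
set w := landing _ _ _ _ _; have -> : w = left_update st xi (nth 0%N x) n.
  by rewrite /w /landing; case: (st) => [al|be]; case: (n).
have e : (size x - n.+1)%N = k by lia.
by rewrite en /=; congr (_ :: _); rewrite -[in RHS]e -IH.
Qed.

Variable N : nat.

Lemma right_moveE st xi (x : N.-tuple nat) :
  right_move st xi x = sweep RightEdge st xi 0 None x :> seq nat.
Proof.
have := sweep_rightE st xi x 0; rewrite drop0 subn0 size_tuple => ->.
apply: (@eq_from_nth _ 0%N); first by rewrite size_tuple size_map size_iota.
move=> i; rewrite size_tuple => iN; rewrite (nth_map 0%N) ?size_iota // nth_iota //.
by rewrite -[X in nth _ _ X]/(nat_of_ord (Ordinal iN)) -tnth_nth tnth_mktuple.
Qed.

Lemma left_moveE st xi (x : N.-tuple nat) :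
  rev (left_move st xi x) = sweep LeftEdge st xi 0 None (rev x).
Proof.
have := sweep_leftE st xi (rev x) 0; rewrite drop0 subn0 size_rev size_tuple => ->.
apply: (@eq_from_nth _ 0%N); first by rewrite size_rev size_tuple size_map size_iota.
move=> i; rewrite size_rev size_tuple => iN; rewrite nth_rev ?size_tuple //.
have iN' : (N - i.+1 < N)%N by lia.
rewrite (nth_map 0%N) ?size_iota // nth_iota // -[X in nth _ _ X]/(nat_of_ord (Ordinal iN')).
by rewrite -tnth_nth tnth_mktuple /=; congr left_update; lia.
Qed.

Lemma right_chainS (st : nat -> step R) xi s (x : N.-tuple nat) k :
  right_chain st xi s x k.+1 =
  right_chain st xi s.+1 (right_move (st s) (fun n u => xi (s, n, u)) x) k.
Proof. by elim: k => [|k IH]; [rewrite /= addn0|rewrite /= addSnnS -IH]. Qed.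

Lemma left_chainS (st : nat -> step R) xi s (x : N.-tuple nat) k :
  left_chain st xi s x k.+1 =
  left_chain st xi s.+1 (left_move (st s) (fun n u => xi (s, n, u)) x) k.
Proof. by elim: k => [|k IH]; [rewrite /= addn0|rewrite /= addSnnS -IH]. Qed.

Lemma right_chainE (st : nat -> step R) xi s (x : N.-tuple nat) k :
  right_chain st xi s x k = chain RightEdge xi s [seq st i | i <- iota s k] x :> seq nat.
Proof.
elim: k s x => [//|k IH] s x; rewrite right_chainS IH; cbn [iota map chain].
by rewrite right_moveE.
Qed.

Lemma left_chainE (st : nat -> step R) xi s (x : N.-tuple nat) k :
  rev (left_chain st xi s x k) = chain LeftEdge xi s [seq st i | i <- iota s k] (rev x).
Proof.
elim: k s x => [//|k IH] s x; rewrite left_chainS IH; cbn [iota map chain].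
by rewrite left_moveE.
Qed.

End Chains.

(** * Probabilities of the truncated chains *)

Section Noise.
Context d (Omega : measurableType d) (R : realType) (P : probability Omega R).
Variables (a : nat -> R) (st : nat -> step R) (xi : nat * nat * nat -> Omega -> nat).
Hypothesis noise : is_noise P a st xi.
Hypothesis nz : forall k be x, st k = Geometric be -> 1 + be * a x != 0.
Implicit Types (A B : set Omega) (L : set nat).

Definition pr A : R := fine (P A).

Lemma pr0 : pr set0 = 0. Proof. by rewrite /pr measure0. Qed.

Lemma prU A B : measurable A -> measurable B -> (forall w, A w -> B w -> False) ->
  pr (A `|` B) = pr A + pr B.
Proof.
move=> mA mB dAB; rewrite /pr measureU //; last by apply/seteqP; split=> // w [] /dAB.
by rewrite fineD ?fin_num_measure.
Qed.

Lemma pr_union M (D : nat -> set Omega) : (forall c, measurable (D c)) ->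
    (forall c c' w, D c w -> D c' w -> c = c') ->
  measurable [set w | exists2 c, (c < M)%N & D c w] /\
  pr [set w | exists2 c, (c < M)%N & D c w] = \sum_(c < M) pr (D c).
Proof.
move=> mD dD; elim: M => [|M [mU IH]].
  rewrite big_ord0 (_ : [set w | _] = set0) ?pr0; first by split.
  by apply/seteqP; split=> // w [].
have -> : [set w | exists2 c, (c < M.+1)%N & D c w] =
    [set w | exists2 c, (c < M)%N & D c w] `|` D M.
  apply/seteqP; split=> w /=.
    by move=> [c]; rewrite ltnS leq_eqVlt => /orP[/eqP ->|]; [right|left; exists c].
  by move=> [[c cM Dc]|DM]; [exists c => //; exact: ltnW|exists M].
split; first exact: measurableU.
rewrite prU ?IH ?big_ord_recr // => w [c cM Dc] DM.
by have := dD _ _ _ Dc DM; move: cM; lia.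
Qed.

Lemma measurable_noise i L : measurable (xi i @^-1` L).
Proof. by have [h _ _] := noise; rewrite -[X in measurable X]setTI; exact: h. Qed.

Lemma pr_noise k n x m : pr (xi (k, n, x) @^-1` [set m]) = noise_pmf a (st k) x m.
Proof. by have [_ _ h] := noise; rewrite /pr h. Qed.

(** The values 0 and 1 already carry mass 1, so all larger values together have probability 0. *)
Lemma pr_noise_bernoulli k n x al L : st k = Bernoulli al ->
  pr (xi (k, n, x) @^-1` L) =
  (1 - al * a x) * (`[< L 0%N >])%:R + al * a x * (`[< L 1%N >])%:R.
Proof.
move=> stk; pose X := xi (k, n, x).
have p0 : pr (X @^-1` [set 0%N]) = 1 - al * a x by rewrite pr_noise stk.
have p1 : pr (X @^-1` [set 1%N]) = al * a x by rewrite pr_noise stk.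
pose D (S : set nat) := pr (X @^-1` S).
have DU (S S' : set nat) : (forall m, S m -> S' m -> False) -> D (S `|` S') = D S + D S'.
  by move=> h; rewrite /D preimage_setU prU //; try exact: measurable_noise; move=> w; exact: h.
pose Z := [set m : nat | (1 < m)%N].
have pZ : D Z = 0.
  have : D setT = 1 by rewrite /D preimage_setT /pr probability_setT.
  have -> : setT = ([set 0%N] `|` [set 1%N]) `|` Z.
    by apply/seteqP; split=> // -[|[|m]] _ /=; [left; left|left; right|right].
  rewrite !DU; first by rewrite /D p0 p1; lra.
  - by move=> m /= -> .
  - by move=> m /= [] ->.
have Dle (S S' : set nat) : S `<=` S' -> D S <= D S'.
  move=> SS; have -> : S' = S `|` (S' `&` ~` S).
    apply/seteqP; split=> m /=; last by move=> [/SS|[]].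
    by move=> S'm; have [|nS] := pselect (S m); [left|right].
  rewrite DU; last by move=> m Sm [_]; exact.
  by rewrite lerDl /D /pr fine_ge0.
have D0 (S : set nat) : S `<=` Z -> D S = 0.
  by move=> SZ; apply/le_anti; rewrite -{1}pZ Dle //= /D /pr fine_ge0.
have D1 m : D (L `&` [set m]) = (`[< L m >])%:R * D [set m].
  have [Lm|nLm] := pselect (L m).
    rewrite asboolT // mul1r; congr D; apply/seteqP; split=> [x' []//|x' /= ->]; by split.
  rewrite asboolF // mul0r (_ : _ `&` _ = set0); first by rewrite /D preimage_set0 pr0.
  by apply/seteqP; split=> // x' [/= Lx e]; rewrite e in Lx.
transitivity (D (((L `&` [set 0%N]) `|` (L `&` [set 1%N])) `|` (L `&` Z))).
  congr D; apply/seteqP; split=> [[|[|m]] Lm|m [[|]|] []//].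
  - by left; left.
  - by left; right.
  - by right.
rewrite !DU.
- rewrite !D1 [D (L `&` Z)]D0; last by move=> m [].
  by rewrite /D p0 p1; ring.
- by move=> m [_ ->] [].
- by move=> m [[_ ->]|[_ ->]] [].
Qed.

Lemma pr_noise_geometric k n x be c : st k = Geometric be -> (x <= c)%N ->
  pr (xi (k, n, x) @^-1` [set (c - x)%N]) = geo a be x c.
Proof. by move=> stk xc; rewrite pr_noise stk /noise_pmf subnKC // /geo xc. Qed.

(** Point masses are peeled off the total mass 1; each removal turns [reach] at one site into
    [reach] at the next. *)
Lemma pr_noise_tail k n x be j : st k = Geometric be ->
  pr (xi (k, n, x) @^-1` [set m | (j <= m)%N]) = reach a be x (x + j).
Proof.
move=> stk; elim: j => [|j IH].
  rewrite addn0 /reach big_geq // (_ : _ @^-1` _ = setT); last by apply/seteqP; split.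
  by rewrite /pr probability_setT.
have : pr (xi (k, n, x) @^-1` [set m | (j <= m)%N]) =
    pr (xi (k, n, x) @^-1` [set j]) + pr (xi (k, n, x) @^-1` [set m | (j < m)%N]).
  rewrite -prU; try exact: measurable_noise; last by move=> w /= ->; rewrite ltnn.
  congr pr; apply/seteqP; split=> w /=; first by rewrite leq_eqVlt eq_sym => /orP[/eqP|]; [left|right].
  by case=> [->//|/ltnW].
rewrite IH => e; have {e} -> : pr (xi (k, n, x) @^-1` [set m | (j < m)%N]) =
    reach a be x (x + j) - pr (xi (k, n, x) @^-1` [set j]) by rewrite e; ring.
rewrite -{2}(addKn x j) (pr_noise_geometric _ stk) ?leq_addr // /geo leq_addr.
rewrite addnS /reach big_nat_recr ?leq_addr //=.
by have := nz (x + j)%N stk => h; field.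
Qed.

Lemma pr_landing e s n q u c :
  pr (xi (s, n, noise_site e (st s) q u) @^-1` [set m | landing e (st s) q u m = c]) =
  landing_law a e (st s) q u c.
Proof.
case stE : (st s) => [al|be].
  rewrite (pr_noise_bernoulli _ _ _ stE) /=; case: e => /=.
    by congr (_ * _%:R + _ * _%:R); congr nat_of_bool; apply/asboolP/eqP.
  by congr (_ * _%:R + _ * _%:R); congr nat_of_bool; apply/asboolP/eqP.
have empty (k : nat * nat * nat) (L : set nat) : (forall m, ~ L m) -> pr (xi k @^-1` L) = 0.
  by move=> L0; rewrite (_ : _ @^-1` _ = set0) ?pr0 //; apply/seteqP; split=> // w /L0.
have single x : pr (xi (s, n, x) @^-1` [set m | (x + m)%N = c]) = geo a be x c.
  have [xc|cx] := leqP x c.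
    rewrite -(pr_noise_geometric n stE xc); congr (pr (_ @^-1` _)).
    by apply/seteqP; split=> m /=; rewrite /landing; lia.
  by rewrite geo_below // empty // => m /=; rewrite /landing; lia.
case: e => /=; first exact: single.
case: q => [p|] /=; last exact: single.
rewrite /geo_stop; case: ltnP => [cp|pc].
  by rewrite -single; congr (pr (_ @^-1` _)); apply/seteqP; split=> m /=; rewrite /landing; lia.
case: eqP => [->|cp]; last by rewrite empty // => m /=; rewrite /landing; lia.
have [up|pu] := leqP u p.
  rewrite -[in RHS](subnKC up) -(pr_noise_tail n u _ stE); congr (pr (_ @^-1` _)).
  by apply/seteqP; split=> m /=; rewrite /landing; lia.
rewrite /reach big_geq; last by lia.
rewrite (_ : _ @^-1` _ = setT); first by rewrite /pr probability_setT.
by apply/seteqP; split=> // w _ /=; rewrite /landing; lia.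
Qed.

Implicit Types (J : seq (nat * nat * nat)) (S : nat * nat * nat -> set nat).

Definition joint J S :=
  \bigcap_(i in [set` J]) (xi i @^-1` S i).

Lemma measurable_joint J S : measurable (joint J S).
Proof.
apply: fin_bigcap_measurable => [|i _]; last exact: measurable_noise.
exact: finite_seq.
Qed.

Lemma pr_joint J S : uniq J -> pr (joint J S) = \prod_(i <- J) pr (xi i @^-1` S i).
Proof. by have [_ h _] := noise; exact: h. Qed.

Variables (e : edge) (M : nat) (v : seq nat).
Local Notation sts s k := [seq st i | i <- iota s k].
Local Notation "xi @@ w" := (fun i => xi i w) (at level 10).

(** Which noise variable a particle uses depends on where its predecessors landed. Once those sites
    are prescribed the index is fixed and new, and the independence formula applies. The induction
    therefore carries an arbitrary event on a list [J] of variables already used. *)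
Lemma pr_hits k s l J S : uniq J -> (forall i, i \in J -> (i.1.1 < s)%N) ->
  let B := [set w | hits e M (xi @@ w) v s (sts s k) l] in
  measurable B /\
  pr (joint J S `&` B) = (\prod_(i <- J) pr (xi i @^-1` S i)) * edge_prob a e M v (sts s k) l.
Proof.
elim: k s l J S => [|k IH] s l J S uJ Js B.
  rewrite /B /=; case: (l == v).
    rewrite (_ : [set w | _] = setT); last by apply/seteqP; split.
    by split=> //; rewrite setIT mulr1 pr_joint.
  rewrite (_ : [set w | _] = set0); last by apply/seteqP; split.
  by split=> //; rewrite setI0 mulr0 pr0.
pose swp w n q l := sweep e (st s) (fun n u => xi (s, n, u) w) n q l.
(* Within one step the particles are treated in turn: [pre] holds the sites already chosen, and the
   indices in [J'] belong to earlier steps or earlier particles. *)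
suff inner l' pre q n J' S' : uniq J' ->
    (forall i, i \in J' -> (i.1.1 < s)%N \/ i.1.1 = s /\ (i.1.2 < n)%N) ->
  let B' := [set w | all (ltn^~ M) (swp w n q l') &&
       hits e M (xi @@ w) v s.+1 (sts s.+1 k) (pre ++ swp w n q l')] in
  measurable B' /\ pr (joint J' S' `&` B') = (\prod_(i <- J') pr (xi i @^-1` S' i)) *
     sweep_mean a e (st s) M q l' (fun l => edge_prob a e M v (sts s.+1 k) (pre ++ l)).
  exact: (inner l [::] None 0%N J S uJ (fun i h => or_introl (Js i h))).
elim: l' pre q n J' S' {l J S uJ Js B} => [|u l IHl] pre q n J S uJ Js B.
  have Js' i : i \in J -> (i.1.1 < s.+1)%N by move=> /Js; lia.
  exact: (IH s.+1 (pre ++ [::]) J S uJ Js').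
pose i0 := (s, n, noise_site e (st s) q u).
have i0J : i0 \notin J by apply/negP => /Js /=; lia.
pose L c := [set m | landing e (st s) q u m = c].
(* Landing at [c] joins the recorded event as a condition on the one new variable [i0]. *)
pose S' c i := if i == i0 then L c else S i.
pose B' c := [set w | all (ltn^~ M) (swp w n.+1 (barrier e (st s) u c) l) &&
       hits e M (xi @@ w) v s.+1 (sts s.+1 k) (rcons pre c ++ swp w n.+1 (barrier e (st s) u c) l)].
have uJ' : uniq (i0 :: J) by rewrite /= i0J.
have J's i : i \in i0 :: J -> (i.1.1 < s)%N \/ i.1.1 = s /\ (i.1.2 < n.+1)%N.
  rewrite inE => /orP[/eqP ->|/Js [h|[h1 h2]]]; [by right|by left|].
  by right; split=> //; exact: ltnW.
have step c S1 := IHl (rcons pre c) (barrier e (st s) u c) n.+1 (i0 :: J) S1 uJ' J's.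
pose c0 w := landing e (st s) q u (xi i0 w).
have Bw w : B w = ((c0 w < M)%N && all (ltn^~ M) (swp w n.+1 (barrier e (st s) u (c0 w)) l)) &&
    hits e M (xi @@ w) v s.+1 (sts s.+1 k)
      (rcons pre (c0 w) ++ swp w n.+1 (barrier e (st s) u (c0 w)) l) :> Prop.
  by rewrite cat_rcons.
have BE : B = [set w | exists2 c, (c < M)%N & (xi i0 @^-1` L c `&` B' c) w].
  apply/seteqP; split=> w; rewrite Bw.
    by move=> /andP[/andP[cM al] hi]; exists (c0 w) => //; split=> //; apply/andP.
  by move=> [c cM [Lc /andP[al hi]]]; rewrite /c0 Lc cM al.
have mD c : measurable (xi i0 @^-1` L c `&` B' c).
  by apply: measurableI; [exact: measurable_noise|exact: (step c S).1].
have dD c c' w : (xi i0 @^-1` L c `&` B' c) w -> (xi i0 @^-1` L c' `&` B' c') w -> c = c'.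
  by move=> [/= <- _] [/= <- _].
split; first by rewrite BE; exact: (pr_union M mD dD).1.
have JE c : joint J S `&` (xi i0 @^-1` L c `&` B' c) = joint (i0 :: J) (S' c) `&` B' c.
  rewrite setIA; congr (_ `&` _); apply/seteqP; split=> w.
    move=> [Jw Lw] i /=; rewrite inE /S'; case: eqP => [->//|_ /= iJ]; exact: Jw.
  move=> Jw; split.
    move=> i iJ; have := Jw i; rewrite /= inE iJ orbT /S' => /(_ isT).
    by case: eqP => // ii0; case/negP: i0J; rewrite -ii0.
  by have := Jw i0; rewrite /= mem_head /S' eqxx; exact.
have -> : joint J S `&` B = [set w | exists2 c, (c < M)%N & (joint (i0 :: J) (S' c) `&` B' c) w].
  rewrite BE; apply/seteqP; split=> w.
    by move=> [Jw [c cM D]]; exists c => //; rewrite -JE.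
  by move=> [c cM]; rewrite -JE => -[Jw D]; split=> //; exists c.
have [|c c' w|_ ->] := @pr_union M (fun c => joint (i0 :: J) (S' c) `&` B' c).
- by move=> c; apply: measurableI; [exact: measurable_joint|exact: (step c S).1].
- by rewrite -!JE => -[_ D] [_ D']; exact: dD D D'.
rewrite /= mulr_sumr; apply: eq_bigr => c _.
rewrite (step c (S' c)).2 big_cons {1}/S' eqxx pr_landing.
rewrite (_ : \prod_(j <- J) _ = \prod_(i <- J) pr (xi i @^-1` S i)); last first.
  apply: eq_big_seq => i iJ; rewrite /S'; case: eqP => // ii0.
  by move: iJ; rewrite ii0 (negPf i0J).
rewrite -mulrA mulrCA; congr (_ * (_ * _)); congr sweep_mean.
by apply: funext => k'; rewrite cat_rcons.
Qed.

Lemma pr_hits0 k s l :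
  pr [set w | hits e M (xi @@ w) v s (sts s k) l] = edge_prob a e M v (sts s k) l.
Proof.
have [//|_] := @pr_hits k s l [::] (fun=> setT) isT.
by rewrite big_nil mul1r /joint set_nil bigcap_set0 setTI.
Qed.

End Noise.

Section DiscreteEdges.
Context d (Omega : measurableType d) (R : realType) (P : probability Omega R).
Variables (a : nat -> R) (st : nat -> step R) (xi : nat * nat * nat -> Omega -> nat).
Hypothesis noise : is_noise P a st xi.
Hypothesis nz : forall k be x, st k = Geometric be -> 1 + be * a x != 0.
Variables (N M s t : nat).

Lemma E_right_discreteE (x v : N.-tuple nat) : all (ltn^~ M) v ->
  E_right_discrete P st xi s t x v =
  edge_prob a RightEdge M v [seq st i | i <- index_iota s t] x.
Proof.
move=> vM; rewrite -(pr_hits0 noise nz); congr (fine (P _)).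
apply/seteqP; split=> w /=; rewrite hits_right // -right_chainE => h.
  by rewrite h.
by apply/val_inj/eqP.
Qed.

Lemma E_left_discreteE (x v : N.-tuple nat) : all (ltn^~ M) v -> sorted geq (rev x) ->
  E_left_discrete P st xi s t x v =
  edge_prob a LeftEdge M (rev v) [seq st i | i <- index_iota s t] (rev x).
Proof.
move=> vM sx; rewrite -(pr_hits0 noise nz); congr (fine (P _)).
have rM : all (ltn^~ M) (rev v) by rewrite all_rev.
apply/seteqP; split=> w /=; rewrite hits_left // -left_chainE => h.
  by rewrite h.
by apply/val_inj/(can_inj revK)/eqP.
Qed.

End DiscreteEdges.

(** * Continuous time: approximation of a jump process by Bernoulli steps *)

Section BitsExpansion.
Variables (R : realType) (a : nat -> R) (b h : R).
Hypothesis a0 : forall u, 0 <= a u.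
Hypothesis ab : forall u, a u <= b.
Hypothesis h0 : 0 <= h.
Hypothesis hb : h * b <= 1.
Implicit Types (F : seq bool -> R) (l : seq nat).

Let b0 : 0 <= b. Proof. exact: le_trans (ab 0%N). Qed.

Let ha0 u : 0 <= h * a u. Proof. exact: mulr_ge0. Qed.

Let hab u : h * a u <= h * b. Proof. by rewrite ler_wpM2l. Qed.

Let ha1 u : 0 <= 1 - h * a u. Proof. by rewrite subr_ge0 (le_trans (hab u)). Qed.

Definition no_bit m : seq bool := nseq m false.

Definition one_bit n m : seq bool := nseq n false ++ true :: nseq (m - n.+1) false.

Lemma bits_mean_lin l c d F G :
  bits_mean a h l (fun s => c * F s + d * G s) =
  c * bits_mean a h l F + d * bits_mean a h l G.
Proof. by elim: l F G => //= u l IH F G; rewrite !IH; ring. Qed.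

Lemma bits_mean_cst l c : bits_mean a h l (fun=> c) = c.
Proof. by elim: l => //= u l ->; ring. Qed.

Lemma bits_mean_ge0 l F : (forall s, size s = size l -> 0 <= F s) -> 0 <= bits_mean a h l F.
Proof.
elim: l F => [|u l IH] F F0 /=; first exact: F0.
by rewrite addr_ge0 // mulr_ge0 //; apply: IH => s sl; apply: F0; rewrite /= sl.
Qed.

(** Some bit is set with probability at most [h b] times the number of bits, and only then does [D]
    matter. *)
Lemma bits_mean_jump l F D : 0 <= D ->
    (forall s, size s = size l -> s != no_bit (size l) -> `|F s| <= D) ->
  `|bits_mean a h l F| <= `|F (no_bit (size l))| + h * b * (size l)%:R * D.
Proof.
move=> D0; elim: l F => [|u l IH] F FD /=; first by rewrite mulr0 mul0r addr0.
have h1 := IH (fun s => F (false :: s)) (fun s sl ns => FD (false :: s) (f_equal S sl) ns).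
have {}h1 : (1 - h * a u) * `|bits_mean a h l (fun s => F (false :: s))| <=
    `|F (no_bit (size l).+1)| + h * b * (size l)%:R * D.
  apply: le_trans h1; rewrite ler_piMl // gerBl //.
have h2 : `|bits_mean a h l (fun s => F (true :: s))| <= D.
  have : 0 <= bits_mean a h l (fun s => 1 * D + (-1) * F (true :: s)).
    apply: bits_mean_ge0 => s sl; have := FD (true :: s) (f_equal S sl) isT.
    by rewrite ler_norml => /andP[_]; lra.
  have : 0 <= bits_mean a h l (fun s => 1 * D + 1 * F (true :: s)).
    apply: bits_mean_ge0 => s sl; have := FD (true :: s) (f_equal S sl) isT.
    by rewrite ler_norml => /andP[]; lra.
  by rewrite !bits_mean_lin !bits_mean_cst ler_norml => h3 h4; apply/andP; split; lra.
apply: le_trans (ler_normD _ _) _; rewrite !normrM (ger0_norm (ha1 u)) -normrM (ger0_norm (ha0 u)).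
apply: le_trans (lerD h1 (ler_pM (ha0 u) (normr_ge0 _) (hab u) h2)) _.
by rewrite -natr1; lra.
Qed.

(** One more bit adds an error of [h b] times a difference of the kind estimated in
    [bits_mean_jump], hence of second order and linear in the length [m]; the square in the constant
    absorbs it by [m^2 + m <= (m + 1)^2]. *)
Lemma bits_mean_first_order l F D : (forall s, size s = size l -> `|F s| <= D) ->
  `|bits_mean a h l F - (F (no_bit (size l)) +
     h * \sum_(n < size l) a (nth 0%N l n) * (F (one_bit n (size l)) - F (no_bit (size l))))|
  <= 4 * b ^+ 2 * (size l)%:R ^+ 2 * h ^+ 2 * D.
Proof.
elim: l F => [|u l IH] F FD.
  by rewrite big_ord0 mulr0 addr0 subrr normr0 expr0n /= !(mulr0, mul0r).
have D0 : 0 <= D by apply: le_trans (FD (no_bit (size l).+1) _); rewrite ?size_nseq.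
have e1 := IH (fun s => F (false :: s)) (fun s sl => FD (false :: s) (f_equal S sl)).
have jump (c : bool) : `|bits_mean a h l (fun s => F (c :: s)) - F (c :: no_bit (size l))| <=
    h * b * (size l)%:R * (2 * D).
  have j := @bits_mean_jump l (fun s => 1 * F (c :: s) + (-1) * F (c :: no_bit (size l))) (2 * D).
  rewrite bits_mean_lin bits_mean_cst !mul1r !mulN1r subrr normr0 add0r in j; apply: j.
    by rewrite mulr_ge0.
  move=> s sl _; rewrite ?mul1r ?mulN1r; apply: le_trans (ler_normB _ _) _.
  have := FD (c :: s) (f_equal S sl).
  have := FD (c :: no_bit (size l)); rewrite /= size_nseq => /(_ erefl); lra.
have j0 := jump false; have j1 := jump true.
rewrite [size (u :: l)]/= big_ord_recl [bits_mean _ _ _ _]/=.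
rewrite [nth 0%N _ ord0]/= [one_bit ord0 _](_ : _ = true :: no_bit (size l)); last first.
  by rewrite /one_bit /= subSS subn0.
rewrite [no_bit _](_ : _ = false :: no_bit (size l)) //.
move: e1 j0 j1.
rewrite (_ : \sum_(i < size l) a (nth 0%N (u :: l) (lift ord0 i)) * _ =
  \sum_(n < size l) a (nth 0%N l n) *
    (F (false :: one_bit n (size l)) - F (false :: no_bit (size l)))) //.
set Sg := \sum_(n < _) _; set X0 := bits_mean _ _ _ _; set X1 := bits_mean _ _ _ _.
set f0 := F (false :: _); set f1 := F (true :: _); set m := (size l)%:R : R => e1 j0 j1.
have m0 : 0 <= m by rewrite ler0n.
have -> : (1 - h * a u) * X0 + h * a u * X1 - (f0 + h * (a u * (f1 - f0) + Sg)) =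
   (X0 - (f0 + h * Sg)) + (h * a u) * ((X1 - f1) - (X0 - f0)) by ring.
apply: le_trans (ler_normD _ _) _; rewrite normrM (ger0_norm (ha0 u)).
have e2 : `|X1 - f1 - (X0 - f0)| <= h * b * m * (4 * D).
  by apply: le_trans (ler_normB _ _) _; lra.
have e3 := ler_pM (ha0 u) (normr_ge0 _) (hab u) e2.
apply: le_trans (lerD e1 e3) _; rewrite -natr1 -/m.
rewrite -subr_ge0 [X in 0 <= X](_ : _ = 4 * b ^+ 2 * h ^+ 2 * D * (m + 1)); last by ring.
by rewrite mulr_ge0 ?addr_ge0 // !mulr_ge0 // exprn_ge0.
Qed.

End BitsExpansion.

(** * Comparison of a transition function with Bernoulli walks *)

Section TransitionFunction.
Variables (R : realType) (N : nat) (S : set (N.-tuple nat)).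
Variables (rate : 'I_N -> N.-tuple nat -> R) (jump : 'I_N -> N.-tuple nat -> N.-tuple nat).
Variable p : R -> N.-tuple nat -> N.-tuple nat -> R.
Hypothesis tf : is_transition_function S rate jump p.
Hypothesis Sjump : forall n x, S x -> S (jump n x).
Implicit Types (x v w : N.-tuple nat) (J : seq (N.-tuple nat)).

Let p_ge0 t x v : 0 <= t -> S x -> S v -> 0 <= p t x v.
Proof. by have [h _ _ _ _] := tf; exact: h. Qed.

Lemma esum_seq (g : N.-tuple nat -> R) J : uniq J -> (forall w, w \in J -> S w) ->
    (forall w, S w -> 0 <= g w) ->
  (\esum_(w in S) (g w)%:E =
   (\sum_(w <- J) g w)%:E + \esum_(w in S `&` ~` [set` J]) (g w)%:E)%E.
Proof.
move=> uJ JS g0; rewrite (esumID [set` J]); last by move=> w Sw; rewrite lee_fin g0.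
congr (_ + _)%E; rewrite (_ : S `&` [set` J] = [set` J]); last first.
  by apply/seteqP; split=> w; [case|move=> wJ; split=> //; exact: JS].
rewrite esum_fset; last 2 first.
- exact: finite_seq.
- by move=> w wJ; rewrite lee_fin g0 //; apply: JS; rewrite inE in wJ.
by rewrite -fsbig_seq // -sumEFin.
Qed.

Lemma transition_le1 t x v : 0 <= t -> S x -> S v -> p t x v <= 1.
Proof.
move=> t0 Sx Sv; have [_ tot _ _ _] := tf.
have := tot t x t0 Sx; rewrite (@esum_seq _ [:: v]) //; last 2 first.
- by move=> w; rewrite inE => /eqP ->.
- by move=> w Sw; exact: p_ge0.
rewrite big_seq1 => e; rewrite -lee_fin -e leeDl //.
by apply: esum_ge0 => w [Sw _]; rewrite lee_fin p_ge0.
Qed.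

(** The intermediate states outside [J] carry the missing mass, and there [p t w v] lies between 0
    and 1. *)
Lemma chapman_bounds h t x v J : 0 <= h -> 0 <= t -> S x -> S v ->
    uniq J -> (forall w, w \in J -> S w) ->
  \sum_(w <- J) p h x w * p t w v <= p (h + t) x v <=
  \sum_(w <- J) p h x w * p t w v + (1 - \sum_(w <- J) p h x w).
Proof.
move=> h0 t0 Sx Sv uJ JS; have [_ tot _ ck _] := tf.
have := tot h x h0 Sx; rewrite (esum_seq uJ JS); last by move=> w Sw; exact: p_ge0.
set s1 := \sum_(w <- J) _; set E1 := \esum_(w in _) _ => e1.
have := ck h t x v h0 t0 Sx Sv; rewrite (esum_seq uJ JS); last first.
  by move=> w Sw; rewrite mulr_ge0 // p_ge0.
set s2 := \sum_(w <- J) _; set E2 := \esum_(w in _) _ => e2.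
have E20 : (0 <= E2)%E by apply: esum_ge0 => w [Sw _]; rewrite lee_fin mulr_ge0 // p_ge0.
have E21 : (E2 <= E1)%E.
  apply: le_esum => w [Sw _]; rewrite lee_fin ler_piMr ?p_ge0 //.
  exact: transition_le1.
have {}e1 : E1 = (1 - s1)%:E.
  by rewrite EFinB -e1 addeAC subee // add0e.
apply/andP; split; rewrite -lee_fin e2; first by rewrite leeDl.
by rewrite EFinD leeD2l // -e1.
Qed.

Lemma sum_delta_seq J (f : N.-tuple nat -> R) z : uniq J -> z \in J ->
  \sum_(w <- J) (z == w)%:R * f w = f z.
Proof.
move=> uJ zJ; rewrite (bigD1_seq z) //= eqxx mul1r big1 ?addr0 // => w.
by rewrite eq_sym => /negPf ->; rewrite mul0r.
Qed.

Lemma near_seq (T : Type) (I : eqType) (F : set_system T) {FF : Filter F} (r : seq I)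
    (P : I -> T -> Prop) : (forall i, i \in r -> \forall h \near F, P i h) ->
  \forall h \near F, forall i, i \in r -> P i h.
Proof.
elim: r => [|i r IH] Pr; first by near=> h.
have h1 : \forall h \near F, P i h by apply: Pr; rewrite mem_head.
have h2 : \forall h \near F, forall i, i \in r -> P i h.
  by apply: IH => k kr; apply: Pr; rewrite inE kr orbT.
near=> h => k; rewrite inE => /orP[/eqP ->|]; first by near: h.
by move: k; near: h.
Unshelve. all: by end_near. Qed.

(** The derivative at 0 is used on the finite set [J] of [x] and its jump targets, for the functions
    [p t ^~ v] and 1; the latter shows that only mass o(h) leaves [J], and [chapman_bounds]
    concludes. The estimate is uniform in [t] but not in [x]. *)
Lemma transition_first_order x v (eta : R) : S x -> S v -> 0 < eta ->
  exists2 h0 : R, 0 < h0 & forall h t, 0 < h < h0 -> 0 <= t ->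
  `|p (h + t) x v - (p t x v + h * \sum_(n < N) rate n x * (p t (jump n x) v - p t x v))|
  <= eta * h.
Proof.
move=> Sx Sv eta0; have [_ _ _ _ lim] := tf.
pose J := undup (x :: [seq jump n x | n <- enum 'I_N]).
have uJ : uniq J by exact: undup_uniq.
have xJ : x \in J by rewrite mem_undup mem_head.
have jJ n : jump n x \in J.
  by rewrite mem_undup inE map_f ?orbT // mem_enum.
have JS w : w \in J -> S w.
  by rewrite mem_undup inE => /orP[/eqP ->//|/mapP[n _ ->]]; exact: Sjump.
have sJ : 0 < (size J)%:R :> R by rewrite ltr0n; case: (J) xJ.
pose eta' := eta / (2 * (size J)%:R).
have eta'0 : 0 < eta' by rewrite divr_gt0 // mulr_gt0.
pose Q w := jump_generator rate jump x w.
have : \forall h \near (0:R)^'+, forall w, w \in J -> `|Q w - (p h x w - (x == w)%:R) / h| < eta'.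
  apply: near_seq => w wJ; have /cvgrPdist_lt := lim x w Sx (JS w wJ); exact.
move=> /nbhs_ballP[h0 /= h00 H]; exists h0 => // h t /andP[hp hh0] t0.
have {}H w : w \in J -> `|p h x w - ((x == w)%:R + h * Q w)| <= h * eta'.
  move=> wJ; have : ball (0 : R) h0 h by rewrite -ball_normE /= sub0r normrN gtr0_norm.
  move=> /H /(_ hp w wJ) /ltW; rewrite -(ler_pM2l hp) -[X in X * `|_|](gtr0_norm hp) -normrM.
  by rewrite distrC; congr (`|_| <= _); field; rewrite gt_eqF.
have QE (f : N.-tuple nat -> R) : \sum_(w <- J) ((x == w)%:R + h * Q w) * f w =
    f x + h * \sum_(n < N) rate n x * (f (jump n x) - f x).
  transitivity (\sum_(w <- J) (x == w)%:R * f w + \sum_(w <- J) h * (Q w * f w)).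
    by rewrite -big_split; apply: eq_bigr => w _; rewrite mulrDl mulrA.
  rewrite sum_delta_seq // -mulr_sumr; congr (_ + _ * _).
  transitivity (\sum_(w <- J) \sum_(n < N) rate n x * ((jump n x == w)%:R * f w - (x == w)%:R * f w)).
    apply: eq_bigr => w _; rewrite /Q /jump_generator mulr_suml.
    by apply: eq_bigr => n _; ring.
  rewrite exchange_big; apply: eq_bigr => n _; rewrite -mulr_sumr; congr (_ * _).
  by rewrite sumrB !sum_delta_seq.
have sum_bound (f : N.-tuple nat -> R) : (forall w, w \in J -> 0 <= f w <= 1) ->
    `|\sum_(w <- J) p h x w * f w - (f x + h * \sum_(n < N) rate n x * (f (jump n x) - f x))| <=
    h * (eta / 2).
  move=> f01; rewrite -QE -sumrB; apply: le_trans (ler_norm_sum _ _ _) _.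
  have -> : h * (eta / 2) = \sum_(w <- J) h * eta'.
    rewrite big_const_seq iter_addr_0 count_predT -mulr_natr /eta'; field.
    by rewrite gt_eqF.
  rewrite big_seq [leRHS]big_seq; apply: ler_sum => w wJ; rewrite -mulrBl normrM.
  have /andP[f0 f1] := f01 w wJ.
  by rewrite -[leRHS]mulr1 ler_pM ?H // ger0_norm.
have b1 := sum_bound (fun w => p t w v).
have b2 := sum_bound (fun=> 1).
have {b1} b1 : `|\sum_(w <- J) p h x w * p t w v -
   (p t x v + h * \sum_(n < N) rate n x * (p t (jump n x) v - p t x v))| <= h * (eta / 2).
  by apply: b1 => w /JS Sw; rewrite p_ge0 // transition_le1.
have {b2} : `|\sum_(w <- J) p h x w * 1 - (1 + h * \sum_(n < N) rate n x * (1 - 1))| <= h * (eta / 2).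
  by apply: b2 => w _; rewrite ler01 lexx.
rewrite [\sum_(n < N) _]big1; last by move=> n _; rewrite subrr mulr0.
rewrite (eq_bigr (fun w => p h x w)); last by move=> w _; rewrite mulr1.
rewrite mulr0 addr0 => b2.
have /andP[c1 c2] := chapman_bounds (ltW hp) t0 Sx Sv uJ JS.
move: b1 b2; rewrite !ler_norml => /andP[x1 x2] /andP[x3 x4].
by apply/andP; split; lra.
Unshelve. all: by end_near. Qed.

Variables (a : nat -> R) (b : R).
Hypothesis a0 : forall u, 0 <= a u.
Hypothesis ab : forall u, a u <= b.
Variables (sites : N.-tuple nat -> seq nat) (upd : N.-tuple nat -> seq bool -> N.-tuple nat).
Hypothesis size_sites : forall x, size (sites x) = N.
Hypothesis Supd : forall x s, S x -> S (upd x s).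
Hypothesis upd_none : forall x, S x -> upd x (no_bit N) = x.
Hypothesis upd_one : forall x (n : 'I_N), S x -> upd x (one_bit n N) = jump n x.
Hypothesis rateE : forall x (n : 'I_N), S x -> rate n x = a (nth 0%N (sites x) n).

Definition bits_step (h : R) (F : N.-tuple nat -> R) x : R :=
  bits_mean a h (sites x) (fun s => F (upd x s)).

Definition bits_walk h v n : N.-tuple nat -> R :=
  iter n (bits_step h) (fun x => (x == v)%:R).

Let b0 : 0 <= b. Proof. exact: le_trans (ab 0%N). Qed.

Lemma bits_walk01 h v n x : 0 <= h -> h * b <= 1 -> 0 <= bits_walk h v n x <= 1.
Proof.
move=> h0 hb; elim: n x => [|n IH] x.
  by rewrite /bits_walk /=; case: (x == v); rewrite ?lexx ?ler01.
rewrite /bits_walk iterS -/(bits_walk h v n) /bits_step; apply/andP; split.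
  by apply: (bits_mean_ge0 a0 ab h0 hb) => s _; case/andP: (IH (upd x s)).
rewrite -subr_ge0; have : 0 <= bits_mean a h (sites x) (fun s => 1 * 1 + (-1) * bits_walk h v n (upd x s)).
  by apply: (bits_mean_ge0 a0 ab h0 hb) => s _; have /andP[_] := IH (upd x s); lra.
by rewrite bits_mean_lin bits_mean_cst; lra.
Qed.

Lemma small_seq (I : eqType) (r : seq I) (P : I -> R -> Prop) :
    (forall i, i \in r -> exists2 h0 : R, 0 < h0 & forall h, 0 < h < h0 -> P i h) ->
  exists2 h0 : R, 0 < h0 & forall h, 0 < h < h0 -> forall i, i \in r -> P i h.
Proof.
elim: r => [|i r IH] Pr; first by exists 1.
have [h1 h10 H1] := Pr i (mem_head _ _).
have [|h2 h20 H2] := IH; first by move=> k kr; apply: Pr; rewrite inE kr orbT.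
exists (Num.min h1 h2); first by rewrite lt_min h10.
move=> h /andP[h0]; rewrite lt_min => /andP[hh1 hh2] k; rewrite inE => /orP[/eqP ->|].
  by apply: H1; rewrite h0.
by apply: H2; rewrite h0.
Qed.

Lemma small_step h : 0 < h < (b + 1)^-1 -> h * b <= 1.
Proof.
move=> /andP[h0 h1]; have b1 : 0 < b + 1 by rewrite ltr_wpDl.
apply: le_trans (_ : (b + 1)^-1 * b <= 1); first by rewrite ler_wpM2r // ltW.
by rewrite mulrC ler_pdivrMr // mul1r lerDl.
Qed.

(** The bit step and the transition function share their expansion to first order in [h]; [K] is the
    second order constant of [bits_mean_first_order]. *)
Lemma local_error x v (eta : R) : S x -> S v -> 0 < eta ->
  exists2 h0 : R, 0 < h0 & forall h, 0 < h < h0 -> forall t, 0 <= t ->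
    `|bits_step h (p t ^~ v) x - p (h + t) x v| <= eta * h.
Proof.
move=> Sx Sv eta0; have eta2 : 0 < eta / 2 by rewrite divr_gt0.
have [h1 h10 H1] := transition_first_order Sx Sv eta2.
pose K := 4 * b ^+ 2 * N%:R ^+ 2.
have K0 : 0 <= K by rewrite !mulr_ge0 ?exprn_ge0.
have K1 : 0 < K + 1 by rewrite ltr_wpDl.
exists (Num.min h1 (Num.min (b + 1)^-1 (eta / 2 / (K + 1)))).
  by rewrite !lt_min h10 !divr_gt0 ?invr_gt0 ?ltr_wpDl.
move=> h /andP[h0]; rewrite !lt_min => /and3P[hh1 hb hK] t t0.
have {}hb : h * b <= 1 by apply: small_step; rewrite h0.
have := H1 h t; rewrite h0 hh1 => /(_ isT t0) e1.
have F1 s : size s = size (sites x) -> `|p t (upd x s) v| <= 1.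
  by move=> _; rewrite ger0_norm ?transition_le1 ?p_ge0 //; exact: Supd.
have := bits_mean_first_order a0 ab (ltW h0) hb F1.
rewrite size_sites upd_none // mulr1 -/K => e2.
have {}e2 : `|bits_step h (p t ^~ v) x - (p t x v + h * \sum_(n < N) rate n x * (p t (jump n x) v - p t x v))|
    <= eta / 2 * h.
  apply: le_trans (_ : K * h ^+ 2 <= _).
    rewrite /bits_step [X in _ + h * X](eq_bigr (fun n : 'I_N => a (nth 0%N (sites x) n) *
      (p t (upd x (one_bit n N)) v - p t x v))) //.
    by move=> n _; rewrite upd_one // rateE.
  rewrite expr2 mulrA ler_wpM2r ?(ltW h0) //.
  apply: le_trans (_ : (K + 1) * h <= _); first by rewrite ler_wpM2r ?lerDl // ltW.
  by rewrite mulrC -ler_pdivlMr // ltW.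
move: e1 e2; set q := _ + h * _; rewrite !ler_norml => /andP[x1 x2] /andP[x3 x4].
by apply/andP; split; lra.
Qed.

(* Within a bounded time only few bits are set, so that the non-uniformity in
   the starting point of [local_error] is harmless: [k] bounds the number of
   jumps taken into account, and the paths with more jumps contribute the
   first term. *)
Lemma bits_walk_close k v x (T eps : R) : S v -> S x -> 0 <= T -> 0 < eps ->
  exists2 h0 : R, 0 < h0 & forall h, 0 < h < h0 -> forall n, n%:R * h <= T ->
    `|bits_walk h v n x - p (n%:R * h) x v| <=
      2 * (1 + 2 * (b * N%:R) * h) ^+ n / 2 ^+ k + eps.
Proof.
move=> Sv Sx T0; pose C : R := b * N%:R; have C0 : 0 <= C by rewrite mulr_ge0.
have [_ _ p0 _ _] := tf.
elim: k x eps Sx => [|k IH] x eps Sx e0.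
  exists (b + 1)^-1; first by rewrite invr_gt0 ltr_wpDl.
  move=> h hh n nT; have /andP[h0 _] := hh; have hb := small_step hh.
  have /andP[w0 w1] := bits_walk01 v n x (ltW h0) hb.
  have nh0 : 0 <= n%:R * h by rewrite mulr_ge0 // ltW.
  have := p_ge0 nh0 Sx Sv; have := transition_le1 nh0 Sx Sv => p1 p2.
  have : 1 <= (1 + 2 * (b * N%:R) * h) ^+ n.
    by rewrite exprn_ege1 // lerDl mulr_ge0 ?mulr_ge0 // ltW.
  by rewrite expr0 divr1 ler_norml => h1; apply/andP; split; lra.
have T1 : 0 < T + 1 by rewrite ltr_wpDl.
have C1 : 0 < C + 1 by rewrite ltr_wpDl.
(* Chosen so that [(T + 1) ((C + 1) e1 + eta) = eps]. *)
pose e1 := eps / (2 * (T + 1) * (C + 1)); pose eta := eps / (2 * (T + 1)).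
have e10 : 0 < e1 by rewrite divr_gt0 ?mulr_gt0.
have eta0 : 0 < eta by rewrite divr_gt0 ?mulr_gt0.
have [h1 h10 H1] := local_error Sx Sv eta0.
(* One step from [x] leads to at most as many states as there are bit tuples, so a single [h2]
   serves all of them. *)
have [h2 h20 H2] := @small_seq _ (enum {: N.-tuple bool})
  (fun s h => forall n, n%:R * h <= T ->
    `|bits_walk h v n (upd x s) - p (n%:R * h) (upd x s) v| <=
      2 * (1 + 2 * (b * N%:R) * h) ^+ n / 2 ^+ k + e1)
  (fun s _ => IH (upd x s) e1 (Supd s Sx) e10).
exists (Num.min h1 (Num.min h2 (b + 1)^-1)).
  by rewrite !lt_min h10 h20 invr_gt0 ltr_wpDl.
move=> h /andP[h0]; rewrite !lt_min => /and3P[hh1 hh2 hb] n.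
have {}hb : h * b <= 1 by apply: small_step; rewrite h0.
have {}H1 := H1 h; rewrite h0 hh1 in H1; have {}H1 := H1 isT.
have {}H2 := H2 h; rewrite h0 hh2 in H2; have {}H2 := H2 isT.
(* Leaving [x] has probability at most [C h] and lowers [k] by one, which doubles the first term of
   the bound; the rate [2 C] in [A] pays for this. *)
pose A n : R := (1 + 2 * C * h) ^+ n; pose e2 := C * e1 + eta.
have A0 m : 0 <= A m by rewrite exprn_ge0 // addr_ge0 // !mulr_ge0 // ltW.
have k2 : 0 < 2 ^+ k :> R by rewrite exprn_gt0.
suff H : n%:R * h <= T -> `|bits_walk h v n x - p (n%:R * h) x v| <=
    2 * A n / 2 ^+ k.+1 + n%:R * h * e2.
  move=> nT; apply: le_trans (H nT) _; rewrite lerD2l.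
  have e20 : 0 <= e2 by apply: addr_ge0; [apply: mulr_ge0|]; rewrite // ltW.
  apply: le_trans (ler_wpM2r e20 nT) _.
  apply: le_trans (_ : (T + 1) * (((C + 1) * e1) + eta) <= _).
    apply: ler_pM => //; first by rewrite lerDl.
    by rewrite lerD2r ler_wpM2r ?lerDl // ltW.
  rewrite (_ : _ * _ = eps) // /e1 /eta; field.
  by rewrite !gt_eqF.
elim: n => [|n IHn] nT.
  rewrite /bits_walk /= !mul0r p0 // subrr normr0 addr0.
  by apply: divr_ge0; [apply: mulr_ge0|]; rewrite // exprn_ge0.
have nT' : n%:R * h <= T.
  by apply: le_trans nT; rewrite ler_wpM2r ?ler_nat // ltW.
have nh0 : 0 <= n%:R * h by rewrite mulr_ge0 // ltW.
have := IHn nT'; set dn := bits_walk h v n x - _ => e3.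
have tE : n.+1%:R * h = h + n%:R * h by rewrite -natr1; ring.
have -> : bits_walk h v n.+1 x - p (n.+1%:R * h) x v =
   bits_mean a h (sites x) (fun s => 1 * bits_walk h v n (upd x s) + (-1) * p (n%:R * h) (upd x s) v) +
   (bits_step h (p (n%:R * h) ^~ v) x - p (h + n%:R * h) x v).
  rewrite tE bits_mean_lin /bits_walk iterS -/(bits_walk h v n) /bits_step; ring.
apply: le_trans (ler_normD _ _) _.
have e4 := H1 _ nh0.
have D0 : 0 <= 2 * A n / 2 ^+ k + e1.
  by apply: addr_ge0; [apply: divr_ge0; [apply: mulr_ge0|]|]; rewrite // ltW.
have e5 : `|bits_mean a h (sites x) (fun s => 1 * bits_walk h v n (upd x s) +
     (-1) * p (n%:R * h) (upd x s) v)| <= `|dn| + h * b * N%:R * (2 * A n / 2 ^+ k + e1).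
  have := @bits_mean_jump _ a b h a0 ab (ltW h0) hb (sites x) (fun s => 1 * bits_walk h v n (upd x s) +
     (-1) * p (n%:R * h) (upd x s) v) _ D0.
  rewrite size_sites upd_none // mul1r mulN1r -/dn; apply=> s ss _.
  have sN : size s == N by rewrite ss.
  by rewrite mul1r mulN1r; apply: (H2 (Tuple sN)); rewrite // mem_enum.
apply: le_trans (lerD e5 e4) _.
apply: le_trans (lerD (lerD e3 (lexx _)) (lexx _)) _.
rewrite le_eqVlt; apply/orP; left; apply/eqP.
rewrite tE /A (exprS _ n) (exprS _ k) -/(A n) /e2 /C; field.
by rewrite gt_eqF.
Qed.

Lemma bits_mean_zero l F : bits_mean a 0 l F = F (no_bit (size l)).
Proof. by elim: l F => //= u l IH F; rewrite !mul0r subr0 mul1r addr0 IH. Qed.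

Lemma exp_power_bound (c : R) n : 0 <= c -> (1 + c / n.+1%:R) ^+ n.+1 <= expR c.
Proof.
move=> c0; have c1 : 0 <= c / n.+1%:R by rewrite divr_ge0.
rewrite -[X in expR X](divfK (_ : n.+1%:R != 0)) ?pnatr_eq0 // expRM_natr.
by rewrite lerXn2r ?nnegrE ?addr_ge0 ?expR_ge0 ?expR_ge1Dx.
Qed.

Lemma bits_walk_cvg v x (t : R) : S v -> S x -> 0 <= t ->
  (fun n => bits_walk (t / n.+1%:R) v n.+1 x) @ \oo --> p t x v.
Proof.
move=> Sv Sx; rewrite le_eqVlt => /orP[/eqP <-|t0].
  have [_ _ p0 _ _] := tf; rewrite p0 //.
  rewrite (_ : (fun n => _) = fun=> (x == v)%:R); first exact: cvg_cst.
  apply: funext => n; rewrite mul0r; elim: n.+1 => [//|m IH].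
  by rewrite /bits_walk iterS -/(bits_walk 0 v m) /bits_step bits_mean_zero size_sites upd_none.
apply/cvgrPdist_le => e e0; pose E := expR (2 * (b * N%:R) * t).
have E0 : 0 <= E by exact: expR_ge0.
pose k := Num.bound (4 * E / e).
have kP : 2 * E / 2 ^+ k <= e / 2.
  have : 4 * E / e < 2 ^+ k.
    apply: lt_le_trans (archi_boundP _) _; first by rewrite divr_ge0 ?mulr_ge0 // ltW.
    by rewrite -natrX ler_nat ltnW // ltn_expl.
  by rewrite ltr_pdivrMr // ler_pdivrMr ?exprn_gt0 //; lra.
have e2 : 0 < e / 2 by rewrite divr_gt0.
have [h0 h00 H] := bits_walk_close k Sv Sx (ltW t0) e2.
near=> n.
have nh : t / n.+1%:R < h0.
  rewrite ltr_pdivrMr // mulrC -ltr_pdivrMr //.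
  apply: lt_le_trans (_ : n%:R <= _); last by rewrite ler_nat.
  by near: n; exact: nbhs_infty_gtr.
have := H (t / n.+1%:R); rewrite nh divr_gt0 // => /(_ isT n.+1).
rewrite mulrC divfK ?pnatr_eq0 // => /(_ (lexx _)); rewrite distrC => h1.
apply: le_trans h1 _; rewrite -[leRHS](_ : e / 2 + e / 2 = e); last by field.
rewrite lerD2r; apply: le_trans kP; rewrite ler_pM2r ?invr_gt0 ?exprn_gt0 //.
rewrite ler_pM2l // mulrA; apply: exp_power_bound.
by rewrite !mulr_ge0 // ltW.
Unshelve. all: by end_near. Qed.

End TransitionFunction.

(** * Continuous time: the exponential as a limit of Bernoulli steps *)

Section ExponentialLimit.
Variable R : realType.
Local Notation C := (complex R).
Local Notation Re := complex.Re.
Local Notation Im := complex.Im.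
Implicit Types (z w : C) (p q rho : R).

(** The l1 norm of the plane, submultiplicative like the modulus and free of square roots. *)
Definition cabs z : R := `|Re z| + `|Im z|.

Lemma cabs_ge0 z : 0 <= cabs z. Proof. exact: addr_ge0. Qed.

Lemma cabsD z w : cabs (z + w) <= cabs z + cabs w.
Proof.
rewrite /cabs cReD cImD addrACA; apply: lerD; exact: ler_normD.
Qed.

Lemma cabsM z w : cabs (z * w) <= cabs z * cabs w.
Proof.
rewrite /cabs cReM cImM.
apply: le_trans (lerD (ler_normB _ _) (ler_normD _ _)) _; rewrite !normrM.
rewrite le_eqVlt; apply/orP; left; apply/eqP; ring.
Qed.

Lemma cabs_real (r : R) : cabs r%:C = `|r|.
Proof. by rewrite /cabs /= normr0 addr0. Qed.

Lemma cexpD z w : cexp (z + w) = cexp z * cexp w.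
Proof.
apply: eq_ReIm; rewrite ?cReM ?cImM /= cReD cImD expRD.
  by rewrite cosD; ring.
by rewrite sinD; ring.
Qed.

Lemma cexpX z n : cexp z ^+ n = cexp (n%:R * z).
Proof.
elim: n => [|n IH].
  by rewrite expr0 mul0r /cexp /= expR0 cos0 sin0 mulr1 mulr0.
by rewrite exprS IH -cexpD -natr1 mulrDl mul1r addrC.
Qed.

Lemma cabs_cexp z : cabs (cexp z) <= 2 * expR (Re z).
Proof.
rewrite /cabs /cexp /= !normrM (ger0_norm (expR_ge0 _)) -mulrDr mulrC ler_wpM2r ?expR_ge0 //.
by rewrite [leRHS](_ : _ = 1 + 1) // lerD // ler_norml ?cos_geN1 ?cos_le1 ?sin_geN1 ?sin_le1.
Qed.

Lemma sin_lip q : 0 <= q -> `|sin q| <= q.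
Proof.
move=> q0; have cs : {within `[0, q], continuous (@sin R)}.
  by apply: continuous_subspaceT => x; exact: continuous_sin.
have [c _] := MVT_segment q0 (fun x _ => is_derive_sin x) cs.
rewrite sin0 !subr0 => ->; rewrite normrM (ger0_norm q0) ler_piMl // ler_norml.
by rewrite cos_geN1 cos_le1.
Qed.

Lemma cos_lip q : 0 <= q -> `|cos q - 1| <= q ^+ 2.
Proof.
move=> q0; have cs : {within `[0, q], continuous (@cos R)}.
  by apply: continuous_subspaceT => x; exact: continuous_cos.
have [c + ] := MVT_segment q0 (fun x _ => is_derive_cos x) cs.
rewrite in_itv /= cos0 subr0 => /andP[c0 cq] ->.
rewrite normrM normrN (ger0_norm q0) expr2 ler_wpM2r //.
exact: le_trans (sin_lip c0) cq.
Qed.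

Lemma sin_quadratic q : 0 <= q <= 1 -> `|sin q - q| <= q ^+ 2.
Proof.
move=> /andP[q0 q1]; have cs : {within `[0, q], continuous (fun x : R => sin x - x)}.
  apply: continuous_subspaceT => x; apply: continuousB; last exact: cvg_id.
  exact: continuous_sin.
have ds (x : R) : x \in `]0, q[ -> is_derive x 1 (fun x : R => sin x - x) (cos x - 1).
  by move=> _; apply: is_deriveB.
have [c + ] := MVT_segment q0 ds cs.
rewrite in_itv /= sin0 !subr0 => /andP[c0 cq] ->.
rewrite normrM (ger0_norm q0) expr2 ler_wpM2r //.
apply: le_trans (cos_lip c0) _; apply: le_trans (_ : c * 1 <= _); last by rewrite mulr1.
by rewrite expr2 ler_wpM2l // (le_trans cq).
Qed.

Lemma trig_quadratic q : `|q| <= 1 -> `|cos q - 1| <= q ^+ 2 /\ `|sin q - q| <= q ^+ 2.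
Proof.
case: (leP 0 q) => [q0|q0].
  by rewrite (ger0_norm q0) => q1; split; [exact: cos_lip|apply: sin_quadratic; rewrite q0].
have q0' : 0 <= - q by rewrite oppr_ge0 ltW.
rewrite (ltr0_norm q0) => q1.
have := cos_lip q0'; have := @sin_quadratic (- q).
rewrite q0' q1 sinN cosN sqrrN -opprD normrN => /(_ isT) h1 h2.
by split.
Qed.

Lemma expR_quadratic p : `|p| <= 2^-1 -> 0 <= expR p - 1 - p <= 2 * p ^+ 2.
Proof.
rewrite ler_norml => /andP[p1 p2]; have h1 := expR_ge1Dx p.
have h2 := expR_ge1Dx (- p); have e0 := expR_gt0 p.
apply/andP; split; first lra.
have h3 : expR p * (1 - p) <= 1.
  rewrite [leRHS](_ : 1 = expR p * expR (- p)); last by rewrite -expRD subrr expR0.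
  by rewrite ler_pM2l.
have h4 : (expR p - 1 - p) * (1 - p) <= p ^+ 2 by rewrite expr2; lra.
have h5 : 0 < 1 - p by lra.
have h6 : 0 <= p ^+ 2 by exact: sqr_ge0.
have h7 : expR p - 1 - p <= p ^+ 2 / (1 - p) by rewrite ler_pdivlMr.
apply: le_trans h7 _; rewrite ler_pdivrMr //; nra.
Qed.

Lemma cexp_quadratic z rho : cabs z <= rho -> rho <= 2^-1 ->
  cabs (1 + z - cexp z) <= 8 * rho ^+ 2.
Proof.
case: z => p q; rewrite /cabs /= => zr r2.
have p0 := normr_ge0 p; have q0 := normr_ge0 q.
have pr : `|p| <= rho by lra.
have qr : `|q| <= rho by lra.
have r0 : 0 <= rho by lra.
have [|c1 s1] := @trig_quadratic q; first by lra.
have /andP[e1 e2] : 0 <= expR p - 1 - p <= 2 * p ^+ 2 by apply: expR_quadratic; lra.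
have sq (x : R) : `|x| <= rho -> 0 <= x ^+ 2 <= rho ^+ 2.
  by move=> xr; rewrite sqr_ge0 -[x ^+ 2]ger0_norm ?sqr_ge0 // normrX lerXn2r ?nnegrE.
have /andP[pp0 pp] := sq p pr; have /andP[qq0 qq] := sq q qr.
have hr : rho ^+ 2 <= 2^-1 * rho by rewrite expr2 ler_wpM2r.
have E0 := expR_gt0 p; have E2 : expR p <= 2.
  by move: pr; rewrite ler_norml => /andP[_]; lra.
have EC : `|expR p * (cos q - 1)| <= 2 * rho ^+ 2.
  by rewrite normrM (gtr0_norm E0); apply: ler_pM; rewrite ?(ltW E0) //; exact: le_trans c1 qq.
have ES : `|expR p * (sin q - q)| <= 2 * rho ^+ 2.
  by rewrite normrM (gtr0_norm E0); apply: ler_pM; rewrite ?(ltW E0) //; exact: le_trans s1 qq.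
have EQ : `|(expR p - 1) * q| <= 2 * rho ^+ 2.
  rewrite normrM [rho ^+ 2]expr2 mulrA ler_pM //.
  rewrite ler_norml; move: pr; rewrite ler_norml => /andP[pr1 pr2].
  by apply/andP; split; lra.
have -> : 1 + p - expR p * cos q = - (expR p - 1 - p) - expR p * (cos q - 1) by ring.
have -> : 0 + q - expR p * sin q = - (expR p * (sin q - q)) - (expR p - 1) * q by ring.
have h1 := ler_normB (- (expR p - 1 - p)) (expR p * (cos q - 1)).
have h2 := ler_normB (- (expR p * (sin q - q))) ((expR p - 1) * q).
rewrite normrN (ger0_norm e1) in h1; rewrite normrN in h2.
lra.
Qed.

(** Telescoping of the two powers: each factor [1 + z] costs at most [expR rho], and the powers of
    [cexp z] are bounded likewise up to the 2 of [cabs_cexp]. *)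
Lemma power_exp_diff z rho n : cabs z <= rho -> rho <= 2^-1 ->
  cabs ((1 + z) ^+ n - cexp z ^+ n) <= 2 * n%:R * expR (n%:R * rho) * (8 * rho ^+ 2).
Proof.
move=> zr r2; have d := cexp_quadratic zr r2; have r0 : 0 <= rho := le_trans (cabs_ge0 z) zr.
have D0 : 0 <= 8 * rho ^+ 2 by rewrite mulr_ge0 ?exprn_ge0.
elim: n => [|n IH].
  by rewrite !expr0 subrr /cabs /= normr0 addr0 !mulr0 !mul0r.
have -> : (1 + z) ^+ n.+1 - cexp z ^+ n.+1 =
    (1 + z) * ((1 + z) ^+ n - cexp z ^+ n) + (1 + z - cexp z) * cexp z ^+ n.
  by rewrite !exprS; ring.
apply: le_trans (cabsD _ _) _.
have u1 : cabs (1 + z) <= expR rho.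
  apply: le_trans (expR_ge1Dx rho); apply: le_trans (cabsD _ _) _.
  by rewrite lerD // -[X in cabs X]/(1%:C) cabs_real normr1.
have v1 : cabs (cexp z ^+ n) <= 2 * expR (n%:R * rho).
  rewrite cexpX; apply: le_trans (cabs_cexp _) _; rewrite ler_pM2l // ler_expR.
  have -> : Re (n%:R * z) = n%:R * Re z.
    by rewrite -ReZ; congr (complex.Re (_ * _)); rewrite rmorph_nat.
  rewrite ler_wpM2l //; apply: le_trans (ler_norm _) _; apply: le_trans zr.
  by rewrite lerDl.
have h1 := le_trans (cabsM _ _) (ler_pM (cabs_ge0 _) (cabs_ge0 _) u1 IH).
have h2 := le_trans (cabsM _ _) (ler_pM (cabs_ge0 _) (cabs_ge0 _) d v1).
apply: le_trans (lerD h1 h2) _.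
have e1 : expR (n.+1%:R * rho) = expR rho * expR (n%:R * rho).
  by rewrite -expRD -natr1; congr expR; ring.
have e2 : 1 <= expR rho by rewrite -expR0 ler_expR.
have e3 : expR (n%:R * rho) <= expR (n.+1%:R * rho).
  by rewrite e1 ler_peMl ?expR_ge0.
rewrite [leLHS](_ : _ = 2 * n%:R * expR (n.+1%:R * rho) * (8 * rho ^+ 2) +
   2 * expR (n%:R * rho) * (8 * rho ^+ 2)); last by rewrite e1; ring.
rewrite [leRHS](_ : _ = 2 * n%:R * expR (n.+1%:R * rho) * (8 * rho ^+ 2) +
   2 * expR (n.+1%:R * rho) * (8 * rho ^+ 2)); last by rewrite -[in LHS]natr1; ring.
by rewrite lerD2l ler_wpM2r // ler_pM2l.
Qed.

Lemma compound_limit (B e : R) : 0 < e -> exists m0 : nat, forall m z, (m0 <= m)%N ->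
  cabs z <= B -> cabs ((1 + (m.+1%:R^-1)%:C * z) ^+ m.+1 - cexp z) <= e.
Proof.
move=> e0; pose B1 := Num.max B 1; have B10 : 0 < B1 by rewrite lt_max ltr01 orbT.
(* For exponent [n] and [rho = B1 / n] the bound of [power_exp_diff] equals [K / n]; the term
   [2 * B1] in [k] ensures [rho <= 1/2]. *)
pose K := 16 * expR B1 * B1 ^+ 2; have K0 : 0 < K by rewrite !mulr_gt0 ?expR_gt0 ?exprn_gt0.
pose k := Num.bound (2 * B1 + K / e).
have kP : 2 * B1 + K / e < k%:R.
  by apply: archi_boundP; rewrite addr_ge0 ?divr_ge0 ?mulr_ge0 // ltW.
exists k => m z km zB.
have m0 : 0 < m.+1%:R :> R by rewrite ltr0n.
have mK : 2 * B1 + K / e < m.+1%:R.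
  by apply: lt_le_trans kP _; rewrite ler_nat ltnW.
have Ke : 0 < K / e by rewrite divr_gt0.
have hz : cabs ((m.+1%:R^-1)%:C * z) <= B1 / m.+1%:R.
  apply: le_trans (cabsM _ _) _; rewrite cabs_real ger0_norm ?invr_ge0 // mulrC.
  by rewrite ler_wpM2r ?invr_ge0 // le_max zB.
have hr : B1 / m.+1%:R <= 2^-1 by rewrite ler_pdivrMr //; lra.
have := power_exp_diff m.+1 hz hr.
rewrite cexpX (_ : _%:R * (_ * z) = z); last first.
  rewrite mulrA -(rmorph_nat (real_complex R)) -rmorphM mulfV ?pnatr_eq0 //.
  by rewrite rmorph1 mul1r.
move=> h; apply: le_trans h _.
rewrite (_ : m.+1%:R * (B1 / m.+1%:R) = B1); last by field; rewrite gt_eqF.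
rewrite (_ : _ * _ = K / m.+1%:R); last by rewrite /K; field; rewrite gt_eqF.
rewrite ler_pdivrMr // mulrC -ler_pdivrMr //.
by apply: ltW; apply: le_lt_trans mK; rewrite lerDr mulr_ge0 // ltW.
Qed.

Lemma ccont_cexp (u : R -> C) : ccont u -> ccont (fun t => cexp (u t)).
Proof.
move=> cu t t01; have [u1 u2] := cu t t01.
have ce : continuous_at t (fun s => expR (Re (u s))).
  exact: (continuous_comp u1 (@continuous_expR R _)).
have cc : continuous_at t (fun s => cos (Im (u s))).
  exact: (continuous_comp u2 (@continuous_cos R _)).
have cs : continuous_at t (fun s => sin (Im (u s))).
  exact: (continuous_comp u2 (@continuous_sin R _)).
by split; [exact: (continuousM ce cc)|exact: (continuousM ce cs)].
Qed.

Lemma ccont_bounded (u : R -> C) : ccont u ->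
  exists K, forall t, 0 <= t <= 1 -> cabs (u t) <= K.
Proof.
move=> cu; have cw (f : R -> R) : (forall t : R, 0 <= t <= 1 -> continuous_at t f) ->
    exists K, forall t : R, 0 <= t <= 1 -> `|f t| <= K.
  move=> cf; have c2 : {within `[0, 1], continuous (fun t => `|f t|)}.
    apply: continuous_in_subspaceT => t /set_mem; rewrite /= in_itv /= => t01.
    exact: (continuous_comp (cf t t01) (@norm_continuous _ _ _)).
  have [c _ hc] := EVT_max ler01 c2; exists `|f c| => t t01.
  by apply: hc; rewrite in_itv.
have [K1 h1] := cw (fun t => Re (u t)) (fun t h => (cu t h).1).
have [K2 h2] := cw (fun t => Im (u t)) (fun t h => (cu t h).2).
by exists (K1 + K2) => t t01; rewrite lerD ?h1 ?h2.
Qed.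

Lemma cint_bound (u : R -> C) K : ccont u -> (forall t, 0 <= t <= 1 -> cabs (u t) <= K) ->
  cabs (cint u) <= K + K.
Proof.
move=> cu uK; have B (f : R -> R) : (forall t : R, 0 <= t <= 1 -> continuous_at t f) ->
    (forall t : R, 0 <= t <= 1 -> `|f t| <= K) ->
    `|\int[lebesgue_measure]_(t in `[0, 1]) f t| <= K.
  move=> cf fK; have m01 : measurable (`[0, 1]%classic : set R) by [].
  apply: le_trans (le_normr_Rintegral _ (integrable01 cf)) _ => //.
  have cst c : \int[lebesgue_measure]_(t in `[0, 1]) (fun=> c : R) t = c.
    rewrite Rintegral_cst // -[RHS]mulr1; congr (_ * _).
    transitivity (fine (lebesgue_measure (`[0, 1]%classic : set R))) => //.
    by rewrite lebesgue_measure_itv /= lte_fin ltr01 -EFinD subr0.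
  rewrite -[leRHS]cst; apply: le_Rintegral => //.
  - apply: integrable01 => t t01; exact: (continuous_comp (cf t t01) (@norm_continuous _ _ _)).
  - by apply: integrable01 => t _; exact: cst_continuous.
rewrite /cabs /cint /=; apply: lerD; apply: B.
- by move=> t /cu[].
- by move=> t /uK; apply: le_trans; rewrite lerDl.
- by move=> t /cu[].
- by move=> t /uK; apply: le_trans; rewrite lerDr.
Qed.

End ExponentialLimit.

(** * The kernel of the exponential *)

Section ExponentialKernel.
Variables (R : realType) (gamma : R -> complex R).
Hypothesis gcc : closed_curve gamma.
Local Notation C := (complex R).
Local Notation Re := complex.Re.
Local Notation Im := complex.Im.
Local Notation I := (contour_integral gamma).
Variable a : nat -> R.
Hypothesis a0 : forall x, 0 < a x.
Hypothesis enc : forall x, encircles gamma (a x)%:C.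

Definition bernoulli_steps (t : R) n := nseq n.+1 (Bernoulli (t / n.+1%:R)).

Lemma steps_fun_nseq (h : R) n w : steps_fun (nseq n (Bernoulli h)) w = (1 - h%:C * w) ^+ n.
Proof.
elim: n => [|n IH]; first by rewrite steps_fun_nil expr0.
by rewrite [nseq _ _]/= steps_fun_cons IH exprS.
Qed.

Lemma bernoulli_stepsE t n w :
  steps_fun (bernoulli_steps t n) w = (1 + (n.+1%:R^-1)%:C * ((- t)%:C * w)) ^+ n.+1.
Proof.
rewrite steps_fun_nseq; congr (_ ^+ _); congr (_ + _).
by rewrite rmorphM rmorphN /=; ring.
Qed.

Lemma all_pole_free_bernoulli h n : all_pole_free gamma (nseq n (Bernoulli h)).
Proof. by elim: n => [|n IH] s //= [<-//|]; exact: IH. Qed.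

Lemma bernoulli_steps_pole_free t n : all_pole_free gamma (bernoulli_steps t n).
Proof. exact: all_pole_free_bernoulli. Qed.

(** The curve is bounded on the unit interval, so the convergence of compound powers to the
    exponential is uniform along it and passes through the integral. *)
Lemma Tf_exp_limit t x y :
  (fun n => Tf a gamma (steps_fun (bernoulli_steps t n)) x y) @ \oo -->
  Tf a gamma (fun w => cexp ((- t)%:C * w)) x y.
Proof.
have cu : ccont (fun s => (- t)%:C * gamma s) by apply: ccontM (ccont_cst _) (ccont_gamma gcc).
have ce : on_curve gamma (fun w => cexp ((- t)%:C * w)) := ccont_cexp cu.
have cn n : on_curve gamma (steps_fun (bernoulli_steps t n)).
  exact: (on_curve_steps gcc (@bernoulli_steps_pole_free t n)).
have [B hB] := ccont_bounded cu.
pose G w := charpol a x w / charpol a y.+1 w.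
have cG : ccont (fun s => G (gamma s) * velocity gamma s).
  have h := on_curve_ratio gcc a0 enc x y.+1 (ccont_cst 1 : on_curve gamma (fun=> 1)).
  have h1 : on_curve gamma G.
    by move: h; congr (ccont _); apply/funext => s; rewrite mulr1.
  exact: ccontM h1 (ccont_velocity gcc).
have [K hK] := ccont_bounded cG.
have K0 : 0 <= K by apply: le_trans (hK 0 _); rewrite ?cabs_ge0 // lexx ler01.
set q := - (two_pi_i R)^-1 * ((a y)%:C)^-1.
have q0 := cabs_ge0 q.
apply/cvgrPdist_le => e e0.
pose d := e / (2 * (cabs q + 1) * (K + 1)).
have c1 : 0 < cabs q + 1 by rewrite ltr_wpDl.
have c2 : 0 < K + 1 by rewrite ltr_wpDl.
have d0 : 0 < d by rewrite divr_gt0 ?mulr_gt0.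
have [m0 hm] := compound_limit B d0.
near=> n; rewrite !TfE -cReN -cReD /Tc -/q.
have nm : (m0 <= n)%N by near: n; exact: nbhs_infty_ge.
have -> : q * I (fun w => G w * cexp ((- t)%:C * w)) - q * I (fun w => G w * steps_fun (bernoulli_steps t n) w) =
    q * (1 * I (fun w => G w * cexp ((- t)%:C * w)) + (-1) * I (fun w => G w * steps_fun (bernoulli_steps t n) w)).
  by rewrite mulrDr mul1r mulN1r mulrN.
rewrite -contour_lin //; [|exact: on_curve_ratio..].
rewrite (eq_contour (G := fun w => G w * (cexp ((- t)%:C * w) - steps_fun (bernoulli_steps t n) w))); last first.
  by move=> s _; ring.
have bd : cabs (I (fun w => G w * (cexp ((- t)%:C * w) - steps_fun (bernoulli_steps t n) w))) <=
    K * d + K * d.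
  rewrite contourE; apply: cint_bound.
    have h1 : ccont (fun s => cexp ((- t)%:C * gamma s) - steps_fun (bernoulli_steps t n) (gamma s)).
      by apply: ccontD ce _; apply: ccontN; exact: cn.
    by have h2 := ccontM cG h1; move: h2; congr (ccont _); apply/funext => s; ring.
  move=> s s01.
  rewrite (_ : _ * velocity gamma s = (G (gamma s) * velocity gamma s) *
    (cexp ((- t)%:C * gamma s) - steps_fun (bernoulli_steps t n) (gamma s))); last by ring.
  apply: le_trans (cabsM _ _) _; apply: ler_pM; rewrite ?cabs_ge0 ?hK //.
  rewrite bernoulli_stepsE -[X in cabs X]opprB /cabs cReN cImN !normrN -/(cabs _).
  by apply: hm => //; exact: hB.
apply: le_trans (_ : cabs (q * I (fun w => G w * (cexp ((- t)%:C * w) - steps_fun (bernoulli_steps t n) w))) <= _).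
  by rewrite /cabs lerDl.
apply: le_trans (cabsM _ _) _; apply: le_trans (ler_wpM2l q0 bd) _.
apply: le_trans (_ : (cabs q + 1) * ((K + 1) * d + (K + 1) * d) <= _).
  have Kd : K * d <= (K + 1) * d by rewrite ler_wpM2r ?lerDl // ltW.
  have Kd0 : 0 <= K * d by rewrite mulr_ge0 // ltW.
  by apply: ler_pM; [exact: q0|exact: addr_ge0|rewrite lerDl|exact: lerD].
rewrite le_eqVlt; apply/orP; left; apply/eqP; rewrite /d; field.
by rewrite !gt_eqF.
Unshelve. all: by end_near. Qed.

End ExponentialKernel.

(** * Limits of kernels and of edge determinants *)

Section KernelLimit.
Variables (R : realType) (a : nat -> R) (c : R).
Hypothesis ac : forall u, 0 <= (a u)^-1 <= c.

Lemma cvg_norm_le (f : nat -> R) (l K : R) : f @ \oo --> l ->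
  (\forall n \near \oo, `|f n| <= K) -> `|l| <= K.
Proof.
move=> fl fK; apply/ler_addgt0Pr => e e0; near \oo => n.
have h1 : `|l - f n| <= e by near: n; move/cvgrPdist_le: fl => /(_ _ e0).
have h2 : `|f n| <= K by near: n.
by rewrite -(subrK (f n) l) (le_trans (ler_normD _ _)) // addrC lerD.
Unshelve. all: by end_near. Qed.

Lemma cvg_sumn (f : nat -> nat -> R) (g : nat -> R) M : (forall y, f ^~ y @ \oo --> g y) ->
  (fun n => \sum_(y < M) f n y) @ \oo --> \sum_(y < M) g y.
Proof.
by move=> fg; apply: (@cvg_big _ _ _ _ _ (@add_continuous _)) => y _; exact: fg.
Qed.

Lemma pairing_tail (g h : nat -> R) (D rho : R) M : 0 < rho < 1 -> 0 <= D ->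
    (forall y, `|g y * h y| <= D * rho ^+ y) -> cvgn (fun M => \sum_(y < M) g y * h y) ->
  `|pairing g h - \sum_(y < M) g y * h y| <= D / (1 - rho) * rho ^+ M.
Proof.
move=> r01 D0 gh cv; have [r0 r1] := andP r01.
have lim : (fun m => \sum_(y < m) g y * h y - \sum_(y < M) g y * h y) @ \oo -->
    pairing g h - \sum_(y < M) g y * h y by apply: cvgB; [exact: cv|exact: cvg_cst].
apply: (cvg_norm_le lim).
near=> m; have Mm : (M <= m)%N by near: m; exact: nbhs_infty_ge.
rewrite -!(big_mkord xpredT (fun y => g y * h y)) (big_cat_nat (n := M)) //=.
rewrite addrAC subrr add0r; apply: le_trans (ler_norm_sum _ _ _) _.
apply: le_trans (_ : \sum_(M <= y < m) D * rho ^+ y <= _); first exact: ler_sum.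
rewrite -mulr_sumr -mulrA ler_wpM2l // -{1}[M]add0n big_addn.
apply: le_trans (_ : rho ^+ M * \sum_(0 <= y < m - M) rho ^+ y <= _).
  by rewrite mulr_sumr; apply: ler_sum => y _; rewrite exprD mulrC.
by rewrite mulrC ler_wpM2r ?exprn_ge0 ?(ltW r0) // sum_geo_le.
Unshelve. all: by end_near. Qed.

(** Dominated convergence: the common geometric bound makes the tails uniformly small, and the
    finite sums converge term by term. *)
Lemma pairing_limit (g : nat -> R) (h_ : nat -> nat -> R) (h : nat -> R) (C r : R) :
    0 < r < 1 -> poly_bounded g -> (forall n y, `|h_ n y| <= C * r ^+ y) ->
    (forall y, h_ ^~ y @ \oo --> h y) ->
  (fun n => pairing g (h_ n)) @ \oo --> pairing g h.
Proof.
move=> r01 gp hC cv.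
have hC' y : `|h y| <= C * r ^+ y.
  by apply: (cvg_norm_le (cv y)); apply: nearW => n; exact: hC.
have C0 : 0 <= C by have := hC' 0%N; rewrite expr0 mulr1; exact: le_trans.
have [D [p [D0 gD]]] := gp.
have [D' [rho [D'0 rho01 hD']]] := poly_geo_bound p r01.
have [rho0 rho1] := andP rho01.
have B (k : nat -> R) : (forall y, `|k y| <= C * r ^+ y) ->
    forall y, `|g y * k y| <= (D * C * D') * rho ^+ y.
  move=> kC y; rewrite normrM; apply: le_trans (ler_pM _ _ (gD y) (kC y)) _ => //.
  rewrite [leLHS](_ : _ = D * C * (y.+1%:R ^+ p * r ^+ y)); last by ring.
  by rewrite -[leRHS]mulrA ler_wpM2l ?mulr_ge0.
pose K := D * C * D' / (1 - rho).
have K0 : 0 <= K by rewrite divr_ge0 ?mulr_ge0 // subr_ge0 ltW.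
have tail (k : nat -> R) M : (forall y, `|k y| <= C * r ^+ y) ->
    `|pairing g k - \sum_(y < M) g y * k y| <= K * rho ^+ M.
  move=> kC; apply: pairing_tail => //; rewrite ?mulr_ge0 //; first exact: B.
  by apply/cvg_ex; eexists; exact: cvg_pairing r01 gp kC.
apply/cvgrPdist_le => e e0.
have e3 : 0 < e / 3 by rewrite divr_gt0.
have [M KM] : exists M, K * rho ^+ M <= e / 3.
  have cK : (fun M => K * rho ^+ M) @ \oo --> K * 0.
    by apply: cvgM; [exact: cvg_cst|apply: cvg_expr; rewrite gtr0_norm].
  rewrite mulr0 in cK; move/cvgrPdist_le: cK => /(_ _ e3) [M _ hM]; exists M.
  have := hM M (leqnn M); rewrite /= sub0r normrN; apply: le_trans; exact: ler_norm.
have cs : (fun n => \sum_(y < M) g y * h_ n y) @ \oo --> \sum_(y < M) g y * h y.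
  have hy y : (fun n => g y * h_ n y) @ \oo --> g y * h y.
    by apply: cvgM; [exact: cvg_cst|exact: cv].
  exact: (@cvg_sumn _ (fun y => g y * h y) M hy).
near=> n.
have t1 := tail h M hC'; have t2 := tail (h_ n) M (hC n).
have t3 : `|\sum_(y < M) g y * h y - \sum_(y < M) g y * h_ n y| <= e / 3.
  by near: n; move/cvgrPdist_le: cs => /(_ _ e3).
move: t1 t2 t3 KM; rewrite !ler_norml => /andP[x1 x2] /andP[x3 x4] /andP[x5 x6] KM.
by apply/andP; split; lra.
Unshelve. all: by end_near. Qed.

Variables (T_ : nat -> nat -> nat -> R) (T : nat -> nat -> R) (r C : R).
Hypothesis r01 : 0 < r < 1.
Hypothesis C0 : 0 <= C.
Hypothesis law_ : forall n, kernel_law a (T_ n).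
Hypothesis geo_ : forall n, geo_bound (T_ n) r C.
Hypothesis T_cvg : forall x y, (fun n => T_ n x y) @ \oo --> T x y.

Let row n x y : `|T_ n x y| <= C * (r ^+ x)^-1 * r ^+ y.
Proof.
have [r0 _] := andP r01.
have up : upper (T_ n) by move=> u v; exact: (kernel_tri (law_ n)).
exact: (geo_bound_row up r0 C0 (@geo_ n) x y).
Qed.

Lemma act_limit k x : poly_bounded k -> (fun n => act (T_ n) k x) @ \oo --> act T k x.
Proof. move=> kp; apply: (@pairing_limit k (fun n => T_ n x) (T x) (C * (r ^+ x)^-1) r r01 kp).
  by move=> n y; exact: row.
by move=> y; exact: T_cvg. Qed.

(** The four properties survive because [r] and [C] do not depend on [n]; mass 1 is the pairing with
    the constant 1. *)
Lemma kernel_law_limit : kernel_law a T.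
Proof.
split.
- move=> x y yx; rewrite -(cvg_lim _ (@T_cvg x y)) //; apply: cvg_lim => //.
  rewrite (_ : (fun n => _) = fun=> 0); first exact: cvg_cst.
  by apply: funext => n; rewrite (kernel_tri (law_ n)).
- move=> x y.
  have l1 : (fun n => a x * fdiff ((T_ n)^~ y) x) @ \oo --> a x * fdiff (T^~ y) x.
    by apply: cvgM; [exact: cvg_cst|apply: cvgB; exact: T_cvg].
  have l2 : (fun n => (if y is y'.+1 then a y' * T_ n x y' else 0) - a y * T_ n x y) @ \oo -->
      (if y is y'.+1 then a y' * T x y' else 0) - a y * T x y.
    apply: cvgB; last by apply: cvgM; [exact: cvg_cst|exact: T_cvg].
    by case: y {l1} => [|y]; [exact: cvg_cst|apply: cvgM; [exact: cvg_cst|exact: T_cvg]].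
  rewrite -(cvg_lim _ l1) // -(cvg_lim _ l2) //; congr (limn _).
  by apply: funext => n; rewrite (kernel_comm (law_ n)).
- exists r; split=> // x; exists (C * (r ^+ x)^-1) => y.
  by apply: (cvg_norm_le (@T_cvg x y)); apply: nearW => n; exact: row.
- move=> x; have l := @act_limit (fun=> 1) x (poly_bounded_cst 1).
  rewrite -[LHS](cvg_lim _ l) //; apply: cvg_lim => //.
  rewrite (_ : (fun n => _) = fun=> 1); first exact: cvg_cst.
  by apply: funext => n; exact: kernel_total (law_ n) x.
Qed.

Lemma iter_lgen_limit s (f_ : nat -> nat -> R) f m u : (forall x, f_ ^~ x @ \oo --> f x) ->
  (fun n => iter m (lgen a s) (f_ n) u) @ \oo --> iter m (lgen a s) f u.
Proof.
move=> ff; elim: m u => [|m IH] u; first exact: ff.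
rewrite iterS /lgen /fdiff; apply: cvgM; first exact: cvg_cst.
apply: cvgM; first exact: cvg_cst.
by apply: cvgB; exact: IH.
Qed.

Lemma family_limit s (ker : nat -> nat -> nat -> R) (v : nat -> nat) i j u :
    (forall k w, poly_bounded (ker k w)) ->
  (fun n => det_family a s (fun k w => act (T_ n) (ker k w)) v i j u) @ \oo -->
  det_family a s (fun k w => act T (ker k w)) v i j u.
Proof.
move=> kp; rewrite /det_family; case: leqP => _; last exact: act_limit.
by apply: iter_lgen_limit => x; exact: act_limit.
Qed.

Lemma right_det_limit N v x :
  (fun n => right_det a N (T_ n) v x) @ \oo --> right_det a N T v x.
Proof.
rewrite /right_det /det_fun; case: eqP => _; last exact: cvg_cst.
apply: cvg_det => i j; rewrite mxE; under eq_fun do rewrite mxE.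
by apply: family_limit; exact: right_ker_poly_bounded.
Qed.

Lemma left_det_limit N v x :
  (fun n => left_det a N (T_ n) v x) @ \oo --> left_det a N T v x.
Proof.
rewrite /left_det /det_fun; case: eqP => _; last exact: cvg_cst.
apply: cvg_det => i j; rewrite mxE; under eq_fun do rewrite mxE.
by apply: family_limit; exact: left_ker_poly_bounded ac.
Qed.

End KernelLimit.

(** * Bit updates and the ringing of one clock *)

Section BitUpdates.
Variables (R : realType) (N : nat).
Implicit Types (x y : N.-tuple nat) (s : seq bool) (l : seq nat).

Lemma size_right_bits q l s : size (right_bits q l s) = size l.
Proof. by elim: l q s => //= u l IH q s; rewrite IH. Qed.

Lemma size_left_bits q l s : size (left_bits q l s) = size l.
Proof. by elim: l q s => //= u l IH q s; rewrite IH. Qed.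

Definition right_bit_update x s : N.-tuple nat :=
  [tuple nth 0%N (right_bits 0 x s) i | i < N].

(** One site above the leader: a barrier that a unit jump does not feel. *)
Definition leader_bound l : nat := (head 0 l).+1.

Definition left_bit_update y s : N.-tuple nat :=
  [tuple nth 0%N (rev (left_bits (leader_bound (rev y)) (rev y) s)) i | i < N].

Lemma mktuple_nth l : size l = N -> [tuple nth 0%N l i | i < N] = l :> seq nat.
Proof.
move=> sl; apply: (@eq_from_nth _ 0%N); first by rewrite size_tuple sl.
move=> i; rewrite size_tuple => iN; rewrite -[X in nth _ _ X]/(nat_of_ord (Ordinal iN)).
by rewrite -tnth_nth tnth_mktuple.
Qed.

Lemma right_bit_updateE x s : right_bit_update x s = right_bits 0 x s :> seq nat.
Proof. by apply: mktuple_nth; rewrite size_right_bits size_tuple. Qed.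

Lemma left_bit_updateE y s :
  rev (left_bit_update y s) = left_bits (leader_bound (rev y)) (rev y) s.
Proof.
rewrite /left_bit_update mktuple_nth ?revK // size_rev size_left_bits size_rev.
by rewrite size_tuple.
Qed.

Lemma right_bits_ge q l s : all (leq q) (right_bits q l s) /\ sorted ltn (right_bits q l s).
Proof.
elim: l q s => [//|u l IH] q s /=; set w := maxn _ _.
have [a1 s1] := IH w.+1 (behead s); rewrite path_sortedE; last exact: ltn_trans.
rewrite a1 s1 leq_maxl; split=> //=; apply/allP => z /(allP a1) /= h.
by apply: leq_trans (ltnW h); exact: leq_maxl.
Qed.

(** A list of bits is a Bernoulli noise that depends on the particle only; this gives access to
    [sweep_rightE]. *)
Lemma right_bits_sweep (th : R) q l s n :
  right_bits q l (drop n s) =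
  sweep RightEdge (Bernoulli th) (fun m _ => nth false s m : nat) n (Some q) l.
Proof.
elim: l q n => [//|u l IH] q n; cbn [right_bits sweep].
have -> : head false (drop n s) = nth false s n by rewrite -nth0 nth_drop addn0.
by rewrite -IH -(drop1 (drop n s)) drop_drop add1n.
Qed.

Lemma left_bits_sweep (th : R) q l s n :
  left_bits q l (drop n s) =
  sweep LeftEdge (Bernoulli th) (fun m _ => nth false s m : nat) n (Some q) l.
Proof.
elim: l q n => [//|u l IH] q n; cbn [left_bits sweep].
have -> : head false (drop n s) = nth false s n by rewrite -nth0 nth_drop addn0.
by rewrite -IH -(drop1 (drop n s)) drop_drop add1n.
Qed.

Lemma nth_one_bit n m : (n < N)%N -> nth false (one_bit n N) m = (m == n).
Proof.
move=> nN; rewrite /one_bit nth_cat size_nseq; case: ltngtP => [mn|nm|->].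
- by rewrite nth_nseq mn.
- have [k ->] : exists k, m = (n + k.+1)%N by exists (m - n.+1)%N; lia.
  by rewrite addKn /= nth_nseq if_same.
- by rewrite subnn.
Qed.

Lemma right_push_bounds n (z : nat -> nat) m : (z m <= right_push n z m <= (z m).+1)%N.
Proof. by case: m => [|m] /=; do ![case: ifP => _]; lia. Qed.

(** With only bit [n] set, a particle beyond [n] moves exactly when its predecessor lands on it, so
    the maxima in the Bernoulli update reproduce the chain of pushes. *)
Lemma right_bernoulli_one n (z : nat -> nat) i :
    (forall j, (j < i)%N -> (z j < z j.+1)%N) ->
  right_bernoulli (fun m _ => (m == n) : nat) z i = right_push n z i.
Proof.
elim: i => [|i IH] zi.
  by rewrite /=; case: ltngtP => _; rewrite ?addn0 ?addn1 //; lia.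
rewrite /= IH; last by move=> j ji; apply: zi; exact: ltnW.
have zz := zi i (leqnn _); have /andP[b1 b2] := right_push_bounds n z i.
case: ltngtP => [lt|gt|e].
- have -> : right_push n z i = z i by case: (i) lt => [|j] lt /=; rewrite ifT //; lia.
  by lia.
- by case: eqP => h; lia.
- have -> : right_push n z i = z i by rewrite -e; case: (i) => [|j] //=; rewrite ltnS leqnn.
  by lia.
Qed.

Lemma left_bernoulli_one n (z : nat -> nat) i :
    (forall j, (j < i)%N -> (z j.+1 <= z j)%N) ->
  left_bernoulli (fun m _ => (m == n) : nat) z i = left_block n z i.
Proof.
move=> zi; have low j : (j <= i)%N -> (z j <= left_bernoulli (fun m _ => (m == n) : nat) z j)%N.
  elim: j => [|j IH] ji /=; first by lia.
  by have := zi j ji; have := IH (ltnW ji); lia.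
have before j : (j < n)%N -> (j <= i)%N -> left_bernoulli (fun m _ => (m == n) : nat) z j = z j.
  elim: j => [|j IH] jn ji /=; first by rewrite ltn_eqF // addn0.
  by rewrite IH ?ltn_eqF //; [have := zi j ji; lia|exact: ltnW|exact: ltnW].
rewrite /left_block; case: eqP => [e|ne].
  case: n before e {low} => [|n] before e; first by rewrite e /= addn1.
  rewrite e /= eqxx before ?ltnS //; last by lia.
  by have := zi n; rewrite e => /(_ (leqnn _)); case: eqP => h; lia.
case: i zi low before ne => [|i] zi low before ne /=; first by case: eqP => //; lia.
have -> : (i.+1 == n) = false by apply/eqP.
by have := low i (leqnSn i); have := zi i (leqnn _); lia.
Qed.

Lemma right_update_none x : @weyl N x -> right_bit_update x (no_bit N) = x.
Proof.
move=> xW; apply: val_inj; rewrite /= right_bit_updateE -[RHS](cascade0 xW).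
rewrite -{2}(size_tuple x); elim: (tval x) 0%N => [//|u l IH] q /=.
by rewrite addn0 IH.
Qed.

Lemma right_update_one x (n : 'I_N) : @weyl N x ->
  right_bit_update x (one_bit n N) = right_ring n x.
Proof.
move=> xW; suff: tval (right_bit_update x (one_bit n N)) = tval (right_ring n x) by move/val_inj.
rewrite right_bit_updateE -[one_bit n N]drop0 (right_bits_sweep 0).
have -> : (fun m (_ : nat) => nth false (one_bit n N) m : nat) = fun m _ => (m == n) : nat.
  by apply: funext => m; apply: funext => _; rewrite nth_one_bit.
have -> l st xi : sweep RightEdge st xi 0 (Some 0%N) l = sweep RightEdge st xi 0 None l :> seq nat.
  by case: l.
have := sweep_rightE (Bernoulli (0 : R)) (fun m _ => (m == n) : nat) x 0.
rewrite drop0 subn0 size_tuple => ->.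
apply: (@eq_from_nth _ 0%N); first by rewrite size_map size_iota size_tuple.
move=> i; rewrite size_map size_iota => iN; rewrite (nth_map 0%N) ?size_iota // nth_iota //=.
rewrite right_bernoulli_one; last first.
  by move=> j ji; apply: (sortedP 0%N xW); rewrite size_tuple; lia.
by rewrite (nth_map n) ?size_enum_ord // nth_enum_ord.
Qed.

Lemma left_bits_none p l : path geq p l -> left_bits p l (no_bit (size l)) = l.
Proof.
elim: l p => [//|u l IH] p /= /andP[up pl]; rewrite addn0.
have -> : minn p u = u by apply/minn_idPr.
by rewrite IH.
Qed.

Lemma leader_boundP l : sorted geq l -> path geq (leader_bound l) l /\ all (ltn^~ (leader_bound l)) l.
Proof.
case: l => [//|u l] /= sl; rewrite sl andbT ltnS leqnn leqnSn; split=> //=.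
move: sl; rewrite path_sortedE; last by move=> x y z /=; lia.
by move=> /andP[/allP ul _]; apply/allP => z /ul /=; rewrite /leader_bound /=; lia.
Qed.

Lemma rev_weyl_closed y : @weyl_closed N y -> sorted geq (rev y).
Proof. by rewrite /weyl_closed /= => yW; rewrite rev_sorted. Qed.

Lemma left_update_none y : @weyl_closed N y -> left_bit_update y (no_bit N) = y.
Proof.
move=> yW; apply/val_inj/(can_inj revK); rewrite /= left_bit_updateE.
have [pl _] := leader_boundP (rev_weyl_closed yW).
by rewrite -[in RHS](left_bits_none pl) size_rev size_tuple.
Qed.

Lemma left_update_one y (n : 'I_N) : @weyl_closed N y ->
  left_bit_update y (one_bit n N) = left_ring n y.
Proof.
move=> yW; suff: rev (left_bit_update y (one_bit n N)) = rev (left_ring n y).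
  by move=> /(can_inj revK)/val_inj.
rewrite left_bit_updateE; have sl := rev_weyl_closed yW.
rewrite -[one_bit n N]drop0 (left_bits_sweep 0).
have -> : (fun m (_ : nat) => nth false (one_bit n N) m : nat) = fun m _ => (m == n) : nat.
  by apply: funext => m; apply: funext => _; rewrite nth_one_bit.
have -> l : sweep LeftEdge (Bernoulli (0 : R)) (fun m _ => (m == n) : nat) 0 (Some (leader_bound l)) l =
    sweep LeftEdge (Bernoulli (0 : R)) (fun m _ => (m == n) : nat) 0 None l.
  case: l => [//|u l]; cbn [sweep]; rewrite /landing /noise_site /leader_bound /=.
  by rewrite (_ : minn u.+1 _ = u + (0%N == n))%N //; case: (0%N == n); lia.
have := sweep_leftE (Bernoulli (0 : R)) (fun m _ => (m == n) : nat) (rev y) 0.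
rewrite drop0 subn0 size_rev size_tuple => ->.
apply: (@eq_from_nth _ 0%N); first by rewrite size_map size_iota size_rev size_tuple.
move=> i; rewrite size_map size_iota => iN; rewrite (nth_map 0%N) ?size_iota // nth_iota //=.
rewrite left_bernoulli_one; last first.
  move=> j ji; have := sortedP 0%N sl; rewrite size_rev size_tuple => /(_ j); apply; lia.
rewrite nth_rev size_map size_enum_ord //; have iN' : (N - i.+1 < N)%N by lia.
by rewrite (nth_map n) ?size_enum_ord // nth_enum_ord //; congr left_block; lia.
Qed.

Lemma right_update_weyl x s : @weyl N (right_bit_update x s).
Proof. by rewrite /weyl /= right_bit_updateE; have [] := right_bits_ge 0 x s. Qed.

Lemma left_update_weyl y s : @weyl_closed N (left_bit_update y s).
Proof.
have [h _] := left_bits_sorted (leader_bound (rev y)) (rev y) s.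
by rewrite /weyl_closed /= -[X in sorted _ X]revK left_bit_updateE rev_sorted.
Qed.

End BitUpdates.

(** * Conclusion *)

Section Claims.
Variables (R : realType) (a : nat -> R) (c b : R).
Hypothesis ac : forall u, 0 <= (a u)^-1 <= c.
Hypothesis a0 : forall u, 0 < a u.
Hypothesis ab : forall u, a u <= b.
Variables (N : nat) (x y : N.-tuple nat).
Hypothesis xW : @weyl N x.
Hypothesis yW : @weyl_closed N y.
Variable gamma : R -> complex R.

Lemma In_map_pred (T U : Type) (P : U -> Prop) (f : T -> U) (r : seq T) :
  (forall k, P (f k)) -> forall u, List.In u [seq f k | k <- r] -> P u.
Proof. by move=> Pf; elim: r => [//|k r IH] u /= [<-//|]; exact: IH. Qed.

Let abN u : `|a u| <= b. Proof. by rewrite gtr0_norm. Qed.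
Let anz u : a u != 0. Proof. by rewrite gt_eqF. Qed.

Lemma discrete_claims (st : nat -> step R) s t : (forall k, nonneg_step (st k)) ->
    admissible_contour a (discrete_f st s t) gamma ->
  forall d (Omega : measurableType d) (P : probability Omega R)
    (xi : nat * nat * nat -> Omega -> nat), is_noise P a st xi ->
  right_edge_claim a (Tf a gamma (discrete_f st s t)) x (E_right_discrete P st xi s t x)
  /\ left_edge_claim a (Tf a gamma (discrete_f st s t)) y (E_left_discrete P st xi s t y).
Proof.
move=> nn adm d Omega P xi noise.
have nz k be u : st k = Geometric be -> 1 + be * a u != 0.
  move=> stk; have := nn k; rewrite stk => /= be0.
  by rewrite gt_eqF // ltr_pwDl // mulr_ge0 // ltW.
have [gcc [_ enc]] := adm.
have pf : all_pole_free gamma [seq st k | k <- index_iota s t].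
  apply: (admissible_pole_free (a := a)); first exact: In_map_pred.
  by rewrite -discrete_fE.
have law := kernel_law_Tf gcc a0 ab enc pf.
rewrite discrete_fE; split.
  apply: (right_claim ac anz abN law) => v vW.
  have vM := max_above (ltnSn (\max_(u <- v) u)).
  rewrite (E_right_discreteE noise nz _ _ _ vM).
  by rewrite (edge_prob_right a0 ab gcc enc vM (size_tuple v) pf vW (size_tuple x) xW).
apply: (left_claim ac anz abN law) => v vW.
set M := (\max_(u <- v) u + \max_(u <- y) u).+1.
have vM : all (ltn^~ M) v by apply: max_above; rewrite ltnS leq_addr.
have yM : all (ltn^~ M) (rev y) by rewrite all_rev; apply: max_above; rewrite ltnS leq_addl.
rewrite (E_left_discreteE noise nz _ _ vM (rev_weyl_closed yW)).
have rvM : all (ltn^~ M) (rev v) by rewrite all_rev.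
have sr (w : N.-tuple nat) : size (rev w) = N by rewrite size_rev size_tuple.
by rewrite (edge_prob_left ac a0 ab gcc enc rvM (sr v) pf (rev_weyl_closed vW) (sr y)
  (rev_weyl_closed yW) yM).
Qed.

Hypothesis gcc : closed_curve gamma.
Hypothesis enc : forall u, encircles gamma (a u)%:C.
Local Notation T sts := (Tf a gamma (steps_fun sts)).

Let pfb h m : all_pole_free gamma (nseq m (Bernoulli h)).
Proof. exact: all_pole_free_bernoulli. Qed.

Lemma geo_bound_nseq (h r : R) m : 0 < r ->
  geo_bound (T (nseq m (Bernoulli h))) r ((1 + `|h| * (b * (r^-1 + 1))) ^+ m).
Proof.
move=> r0; have b0 : 0 < b by apply: lt_le_trans (ab 0%N).
have B0 : 0 <= 1 + `|h| * (b * (r^-1 + 1)).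
  by rewrite addr_ge0 // !mulr_ge0 ?addr_ge0 ?invr_ge0 // ltW.
elim: m => [|m IH]; first by rewrite expr0; apply: geo_bound_delta (ltW r0).
rewrite exprSr; apply: (geo_bound_bernoulli a0 ab _ r0 _ _ IH).
- exact: (upper_Tf gcc a0 enc (@pfb h m)).
- exact: exprn_ge0.
- by move=> u v; apply: Tf_bernoulli => //; exact: pfb.
Qed.

(** Each of the [n + 1] steps costs a factor 1 plus a constant times [t / (n + 1)], and the product
    stays below an exponential independent of [n]. *)
Lemma bernoulli_steps_geo_bound t : 0 <= t ->
  exists2 C, 0 <= C & forall n, geo_bound (T (bernoulli_steps t n)) 2^-1 C.
Proof.
move=> t0; have b0 : 0 < b by apply: lt_le_trans (ab 0%N).
exists (expR (t * (b * (2^-1^-1 + 1)))); first exact: expR_ge0.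
have h2 : 0 < 2^-1 :> R by rewrite invr_gt0.
move=> n u k; apply: le_trans (@geo_bound_nseq (t / n.+1%:R) 2^-1 n.+1 h2 u k) _.
rewrite ler_wpM2r ?exprn_ge0 ?invr_ge0 // ger0_norm ?divr_ge0 //.
rewrite mulrAC; apply: exp_power_bound.
by rewrite !mulr_ge0 ?addr_ge0 ?invr_ge0 // ltW.
Qed.

Let law m h : kernel_law a (T (nseq m (Bernoulli h))).
Proof. exact: (kernel_law_Tf gcc a0 ab enc (@pfb h m)). Qed.

(** By the Neumann relation [bits_mean_right] replaces pushed moves by independent ones, and
    [shift_all_right] then adds one Bernoulli factor to the kernel. *)
Lemma bits_walk_right h v m w : @weyl N v -> @weyl N w ->
  bits_walk a (fun x : N.-tuple nat => x : seq nat) (@right_bit_update N) h v m w =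
  right_det a N (T (nseq m (Bernoulli h))) v w.
Proof.
move=> vW; elim: m w => [|m IH] w wW.
  have vM := max_above (ltnSn (\max_(u <- v) u)).
  by rewrite -(edge_prob_right a0 ab gcc enc vM (size_tuple v) (@pfb h 0%N) vW (size_tuple w) wW).
have step u z := Tf_bernoulli gcc a0 enc h u z (@pfb h m).
rewrite /bits_walk iterS -/(bits_walk _ _ _ h v m) /bits_step.
rewrite (eq_bits_mean _ _ _ (G := fun s => right_det a N (T (nseq m (Bernoulli h))) v (right_bits 0 w s))).
  rewrite (bits_mean_right a h (right_det_neumann a0 ab N v (law m h)) wW).
  by rewrite (shift_all_right _ _ (law m h) step).
move=> s; rewrite IH; last exact: right_update_weyl.
by rewrite right_bit_updateE.
Qed.

Lemma bits_walk_left h v m w : @weyl_closed N v -> @weyl_closed N w ->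
  bits_walk a (fun x : N.-tuple nat => rev x) (@left_bit_update N) h v m w =
  left_det a N (T (nseq m (Bernoulli h))) (rev v) (rev w).
Proof.
move=> vW; elim: m w => [|m IH] w wW.
  set M := (\max_(u <- v) u + \max_(u <- w) u).+1.
  have vM : all (ltn^~ M) (rev v) by rewrite all_rev; apply: max_above; rewrite ltnS leq_addr.
  have wM : all (ltn^~ M) (rev w) by rewrite all_rev; apply: max_above; rewrite ltnS leq_addl.
  have sr (z : N.-tuple nat) : size (rev z) = N by rewrite size_rev size_tuple.
  rewrite -(edge_prob_left ac a0 ab gcc enc vM (sr v) (@pfb h 0%N) (rev_weyl_closed vW) (sr w)
    (rev_weyl_closed wW) wM).
  by rewrite /= (inj_eq (can_inj revK)).
have step u z := Tf_bernoulli gcc a0 enc h u z (@pfb h m).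
have sw := rev_weyl_closed wW; have [_ aw] := leader_boundP sw.
rewrite /bits_walk iterS -/(bits_walk _ _ _ h v m) /bits_step.
rewrite (eq_bits_mean _ _ _ (G := fun s => left_det a N (T (nseq m (Bernoulli h))) (rev v)
   (left_bits (leader_bound (rev w)) (rev w) s))).
  rewrite (bits_mean_left a h (left_det_neumann ac a0 ab N (rev v) (law m h)) sw aw).
  by rewrite (shift_all_left ac _ _ (law m h) step).
move=> s; rewrite IH; last exact: left_update_weyl.
by rewrite left_bit_updateE.
Qed.

(** One sequence has two limits: as edge determinants of Bernoulli products it converges along with
    the kernels, as bit walks it converges to the transition function. *)
Lemma continuous_claims (s t : R) pr pl : s <= t ->
    is_right_transition a pr -> is_left_transition a pl ->
  right_edge_claim a (Tf a gamma (continuous_f s t)) x (pr (t - s) x)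
  /\ left_edge_claim a (Tf a gamma (continuous_f s t)) y (pl (t - s) y).
Proof.
move=> st hr hl; pose u := t - s; have u0 : 0 <= u by rewrite subr_ge0.
have -> : continuous_f s t = fun w => cexp ((- u)%:C * w).
  by apply: funext => w; rewrite /continuous_f rmorphN mulNr.
set F := fun w => _; have [C C0 hC] := bernoulli_steps_geo_bound u0.
have r01 : (0 < 2^-1 :> R) && (2^-1 < 1 :> R) by rewrite invr_gt0 ltr0n invf_lt1 ?ltr1n ?ltr0n.
have lim u' v' : (fun n => T (bernoulli_steps u n) u' v') @ \oo --> Tf a gamma F u' v'.
  exact: Tf_exp_limit.
have law_ n : kernel_law a (T (bernoulli_steps u n)) by exact: law.
have Tl : kernel_law a (Tf a gamma F) := kernel_law_limit r01 C0 law_ hC lim.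
have a0' v : 0 <= a v by exact: ltW.
split.
  apply: (right_claim ac anz abN Tl) => v vW.
  have l1 : (fun n => right_det a N (T (bernoulli_steps u n)) v x) @ \oo -->
      right_det a N (Tf a gamma F) v x.
    exact: (right_det_limit r01 C0 law_ hC lim).
  have l2 : (fun n => bits_walk a (fun x : N.-tuple nat => x : seq nat) (@right_bit_update N)
      (u / n.+1%:R) v n.+1 x) @ \oo --> pr u x v.
    apply: (bits_walk_cvg hr _ a0' ab) => //.
    - by move=> n z zW; rewrite -right_update_one //; exact: right_update_weyl.
    - by move=> z; rewrite size_tuple.
    - by move=> z s' _; exact: right_update_weyl.
    - exact: right_update_none.
    - by move=> z n zW; exact: right_update_one.
  rewrite -(cvg_lim _ l1) // -(cvg_lim _ l2) //; congr (limn _).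
  by apply: funext => n; rewrite bits_walk_right.
apply: (left_claim ac anz abN Tl) => v vW.
have l1 : (fun n => left_det a N (T (bernoulli_steps u n)) (rev v) (rev y)) @ \oo -->
    left_det a N (Tf a gamma F) (rev v) (rev y).
  exact: (left_det_limit ac r01 C0 law_ hC lim).
have l2 : (fun n => bits_walk a (fun x : N.-tuple nat => rev x) (@left_bit_update N)
    (u / n.+1%:R) v n.+1 y) @ \oo --> pl u y v.
  apply: (bits_walk_cvg hl _ a0' ab) => //.
  - by move=> n z zW; rewrite -left_update_one //; exact: left_update_weyl.
  - by move=> z; rewrite size_rev size_tuple.
  - by move=> z s' _; exact: left_update_weyl.
  - exact: left_update_none.
  - by move=> z n zW; exact: left_update_one.
rewrite -(cvg_lim _ l1) // -(cvg_lim _ l2) //; congr (limn _).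
by apply: funext => n; rewrite bits_walk_left.
Qed.

End Claims.

Lemma range_bounds (R : realType) (a : nat -> R) : 0 < inf (range a) -> has_ubound (range a) ->
  [/\ forall u, inf (range a) <= a u, forall u, a u <= sup (range a) & forall u, 0 < a u].
Proof.
move=> i0 ub; have lb : has_lbound (range a).
  (* The infimum of a set without lower bound is 0 by convention, which contradicts positivity. *)
  apply: contrapT => nlb; move: i0; rewrite inf_out ?ltxx // => -[_ //].
have h1 u : inf (range a) <= a u by apply: ge_inf => //; exists u.
split=> // u; first by apply: ub_le_sup => //; exists u.
exact: lt_le_trans i0 _.
Qed.

Theorem theorem9p6 (R : realType) (a : nat -> R)
    (a_inf : 0 < inf (range a)) (a_sup : has_ubound (range a))
    (N : nat) (N_ge1 : (1 <= N)%N) (x y : N.-tuple nat)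
    (xW : @weyl N x) (yW : @weyl_closed N y) :
  (forall (st : nat -> step R), (forall k, step_ok a (st k)) ->
     forall (s t : nat), (s <= t)%N ->
     forall (gamma : R -> complex R),
       admissible_contour a (discrete_f st s t) gamma ->
     forall (d : measure_display) (Omega : measurableType d)
       (P : probability Omega R) (xi : nat * nat * nat -> Omega -> nat),
       is_noise P a st xi ->
     right_edge_claim a (Tf a gamma (discrete_f st s t)) x
       (E_right_discrete P st xi s t x)
     /\ left_edge_claim a (Tf a gamma (discrete_f st s t)) y
       (E_left_discrete P st xi s t y))
  /\
  (forall (s t : R), 0 <= s -> s <= t ->
     forall (gamma : R -> complex R),
       admissible_contour a (continuous_f s t) gamma ->
     forall (pr pl : R -> N.-tuple nat -> N.-tuple nat -> R),
       is_right_transition a pr -> is_left_transition a pl ->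
     right_edge_claim a (Tf a gamma (continuous_f s t)) x (pr (t - s) x)
     /\ left_edge_claim a (Tf a gamma (continuous_f s t)) y (pl (t - s) y)).
Proof.
have [lo hi a0] := range_bounds a_inf a_sup.
have ac u : 0 <= (a u)^-1 <= (inf (range a))^-1.
  by rewrite invr_ge0 ltW //= lef_pV2 ?posrE.
split=> [st stP s t _ gamma adm d Omega P xi noise|s t _ st gamma adm pr pl hr hl].
  by apply: (discrete_claims ac a0 hi xW yW _ adm noise) => k; exact: step_ok_nonneg (stP k).
have [gcc [_ enc]] := adm.
exact: (continuous_claims ac a0 hi xW yW gcc enc st hr hl).
Qed.
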